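(* Let $(M^n,g)$ be a compact connected Riemannian manifold with negative sectional curvature, and let $\omega$ be a Killing $2$-form on $M$ which is not identically zero. Then $\omega$ is parallel, and there is a non-zero real constant $c$ such that $c\,\omega$ is the fundamental $2$-form of a Kähler structure on $(M,g)$, i.e. $c\,\omega(X,Y)=g(JX,Y)$ for some $g$-compatible almost complex structure $J$ with $\nabla J=0$.
   Context: Let $\nabla$ be the Levi-Civita connection of $g$. A Killing $p$-form on $(M,g)$ is a differential $p$-form $\omega$ such that $\nabla\omega$ is totally skew-symmetric, equivalently $\nabla_X\omega=\frac{1}{p+1}\,\iota_X\,d\omega$ for every tangent vector $X$, where $\iota_X$ denotes the interior product. A form $\omega$ is parallel if $\nabla\omega=0$. *)

(* Defs.v *)
From HB Require Import structures.
From mathcomp Require Import all_boot all_order all_algebra.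
From mathcomp Require Import all_classical all_reals all_analysis.
From mathcomp Require Import ring.
Set Implicit Arguments.
Unset Strict Implicit.
Unset Printing Implicit Defensive.
Import Order.TTheory GRing.Theory Num.Theory.
Import numFieldNormedType.Exports.
Local Open Scope classical_set_scope.
Local Open Scope ring_scope.

(* MathComp-Analysis has no C^k functions of several variables; [Ck_on] is used
   only with U open, so that the directional derivatives are intrinsic to U. *)
Fixpoint Ck_on (R : realType) (n k : nat) (U : set 'rV[R]_n)
    (f : 'rV[R]_n -> R) : Prop :=
  (forall x, U x -> {for x, continuous f}) /\
  if k is k'.+1 then
    forall i : 'I_n,
      (forall x, U x -> derivable f x (delta_mx 0 i)) /\
      Ck_on k' U (fun x => 'D_(delta_mx 0 i) f x)
  else True.

Definition smooth_on (R : realType) (n : nat) (U : set 'rV[R]_n)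
  (f : 'rV[R]_n -> R) : Prop := forall k, Ck_on k U f.

Section SmoothOn.
Variables (R : realType) (n : nat) (U : set 'rV[R]_n).
Hypothesis oU : open U.
Implicit Types f g : 'rV[R]_n -> R.

Lemma eq_Ck_on k f g : (forall x, U x -> f x = g x) -> Ck_on k U f -> Ck_on k U g.
Proof.
elim: k f g => [|k IH] f g fg [cf df].
all: have nfg x : U x -> \forall y \near x, f y = g y
  by move=> Ux; apply: filterS (open_nbhs_nbhs (conj oU Ux)) => y /fg.
all: have cg x : U x -> {for x, continuous g}
  by move=> Ux; have : f @ x --> f x := cf x Ux; rewrite (fg x Ux);
     exact: cvg_trans (near_eq_cvg (nfg x Ux)).
  by split.
split=> // i; have [dfi Cf] := df i; split.
  by move=> x Ux; apply: near_eq_derivable (nfg x Ux) (dfi x Ux).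
by apply: IH Cf => x Ux; apply: near_eq_derive (nfg x Ux).
Qed.

Lemma Ck_onW k f : Ck_on k.+1 U f -> Ck_on k U f.
Proof.
elim: k f => [|k IH] f; first by case.
move=> H; case: (H) => cf df; split=> // i; have [dfi Cf] := df i.
by split=> //; apply: IH.
Qed.

Lemma Ck_on_cst k (a : R) : Ck_on k U (fun=> a).
Proof.
elim: k a => [|k IH] a; (split; first by move=> x _; exact: cst_continuous) => //.
move=> i; split; first by move=> x _; exact: derivable_cst.
by apply: eq_Ck_on (IH 0) => x Ux; rewrite derive_cst.
Qed.

Lemma Ck_onD k f g : Ck_on k U f -> Ck_on k U g -> Ck_on k U (fun x => f x + g x).
Proof.
elim: k f g => [|k IH] f g [cf df] [cg dg]; (split;
  first by move=> x Ux; apply: continuousD; [exact: cf|exact: cg]) => //.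
move=> i; have [dfi Cf] := df i; have [dgi Cg] := dg i; split.
  by move=> x Ux; apply: derivableD; [exact: dfi|exact: dgi].
apply: eq_Ck_on (IH _ _ Cf Cg) => x Ux.
by rewrite -deriveD; [|exact: dfi|exact: dgi].
Qed.

Lemma Ck_onM k f g : Ck_on k U f -> Ck_on k U g -> Ck_on k U (fun x => f x * g x).
Proof.
elim: k f g => [|k IH] f g Hf Hg; (split;
  first by move=> x Ux; apply: continuousM; [exact: Hf.1|exact: Hg.1]) => //.
move=> i; have [dfi Cf] := Hf.2 i; have [dgi Cg] := Hg.2 i; split.
  by move=> x Ux; apply: derivableM; [exact: dfi|exact: dgi].
apply: eq_Ck_on (Ck_onD (IH _ _ (Ck_onW Hf) Cg) (IH _ _ (Ck_onW Hg) Cf)) => x Ux.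
by rewrite deriveM//; [exact: dfi|exact: dgi].
Qed.

End SmoothOn.

(* The fields [chart_map] and [chart_inv] are total functions that matter only
   on [chart_dom] and on its image. *)
Record chart (R : realType) (n : nat) (M : topologicalType) := Chart {
  chart_dom : set M;
  chart_map : M -> 'rV[R]_n;
  chart_inv : 'rV[R]_n -> M;
  chart_dom_open : open chart_dom;
  chart_img_open : open (chart_map @` chart_dom);
  chart_mapK : forall p, chart_dom p -> chart_inv (chart_map p) = p;
  chart_map_continuous : forall p, chart_dom p -> {for p, continuous chart_map};
  chart_inv_continuous :
    forall x, (chart_map @` chart_dom) x -> {for x, continuous chart_inv} }.

Record smoothManifold (R : realType) (n : nat) := SmoothManifold {
  carrier :> topologicalType;
  manifold_hausdorff : hausdorff_space carrier;
  manifold_second_countable : @second_countable carrier;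
  atlas : set (chart R n carrier);
  atlas_cover : forall p : carrier, exists2 c, atlas c & chart_dom c p;
  atlas_compatible : forall c d, atlas c -> atlas d -> forall i : 'I_n,
    smooth_on (chart_map c @` (chart_dom c `&` chart_dom d))
              (fun x => chart_map d (chart_inv c x) 0 i) }.

Section SmoothFunctions.
Variables (R : realType) (n : nat) (M : smoothManifold R n).

Definition smooth (f : M -> R) : Prop :=
  forall c, atlas c -> smooth_on (chart_map c @` chart_dom c) (f \o chart_inv c).

Definition smooth_pred : {pred M -> R} := fun f => `[< smooth f >].

Lemma smooth_cst (a : R) : smooth (fun=> a).
Proof. by move=> c _ k; apply: Ck_on_cst; exact: chart_img_open. Qed.

Lemma smoothD (f g : M -> R) : smooth f -> smooth g -> smooth (fun p => f p + g p).
Proof.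
move=> sf sg c ac k.
exact (Ck_onD (@chart_img_open _ _ _ c) (sf c ac k) (sg c ac k)).
Qed.

Lemma smoothM (f g : M -> R) : smooth f -> smooth g -> smooth (fun p => f p * g p).
Proof.
move=> sf sg c ac k.
exact (Ck_onM (@chart_img_open _ _ _ c) (sf c ac k) (sg c ac k)).
Qed.

Lemma smooth_subring : subring_closed smooth_pred.
Proof.
split=> [|f g /asboolP sf /asboolP sg|f g /asboolP sf /asboolP sg]; apply/asboolP.
- exact: smooth_cst.
- have -> : f - g = fun p => f p + (-1) * g p.
    by apply/funext => p; rewrite mulN1r.
  by apply: smoothD => //; apply: smoothM => //; exact: smooth_cst.
- exact: smoothM.
Qed.

Lemma smooth_submod : submod_closed smooth_pred.
Proof.
split=> [|a f g /asboolP sf /asboolP sg]; apply/asboolP; first exact: smooth_cst.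
by apply: smoothD => //; apply: smoothM => //; exact: smooth_cst.
Qed.

HB.instance Definition _ :=
  GRing.isSubringClosed.Build (M -> R) smooth_pred smooth_subring.
HB.instance Definition _ :=
  GRing.isSubmodClosed.Build R (M -> R) smooth_pred smooth_submod.

(* The commutative R-algebra of smooth functions on M. *)
Record smoothFun := SmoothFun {
  smooth_val :> M -> R;
  smooth_valP : smooth_val \in smooth_pred }.

HB.instance Definition _ := [isSub for smooth_val].
HB.instance Definition _ := [Choice of smoothFun by <:].
HB.instance Definition _ :=
  GRing.SubChoice_isSubComPzRing.Build _ _ smoothFun (subringClosedP _).
HB.instance Definition _ := [SubZmodule_isSubLmodule of smoothFun by <:].

Definition mkSmooth (f : M -> R) (sf : smooth f) : smoothFun :=
  SmoothFun (asboolT sf).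

Lemma smoothFunP (f : smoothFun) : smooth f.
Proof. exact/asboolP/smooth_valP. Qed.

End SmoothFunctions.

Section TangentSpace.
Variables (R : realType) (n : nat) (M : smoothManifold R n) (p : M).

Definition derivation_at (v : smoothFun M -> R) : Prop :=
  (forall a f g, v (a *: f + g) = a * v f + v g) /\
  (forall f g, v (f * g) = v f * g p + f p * v g).

Definition derivation_pred : {pred smoothFun M -> R} :=
  fun v => `[< derivation_at v >].

Lemma derivation_submod : submod_closed derivation_pred.
Proof.
split=> [|b v w /asboolP[vl vm] /asboolP[wl wm]]; apply/asboolP; split.
- by move=> a f g; rewrite mulr0 addr0.
- by move=> f g; rewrite mul0r mulr0 addr0.
- move=> a f g.
  have E h : (b *: v + w) h = b * v h + w h by [].
  by rewrite !E vl wl; ring.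
- move=> f g; have E h : (b *: v + w) h = b * v h + w h by [].
  by rewrite !E vm wm; ring.
Qed.

HB.instance Definition _ := GRing.isSubmodClosed.Build R (smoothFun M -> R)
  derivation_pred derivation_submod.

Record tangent := Tangent {
  tangent_val :> smoothFun M -> R;
  tangent_valP : tangent_val \in derivation_pred }.

HB.instance Definition _ := [isSub for tangent_val].
HB.instance Definition _ := [Choice of tangent by <:].
HB.instance Definition _ := [SubChoice_isSubZmodule of tangent by <:].
HB.instance Definition _ := [SubZmodule_isSubLmodule of tangent by <:].

Definition mkTangent (v : smoothFun M -> R) (dv : derivation_at v) : tangent :=
  Tangent (asboolT dv).

Lemma tangentP (v : tangent) : derivation_at v.
Proof. exact/asboolP/tangent_valP. Qed.

End TangentSpace.

Section VectorFields.
Variables (R : realType) (n : nat) (M : smoothManifold R n).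

Definition smooth_field (X : forall p : M, tangent p) : Prop :=
  forall f : smoothFun M, smooth (fun p => X p f).

Record vfield := Vfield {
  vfield_val :> forall p : M, tangent p;
  vfieldP : smooth_field vfield_val }.

Definition vder (X : vfield) (f : smoothFun M) : smoothFun M :=
  mkSmooth (vfieldP X f).

Lemma vaddP (X Y : vfield) : smooth_field (fun p => X p + Y p).
Proof. by move=> f; apply: smoothD; exact: vfieldP. Qed.

Definition vadd (X Y : vfield) : vfield := Vfield (vaddP X Y).

Lemma vscaleP (f : smoothFun M) (X : vfield) : smooth_field (fun p => f p *: X p).
Proof. by move=> h; apply: smoothM; [exact: smoothFunP|exact: vfieldP]. Qed.

Definition vscale (f : smoothFun M) (X : vfield) : vfield := Vfield (vscaleP f X).

Lemma vder_linear (X : vfield) a f g : vder X (a *: f + g) = a *: vder X f + vder X g.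
Proof. by apply/val_inj/funext => p /=; rewrite (tangentP (X p)).1. Qed.

Lemma vder_leibniz (X : vfield) f g : vder X (f * g) = vder X f * g + f * vder X g.
Proof. by apply/val_inj/funext => p /=; rewrite (tangentP (X p)).2. Qed.

Lemma bracket_derivation (X Y : vfield) (p : M) :
  derivation_at p (fun f => X p (vder Y f) - Y p (vder X f)).
Proof.
have add (Z : vfield) f g : Z p (f + g) = Z p f + Z p g.
  by rewrite -[f]scale1r (tangentP (Z p)).1 mul1r scale1r.
split=> [a f g|f g].
  by rewrite !vder_linear !(tangentP (_ p)).1; ring.
rewrite !vder_leibniz !add !(tangentP (_ p)).2 /=; ring.
Qed.

Lemma bracketP (X Y : vfield) :
  smooth_field (fun p => mkTangent (bracket_derivation X Y p)).
Proof.
by move=> f; exact: (smoothFunP (vder X (vder Y f) - vder Y (vder X f))).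
Qed.

Definition bracket (X Y : vfield) : vfield := Vfield (bracketP X Y).

(* Smooth (0,2)-tensor fields; the metric and the 2-form are both instances. *)
Record tensor2 := Tensor2 {
  tensor2_val :> forall p : M, tangent p -> tangent p -> R;
  tensor2_linearl : forall p a (u v w : tangent p),
    tensor2_val (a *: u + v) w = a * tensor2_val u w + tensor2_val v w;
  tensor2_linearr : forall p a (u v w : tangent p),
    tensor2_val u (a *: v + w) = a * tensor2_val u v + tensor2_val u w;
  tensor2_smooth : forall X Y : vfield,
    smooth (fun p => tensor2_val (X p) (Y p)) }.

Definition tensor2_fun (t : tensor2) (X Y : vfield) : smoothFun M :=
  mkSmooth (tensor2_smooth t X Y).

Record metric := Metric {
  metric_tensor :> tensor2;
  metric_sym : forall p (u v : tangent p), metric_tensor p u v = metric_tensor p v u;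
  metric_pos : forall p (u : tangent p), u != 0 -> 0 < metric_tensor p u u }.

Record form2 := Form2 {
  form2_tensor :> tensor2;
  form2_alternating : forall p (u : tangent p), form2_tensor p u u = 0 }.

Record connection := Connection {
  nabla :> vfield -> vfield -> vfield;
  nabla_linearl : forall f X Y Z,
    nabla (vadd (vscale f X) Y) Z = vadd (vscale f (nabla X Z)) (nabla Y Z);
  nabla_addr : forall X Y Z, nabla X (vadd Y Z) = vadd (nabla X Y) (nabla X Z);
  nabla_leibniz : forall f X Y,
    nabla X (vscale f Y) = vadd (vscale (vder X f) Y) (vscale f (nabla X Y)) }.

(* (nabla_X t)(Y, Z) *)
Definition nabla_tensor2 (D : connection) (t : tensor2) (X Y Z : vfield) (p : M) : R :=
  X p (tensor2_fun t Y Z) - t p (D X Y p) (Z p) - t p (Y p) (D X Z p).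

Definition parallel2 (D : connection) (t : tensor2) : Prop :=
  forall X Y Z p, nabla_tensor2 D t X Y Z p = 0.

Definition torsion_free (D : connection) : Prop :=
  forall X Y p, D X Y p - D Y X p = bracket X Y p.

(* These two conditions determine D uniquely, so quantifying over the D that
   satisfy them is quantifying over the Levi-Civita connection of g *)
Definition levi_civita (g : metric) (D : connection) : Prop :=
  torsion_free D /\ parallel2 D g.

Definition curvature (D : connection) (X Y Z : vfield) (p : M) : tangent p :=
  D X (D Y Z) p - D Y (D X Z) p - D (bracket X Y) Z p.

Definition lin_indep2 (p : M) (u v : tangent p) : Prop :=
  forall a b : R, a *: u + b *: v = 0 -> a = 0 /\ b = 0.

(* Depends on X and Y only through the plane spanned by X p and Y p. *)
Definition sectional_curvature (g : metric) (D : connection) (X Y : vfield) (p : M) : R :=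
  g p (curvature D X Y Y p) (X p) /
  (g p (X p) (X p) * g p (Y p) (Y p) - g p (X p) (Y p) ^+ 2).

Definition negative_sectional_curvature (g : metric) (D : connection) : Prop :=
  forall (X Y : vfield) (p : M), lin_indep2 (X p) (Y p) -> sectional_curvature g D X Y p < 0.

(* The two transpositions generate all permutations of (X, Y, Z). *)
Definition Killing2 (D : connection) (omega : form2) : Prop :=
  forall X Y Z p,
    nabla_tensor2 D omega X Y Z p = - nabla_tensor2 D omega Y X Z p /\
    nabla_tensor2 D omega X Y Z p = - nabla_tensor2 D omega X Z Y p.

(* Smooth fields of endomorphisms of the tangent bundle. *)
Record endo := Endo {
  endo_val :> forall p : M, tangent p -> tangent p;
  endo_linear : forall p a (u v : tangent p),
    endo_val (a *: u + v) = a *: endo_val u + endo_val v;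
  endo_smooth : forall X : vfield, smooth_field (fun p => endo_val (X p)) }.

Definition endo_app (J : endo) (X : vfield) : vfield := Vfield (endo_smooth J X).

Definition almost_complex (J : endo) : Prop :=
  forall p (u : tangent p), J p (J p u) = - u.

Definition metric_compatible (g : metric) (J : endo) : Prop :=
  forall p (u v : tangent p), g p (J p u) (J p v) = g p u v.

(* (nabla_X J) Y = nabla_X (J Y) - J (nabla_X Y) *)
Definition parallel_endo (D : connection) (J : endo) : Prop :=
  forall X Y p, D X (endo_app J Y) p - J p (D X Y p) = 0.

Definition Kahler (g : metric) (D : connection) (J : endo) : Prop :=
  [/\ almost_complex J, metric_compatible g J & parallel_endo D J].

End VectorFields.

(* Main.v *)
(** Write omega = g(A., .) and B_x y = (nabla_x A) y; the Killing equation says that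
    g(B_x y, z) is totally skew. Two maximum principles are used.

    Maximise (|Ax|^2 |y|^2 - |Ay|^2 |x|^2) / (|x|^2 |y|^2) over all pairs of tangent
    vectors at a common point. At a maximum (u, e), u and e are eigenvectors of -A^2 for
    its largest and smallest eigenvalues lam and mu. The second-derivative tests in the
    directions u and e add up, through the Ricci identity for A, to an upper bound 0 for
    - (lam - mu) sec(u, e), so lam = mu by negative curvature. Hence A^2 = - lam on all of
    M, and lam is constant because its derivative along v is a multiple of
    g(B_v v, A v) = 0.

    Therefore J = A / sqrt lam is nearly Kähler. Its second covariant derivative is the
    quadratic expression (nabla^2 J)(w, x, y) = J (B_w B_x y - B_y B_w x + B_x B_w y) / 2
    (with B = nabla J from now on), so its third derivative is cubic in B. Now maximise
    |B_x y|^2 / (|x|^2 |y|^2), let m be the maximum, attained at unit vectors x, y, and put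
    z = B_x y. Then B_x z = - m y and B_y z = m x, and the Ricci identity for nabla^3 J
    evaluated on x, Jx, x, y against Jz becomes
      m (R(x,Jx,x,Jx) + R(x,Jx,y,Jy)) + R(x,Jx,z,Jz) = - m^2.
    Rewriting the bisectional curvatures as sums of sectional curvatures turns this into:
    a nonnegative combination of five sectional curvatures equals 5 m^2. So m = 0. *)
Require Import Defs.
From HB Require Import structures.
From mathcomp Require Import all_boot all_order all_algebra.
From mathcomp Require Import all_classical all_reals all_analysis.
From mathcomp Require Import ring lra.
Set Implicit Arguments.
Unset Strict Implicit.
Unset Printing Implicit Defensive.
Import Order.TTheory GRing.Theory Num.Theory.
Import numFieldNormedType.Exports.
Local Open Scope classical_set_scope.
Local Open Scope ring_scope.

(** * Calculus of several variables *)

(** The eigenvalues of -A^2 need not be differentiable where they cross, so no maximum principle is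
    applied to them directly. Maximising over pairs of vectors avoids this: the maximal pair is
    extended to smooth fields with vanishing covariant derivative at the point, and the inequality
    valid for all pairs makes an explicit smooth function on M maximal there. Both derivative tests
    are needed, because each contains |B_u e|^2 and R(u, e, Au, Ae), with opposite signs; only the
    sum is a multiple of one sectional curvature. The number 5 in the last step is 2 + 2 + 1: the
    bisectional curvatures of x with y and of x with z contribute 2 m^2 each, and the Ricci identity
    contributes m^2. Tangent vectors are derivations of the algebra of global smooth functions, so
    coordinates are available only after multiplication by a cut-off chi. Local formulas are
    multiplied by powers of chi until they hold on all of M, and are then used where chi is
    non-zero. *)

Section Calculus.
Variables (R : realType) (n : nat).
Implicit Types (U V : set 'rV[R]_n) (f g : 'rV[R]_n -> R).

Lemma Ck_on_sub k U V f : V `<=` U -> Ck_on k U f -> Ck_on k V f.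
Proof.
move=> VU; elim: k f => [|k IH] f [cf df]; (split; first by move=> x /VU; exact: cf) => // i.
by have [dfi Cf] := df i; split; [move=> x /VU; exact: dfi|exact: IH].
Qed.

Lemma Ck_on_local k U f :
  (forall x, U x -> exists V, [/\ open V, V x & Ck_on k V f]) -> Ck_on k U f.
Proof.
elim: k f => [|k IH] f H; split => //.
- by move=> x /H[V [_ Vx [cf _]]]; exact: cf.
- by move=> x /H[V [_ Vx [cf _]]]; exact: cf.
move=> i; split; first by move=> x /H[V [_ Vx [_ /(_ i)[df _]]]]; exact: df.
by apply: IH => x /H[V [oV Vx [_ /(_ i)[_ Cf]]]]; exists V.
Qed.

Lemma is_derive_line f (y v : 'rV[R]_n) (s : R) : derivable f (y + s *: v) v ->
  is_derive s 1 (fun t => f (y + t *: v)) ('D_v f (y + s *: v)).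
Proof.
move=> df; have E : (fun h : R => h^-1 *: (f (y + (h *: 1 + s) *: v) - f (y + s *: v))) =
    (fun h : R => h^-1 *: (f (h *: v + (y + s *: v)) - f (y + s *: v))).
  apply/funext => h; congr (_ *: (f _ - _)).
  by rewrite [_ *: 1]mulr1 scalerDl addrCA.
by apply: DeriveDef; [rewrite /derivable /= E|rewrite /derive /= E].
Qed.

Lemma mvt_line f (y v : 'rV[R]_n) (a : R) :
  (forall s : R, `|s| <= `|a| -> derivable f (y + s *: v) v) ->
  exists2 c : R, `|c| <= `|a| & f (y + a *: v) - f y = 'D_v f (y + c *: v) * a.
Proof.
move=> df; pose phi (t : R) := f (y + t *: v).
have dphi (s : R) : `|s| <= `|a| -> is_derive s (1 : R) phi ('D_v f (y + s *: v)).
  by move=> /df; exact: is_derive_line.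
have cphi (s t : R) : (forall r, r \in `[s, t] -> `|r| <= `|a|) ->
    {within `[s, t], continuous phi}.
  by move=> H; apply: derivable_within_continuous => r /H/dphi[].
have phi0 : phi 0 = f y by rewrite /phi scale0r addr0.
have [a0|a0|a0] := ltgtP a 0; last by exists 0;
  rewrite ?normr0 // a0 !scale0r !addr0 subrr mulr0.
- have H (r : R) : r \in `[a, 0] -> `|r| <= `|a|.
    by rewrite in_itv /= => /andP[ar r0]; rewrite (ler0_norm r0) (ltr0_norm a0) lerN2.
  have dr (r : R) : r \in `]a, 0[ -> is_derive r (1 : R) phi ('D_v f (y + r *: v)).
    by move=> rI; apply/dphi/H; exact: subset_itv_oo_cc rI.
  have [c cI E] := MVT a0 dr (cphi _ _ H).
  exists c; first exact/H/subset_itv_oo_cc.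
  by rewrite -/(phi a) -phi0 -opprB E sub0r mulrN opprK.
- have H (r : R) : r \in `[0, a] -> `|r| <= `|a|.
    by rewrite in_itv /= => /andP[r0 ra]; rewrite (ger0_norm r0) (gtr0_norm a0).
  have dr (r : R) : r \in `]0, a[ -> is_derive r (1 : R) phi ('D_v f (y + r *: v)).
    by move=> rI; apply/dphi/H; exact: subset_itv_oo_cc rI.
  have [c cI E] := MVT a0 dr (cphi _ _ H).
  exists c; first exact/H/subset_itv_oo_cc.
  by rewrite -/(phi a) -phi0 E subr0.
Qed.

Lemma rV_coord_le (h : 'rV[R]_n) i : `|h 0 i| <= `|h|.
Proof.
rewrite [leRHS]/Num.Def.normr /= mx_normrE.
exact: (le_bigmax _ (fun ij => `|h ij.1 ij.2|) (0, i)).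
Qed.

Lemma rV_norm_le (h : 'rV[R]_n) (a : R) : 0 <= a -> (forall i, `|h 0 i| <= a) ->
  `|h| <= a.
Proof.
move=> a0 H; rewrite [leLHS]/Num.Def.normr /= mx_normrE.
by apply: bigmax_le => // -[i j] _ /=; rewrite ord1.
Qed.

Let trunc (h : 'rV[R]_n) k : 'rV[R]_n := \row_(j < n) (if (j < k)%N then h 0 j else 0).

Let truncS h (i : 'I_n) : trunc h i.+1 = trunc h i + h 0 i *: delta_mx 0 i.
Proof.
apply/rowP => j; rewrite !mxE eqxx /= ltnS leq_eqVlt.
have [->|ji] := eqVneq j i; first by rewrite eqxx ltnn /= mulr1 add0r.
by rewrite (_ : (nat_of_ord j == i) = false) ?mulr0 ?addr0 //; apply: negbTE.
Qed.

(** Moving from [x] to [x + h] one coordinate at a time, each step is a mean value step along an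
    axis, and continuity of the partial derivatives replaces its intermediate point by [x]. *)
Lemma C1_differentiable U f x : open U -> U x -> Ck_on 1 U f ->
  differentiable f x /\
  forall v, 'D_v f x = \sum_(i < n) v 0 i * 'D_(delta_mx 0 i) f x.
Proof.
move=> oU Ux [cf df].
pose L (h : 'rV[R]_n) : R := \sum_(i < n) h 0 i * 'D_(delta_mx 0 i) f x.
have L_lin : linear L.
  move=> a u v; rewrite /L scaler_sumr -big_split; apply: eq_bigr => i _ /=.
  by rewrite !mxE mulrDl -mulrA.
pose LL := GRing.isLinear.Build _ _ _ _ _ L_lin.
pose Lf : {linear 'rV[R]_n -> R} := HB.pack L LL.
have cL : continuous Lf.
  apply: continuous_big => [|i _ h]; first exact: add_continuous.
  apply: (@cvgMr_tmp R _ (nbhs h)); exact: coord_continuous.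
have key : f \o shift x = cst (f x) + Lf +o_ (nbhs (0 : 'rV[R]_n)) id.
  apply/eqaddoP => _/posnumP[e].
  (* Each of the [n] axis steps costs at most [e' * |h|]; the denominator [n.+1] also covers
     [n = 0]. *)
  pose e' := e%:num / n.+1%:R.
  have e'0 : 0 < e' by rewrite divr_gt0.
  have nearx : \forall y \near x, U y /\
      forall i : 'I_n, `|'D_(delta_mx 0 i) f x - 'D_(delta_mx 0 i) f y| < e'.
    apply: (@filterS2 _ (nbhs x) _ U (fun y => forall i : 'I_n,
        `|'D_(delta_mx 0 i) f x - 'D_(delta_mx 0 i) f y| < e')).
    - by [].
    - exact: open_nbhs_nbhs.
    - apply: (@filter_forall _ _ (fun (i : 'I_n) y =>
        `|'D_(delta_mx 0 i) f x - 'D_(delta_mx 0 i) f y| < e') (nbhs x)) => i; have [_ [cD _]] := df i.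
      by have /cvgrPdist_lt /(_ _ e'0) := cD _ Ux.
  have /nbhs_ballP[d /= d0 Hd] := nearx.
  apply/nbhs_ballP; exists d => //= h; rewrite -ball_normE /= sub0r normrN => hd.
  have small (t : 'rV[R]_n) : (forall j, `|t 0 j| <= `|h 0 j|) ->
      U (x + t) /\ forall i : 'I_n,
        `|'D_(delta_mx 0 i) f x - 'D_(delta_mx 0 i) f (x + t)| < e'.
    move=> ht; apply: Hd; rewrite -ball_normE /= opprD addNKr normrN.
    apply: le_lt_trans hd; apply: rV_norm_le => // j.
    exact: le_trans (ht j) (rV_coord_le _ _).
  have step (i : 'I_n) :
     `|f (x + trunc h i.+1) - f (x + trunc h i) - h 0 i * 'D_(delta_mx 0 i) f x|
       <= e' * `|h|.
    have in_small s : `|s| <= `|h 0 i| -> forall j,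
        `|(trunc h i + s *: delta_mx 0 i) 0 j| <= `|h 0 j|.
      move=> sh j; rewrite !mxE eqxx /=; have [->|ji] := eqVneq j i.
        by rewrite ltnn mulr1 add0r.
      by rewrite mulr0 addr0; case: ifP => // _; rewrite normr0.
    have [|c ch] := @mvt_line f (x + trunc h i) (delta_mx 0 i) (h 0 i).
      move=> s /in_small/small[Us _]; rewrite -addrA.
      by have [dfi _] := df i; exact: dfi.
    rewrite truncS addrA => ->; rewrite -addrA.
    rewrite -(mulrC ('D_(delta_mx 0 i) f x)) -mulrBl normrM ler_pM //; last exact: rV_coord_le.
    have /in_small/small[_ /(_ i)] := ch.
    by rewrite distrC => /ltW.
  have tele : f (x + h) - f x =
      \sum_(i < n) (f (x + trunc h i.+1) - f (x + trunc h i)).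
    rewrite -(big_mkord xpredT (fun i => f (x + trunc h i.+1) - f (x + trunc h i))).
    rewrite telescope_sumr //; congr (f _ - f _).
      by congr (_ + _); apply/rowP => j; rewrite mxE ltn_ord.
    by rewrite [trunc h 0](_ : _ = 0) ?addr0 //; apply/rowP => j; rewrite !mxE.
  have -> : ((f \o shift x) - (cst (f x) + Lf)) h =
      \sum_(i < n) (f (x + trunc h i.+1) - f (x + trunc h i)
                    - h 0 i * 'D_(delta_mx 0 i) f x).
    by rewrite sumrB -tele [in RHS]addrC /= !fctE /= /L [h + x]addrC; ring.
  apply: le_trans (ler_norm_sum _ _ _) _.
  apply: le_trans (ler_sum _ (fun i _ => step i)) _.
  rewrite sumr_const card_ord -mulrnAl ler_wpM2r //.
  rewrite /e' -mulr_natr -mulrA ger_pMr // mulrC ler_pdivrMr // mul1r ler_nat.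
  exact: leqnSn.
have dfx : differentiable f x.
  (* The differential is picked by [get] among continuous linear approximations, so exhibiting one
     of them is enough. *)
  apply/diffP; apply: (@getPex _ (fun (df : {linear 'rV[R]_n -> R}) => continuous df /\
    forall y, f y = f (lim (nbhs x)) + df (y - lim (nbhs x))
                  +o_(y \near x) (y - lim (nbhs x)))).
  exists Lf; split=> //; apply/funeqP/eqaddoP => e e0; rewrite lim_id //.
  move/eqaddoP : key => /(_ e e0) kk.
  have : \forall y \near x, (fun h : 'rV[R]_n => `|((f \o shift x) - (cst (f x) + Lf)) h| <= e * `|h|) (y - x).
    move: kk => /nbhs_ballP[d d0 Hd]; apply/nbhs_ballP; exists d => // y.
    by rewrite -ball_normE /= => yx; apply: Hd; rewrite -ball_normE /= sub0r opprB.
  by apply: filterS => y; rewrite /= !fctE /= subrK /cst.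
split=> // v; rewrite deriveE //.
by have /(_ key) -> := @diff_unique _ _ _ f Lf x cL.
Qed.

End Calculus.

Lemma derive_lineE (R : numFieldType) (V W : normedModType R) (f : V -> W) x v :
  'D_v f x = 'D_1 (fun h : R => f (h *: v + x)) 0.
Proof.
have E : (fun h : R => h^-1 *: ((f \o shift x) (h *: v) - f x)) =
    (fun h : R => h^-1 *: (((fun k : R => f (k *: v + x)) \o shift 0) (h *: (1 : R))
                          - f (0 *: v + x))).
  by apply/funext => h /=; rewrite addr0 scale0r add0r [_ *: (1 : R)]mulr1.
by rewrite /derive E.
Qed.

Lemma Ck_on_le (R : realType) n (U : set 'rV[R]_n) j k f :
  (j <= k)%N -> Ck_on k U f -> Ck_on j U f.
Proof.
by move=> /subnK <-; elim: (k - j)%N => // m IH H; apply: IH; exact: Ck_onW.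
Qed.

Section CkAlgebra.
Variables (R : realType) (n : nat) (U : set 'rV[R]_n).
Hypothesis oU : open U.
Implicit Types f g : 'rV[R]_n -> R.

Lemma Ck_on_sum k (I : Type) (r : seq I) (P : pred I) (F : I -> 'rV[R]_n -> R) :
  (forall i, P i -> Ck_on k U (F i)) -> Ck_on k U (fun x => \sum_(i <- r | P i) F i x).
Proof.
move=> CF; elim: r => [|i r IH].
  apply: eq_Ck_on (Ck_on_cst oU k 0) => // x _; by rewrite big_nil.
case Pi: (P i); last by apply: eq_Ck_on IH => // x _; rewrite big_cons Pi.
apply: eq_Ck_on (Ck_onD oU (CF i Pi) IH) => // x _; by rewrite big_cons Pi.
Qed.

Lemma Ck_onV k f : (forall x, U x -> f x != 0) -> Ck_on k U f ->
  Ck_on k U (fun x => (f x)^-1).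
Proof.
move=> f0; elim: k => [|k IH] Cf; (split;
  first by move=> x Ux; apply: continuousV; [exact: f0|exact: Cf.1]) => //.
move=> i; have [dfi Cdf] := Cf.2 i; split.
  by move=> x Ux; apply: derivableV; [exact: f0|exact: dfi].
have CV := IH (Ck_onW Cf).
have := Ck_onM oU (Ck_on_cst oU k (-1)) (Ck_onM oU (Ck_onM oU CV CV) Cdf).
apply: eq_Ck_on => // x Ux; rewrite deriveV; [|exact: f0|exact: dfi].
by rewrite mulN1r scaleNr expr2 invfM.
Qed.

Lemma is_derive_coord (x v : 'rV[R]_n) i :
  is_derive x v (fun y : 'rV[R]_n => y 0 i : R) (v 0 i).
Proof.
have D : derivable (id : 'rV[R]_n -> _) x v by exact: derivable_id.
have /derivable_mxP/(_ 0 i) Di := D.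
apply: DeriveDef => //.
by have := derive_mx D; rewrite derive_id => /matrixP/(_ 0 i); rewrite mxE.
Qed.

Lemma Ck_on_coord k i : Ck_on k U (fun x : 'rV[R]_n => x 0 i).
Proof.
case: k => [|k]; (split; first by move=> x _; exact: coord_continuous) => //.
move=> j; split; first by move=> x _; case: (is_derive_coord x (delta_mx 0 j) i).
apply: eq_Ck_on (Ck_on_cst oU k ((delta_mx 0 j : 'rV[R]_n) 0 i)) => // x _.
by have [_ ->] := is_derive_coord x (delta_mx 0 j) i.
Qed.

(* [eta j.+1] is the derivative of [eta j] *)
Lemma Ck_on_scalar_comp k j (eta : nat -> R -> R) f :
  (forall i t, is_derive t (1 : R) (eta i) (eta i.+1 t)) ->
  Ck_on k U f -> Ck_on k U (fun x => eta j (f x)).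
Proof.
move=> He.
have ce l t : {for t, continuous (eta l)}.
  by apply: differentiable_continuous; apply/derivable1_diffP; have [] := He l t.
elim: k j => [|k IH] j Cf; (split;
  first by move=> x Ux; apply: continuous_comp; [exact: Cf.1|exact: ce]) => //.
move=> i; have [dfi Cdf] := Cf.2 i.
have key (x : 'rV[R]_n) : U x -> is_derive x (delta_mx 0 i : 'rV[R]_n) (fun x : 'rV[R]_n => eta j (f x))
    (eta j.+1 (f x) * 'D_(delta_mx 0 i : 'rV[R]_n) f x).
  move=> Ux; have dc : derivable (fun h : R => f (h *: (delta_mx 0 i : 'rV[R]_n) + x)) 0 1.
    exact: (derivable1P f x _).1 (dfi x Ux).
  have E (g : 'rV[R]_n -> R) := derive_lineE g x (delta_mx 0 i).
  have [dej dejE] := He j (f x).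
  have dj : derivable (eta j) (f (0 *: delta_mx 0 i + x)) 1 by rewrite scale0r add0r.
  apply: DeriveDef.
    apply: (derivable1P (fun y => eta j (f y)) x _).2; apply/derivable1_diffP.
    by apply: (@differentiable_comp _ _ _ _ (fun h : R => f (h *: _ + x)) (eta j));
      exact/derivable1_diffP.
  rewrite !E -!derive1E.
  have := derive1_comp dc dj; rewrite /comp => ->.
  by rewrite scale0r add0r derive1E dejE.
split; first by move=> x /key[].
have := Ck_onM oU (IH j.+1 (Ck_onW Cf)) Cdf.
by apply: eq_Ck_on => // x /key[_ ->].
Qed.

End CkAlgebra.

Lemma cvg_rV (R : realType) (n : nat) (T : topologicalType) (phi : T -> 'rV[R]_n) x :
  (forall j, {for x, continuous (fun y => phi y 0 j)}) -> {for x, continuous phi}.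
Proof.
move=> H; apply/cvgrPdist_le => e e0.
have := @filter_forall _ _ (fun (j : 'I_n) y => `|phi x 0 j - phi y 0 j| <= e) (nbhs x).
move=> /(_ _ (fun j => ((cvgrPdist_le _ _).1 (H j) e e0))).
apply: filterS => y Hy; apply: rV_norm_le => [|j]; first exact: ltW.
by rewrite !mxE; exact: Hy.
Qed.

Section CkComp.
Variables (R : realType) (m n : nat) (U : set 'rV[R]_n) (V : set 'rV[R]_m).
Variable (phi : 'rV[R]_n -> 'rV[R]_m).
Hypotheses (oU : open U) (oV : open V) (phiUV : forall x, U x -> V (phi x)).

Lemma chain_rule (f : 'rV[R]_m -> R) x v : U x -> Ck_on 1 V f ->
  (forall j, derivable (fun y => phi y 0 j) x v) ->
  is_derive x v (fun y => f (phi y))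
    (\sum_(j < m) 'D_v (fun y => phi y 0 j) x * 'D_(delta_mx 0 j) f (phi x)).
Proof.
move=> Ux C1f dphi; pose c (h : R) := phi (h *: v + x).
have [df Df] := C1_differentiable oV (phiUV Ux) C1f.
have E (W : normedModType R) (g : 'rV[R]_n -> W) := derive_lineE g x v.
have c0 : c 0 = phi x by rewrite /c scale0r add0r.
have dc : derivable c 0 1.
  apply/derivable_mxP => i j; rewrite ord1.
  exact: (derivable1P (fun y => phi y 0 j) x v).1 (dphi j).
have dc' : differentiable c (0 : R) by apply/derivable1_diffP.
have df' : differentiable f (c 0) by rewrite c0.
have dfc : differentiable (f \o c) (0 : R) by exact: differentiable_comp.
apply: DeriveDef.
  exact: (derivable1P (fun y => f (phi y)) x v).2 ((derivable1_diffP _ _).2 dfc).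
rewrite E -/(f \o c) deriveE // diff_comp //= -deriveE // -deriveE // c0 Df.
apply: eq_bigr => j _; congr (_ * _).
by rewrite E (derive_mx dc) mxE.
Qed.

Lemma Ck_on_comp k (f : 'rV[R]_m -> R) : Ck_on k V f ->
  (forall j, Ck_on k U (fun y => phi y 0 j)) -> Ck_on k U (fun y => f (phi y)).
Proof.
elim: k f => [|k IH] f Cf Cphi; (split;
  first by move=> x Ux; apply: continuous_comp;
     [apply: cvg_rV => j; exact: (Cphi j).1|exact: (Cf.1 _ (phiUV Ux))]) => //.
move=> i.
have C1f : Ck_on 1 V f by exact: Ck_on_le Cf.
have key (x : 'rV[R]_n) (Ux : U x) := chain_rule Ux C1f (fun j => ((Cphi j).2 i).1 x Ux).
split; first by move=> x /key[].
have : Ck_on k U (fun x => \sum_(j < m)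
    'D_(delta_mx 0 i) (fun y => phi y 0 j) x * 'D_(delta_mx 0 j) f (phi x)).
  apply: Ck_on_sum => // j _; apply: Ck_onM => //; first exact: ((Cphi j).2 i).2.
  by apply: (IH ('D_(delta_mx 0 j) f)) => [|l]; [exact: (Cf.2 j).2|exact: Ck_onW].
by apply: (eq_Ck_on oU) => x Ux; have [_ ->] := key x Ux.
Qed.

End CkComp.

(** * Smooth bump functions *)

Section Bump.
Variable R : realType.
Implicit Types (p : {poly R}).

(** Induction on the polynomial with [k] free: in [p * 'X + c%:P] the factor ['X] becomes one more
    power of [y], and [c] is handled by y^k / k! <= e^y. *)
Lemma exp_decay p k : exists2 C : R, 0 <= C &
  forall y, 0 < y -> `|p.[y]| * y ^+ k * expR (- y) <= C.
Proof.
have mono l y : 0 < y -> y ^+ l * expR (- y) <= (l`!%:R : R).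
  move=> y0; rewrite expRN ler_pdivrMr ?expR_gt0 //.
  case: l => [|l]; first by rewrite expr0 fact0 mul1r ltW // expR_gt1.
  rewrite -ler_pdivrMl ?ltr0n ?fact_gt0 // mulrC.
  by apply: le_trans (expR_ge1Dxn l (ltW y0)); rewrite lerDr.
elim/poly_ind: p k => [|p c IH] k.
  by exists 0 => // y _; rewrite horner0 normr0 !mul0r.
have [C C0 HC] := IH k.+1.
exists (C + `|c| * k`!%:R); first by rewrite addr_ge0 // mulr_ge0.
move=> y y0; rewrite hornerMXaddC -mulrA.
have yk0 : 0 <= y ^+ k * expR (- y) by rewrite mulr_ge0 ?exprn_ge0 ?expR_ge0 ?ltW.
apply: le_trans (ler_wpM2r yk0 (ler_normD _ _)) _; rewrite mulrDl; apply: lerD.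
  apply: le_trans (HC y y0); rewrite normrM (gtr0_norm y0) exprS.
  by rewrite !mulrA.
by rewrite ler_wpM2l // mono.
Qed.

(** The polynomial makes the family closed under differentiation: the derivative of p(1/t) e^(-1/t)
    has the same form with X^2 (p - p') in place of p. The usual flat function is the case p = 1. *)
Definition exp_cutoff p (t : R) : R :=
  if 0 < t then p.[t^-1] * expR (- t^-1) else 0.

(** Quadratic decay at 0 makes the difference quotient at 0 tend to 0. *)
Lemma exp_cutoff_bound p : exists2 C : R, 0 <= C &
  forall t, `|exp_cutoff p t| <= C * t ^+ 2.
Proof.
have [C C0 HC] := exp_decay p 2; exists C => // t; rewrite /exp_cutoff.
case: ifPn => [t0|_]; last by rewrite normr0 mulr_ge0 ?sqr_ge0.
have := HC t^-1; rewrite invr_gt0 => /(_ t0).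
rewrite normrM (ger0_norm (expR_ge0 _)) exprVn mulrAC ler_pdivrMr //.
by rewrite exprn_gt0.
Qed.

Lemma is_derive_exp_cutoff p t :
  is_derive t (1 : R) (exp_cutoff p) (exp_cutoff ('X^2 * (p - p^`())) t).
Proof.
have [t0|t0|<-] := ltgtP 0 t.
- have hE : is_derive (t^-1) (1 : R) (fun y : R => p.[y] * expR (- y))
      ((p^`() - p).[t^-1] * expR (- t^-1)).
    have dp : is_derive (t^-1) (1 : R) (horner p) (p^`().[t^-1]).
      apply: DeriveDef; first exact: derivable_horner.
      by rewrite derivE derive1E.
    have de : is_derive (t^-1) (1 : R) (fun y : R => expR (- y)) (- expR (- t^-1)).
      by apply: is_derive_eq; rewrite mulrN1.
    apply: (@is_derive_eq _ _ _ _ _ _ _ _ (is_deriveM dp de)).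
    by rewrite hornerD hornerN /GRing.scale /=; ring.
  have dV : is_derive t (1 : R) (fun u : R => u^-1) (- t ^- 2).
    apply: (@is_derive_eq _ _ _ _ _ _ _ _ (is_deriveV _ (is_derive_id t (1:R)))).
      by rewrite gt_eqF.
    by rewrite [_ *: (1 : R)]mulr1.
  have hc := is_derive1_comp (f := fun y => p.[y] * expR (- y)) hE dV.
  apply: (@near_eq_is_derive R R^o R^o (fun u : R => p.[u^-1] * expR (- u^-1))).
    by near=> u; rewrite /exp_cutoff ifT //; near: u; exact: lt_nbhsr.
  apply: (@is_derive_eq _ _ _ _ _ _ _ _ hc).
  rewrite /exp_cutoff t0 hornerM hornerXn !hornerD !hornerN exprVn; ring.
- apply: (@near_eq_is_derive R R^o R^o (cst 0)).
    near=> u; rewrite /exp_cutoff ltNge ifF //; apply/negbF/ltW.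
    by near: u; exact: lt_nbhsl.
  by rewrite /exp_cutoff ltNge (ltW t0) /=; exact: is_derive_cst.
have [C C0 HC] := exp_cutoff_bound p.
rewrite {2}/exp_cutoff ltxx.
have key : (fun h : R => h^-1 *: (exp_cutoff p (h *: 1 + 0) - exp_cutoff p 0))
    @ 0^' --> (0 : R).
  apply/cvgrPdist_le => e e0; near=> h.
  have h0 : h != 0 by near: h; exact: nbhs_dnbhs_neq.
  rewrite sub0r normrN {2}/exp_cutoff ltxx subr0 addr0 [h *: 1]mulr1 normrM normfV.
  rewrite mulrC ler_pdivrMr ?normr_gt0 //.
  apply: le_trans (HC h) _; rewrite -real_normK ?num_real // expr2 mulrA.
  rewrite ler_wpM2r //; apply: (@le_trans _ _ ((C + 1) * `|h|)).
    by rewrite ler_wpM2r // lerDl.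
  rewrite mulrC -ler_pdivlMr ?ltr_wpDl //; apply: ltW.
  by near: h; apply: dnbhs0_lt; rewrite divr_gt0 // ltr_wpDl.
by apply: DeriveDef; [apply/cvg_ex; exists 0|exact/cvg_lim].
Unshelve. all: by end_near. Qed.

End Bump.

Lemma bump_exists (R : realType) (n : nat) (x0 : 'rV[R]_n) (r : R) : 0 < r ->
  exists chi : 'rV[R]_n -> R,
    [/\ smooth_on setT chi, 0 < chi x0 &
        forall x, chi x != 0 -> `|x - x0| <= r].
Proof.
(* The squared Euclidean distance is smooth, whereas the norm of row vectors is the maximum norm;
   the Euclidean ball of radius [r] lies in the cube of the same radius. *)
move=> r0; pose s (x : 'rV[R]_n) : R := r ^+ 2 - \sum_(i < n) (x 0 i - x0 0 i) ^+ 2.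
pose eta j := exp_cutoff (iter j (fun p => 'X^2 * (p - p^`())) (1 : {poly R})).
exists (fun x => eta 0%N (s x)); split.
- move=> k; apply: (@Ck_on_scalar_comp R n setT openT k 0 eta).
    by move=> j t; exact: is_derive_exp_cutoff.
  have C1 : Ck_on k setT (fun x : 'rV[R]_n => \sum_(i < n) (x 0 i - x0 0 i) ^+ 2).
    apply: Ck_on_sum => [|i _]; first exact: openT.
    have CD := Ck_onD openT (Ck_on_coord openT k i) (Ck_on_cst openT k (- x0 0 i)).
    by apply: (eq_Ck_on openT) (Ck_onM openT CD CD) => x _; rewrite expr2.
  have := Ck_onD openT (Ck_on_cst openT k (r ^+ 2)) (Ck_onM openT (Ck_on_cst openT k (-1)) C1).
  by apply: eq_Ck_on; [exact: openT|move=> x _; rewrite mulN1r].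
- rewrite /eta /exp_cutoff /= hornerC mul1r ifT ?expR_gt0 // /s big1 ?subr0 ?exprn_gt0 //.
  by move=> i _; rewrite subrr expr0n.
move=> x; rewrite /eta /exp_cutoff /=; case: ifP => [s0 _|]; last by rewrite eqxx.
apply: rV_norm_le => [|i]; first exact: ltW.
have rn : r \is Num.nneg by rewrite nnegrE ltW.
rewrite -(ler_pXn2r (ltn0Sn 1)) ?nnegrE // real_normK ?num_real // !mxE.
apply: ltW; move: s0; rewrite subr_gt0; apply: le_lt_trans.
by rewrite (bigD1 i) //= lerDl sumr_ge0 // => j _; rewrite sqr_ge0.
Qed.

(** * Hadamard's lemma *)

Section Hadamard.
Variables (R : realType).

Local Notation mu := (@lebesgue_measure R).

Definition avg01 (phi : R -> R) : R := \int[mu]_(t in `[0, 1]) phi t.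

Let int01 (phi : R -> R) : continuous phi -> mu.-integrable `[0, 1] (EFin \o phi).
Proof.
move=> cphi; apply: continuous_compact_integrable; first exact: segment_compact.
exact: continuous_subspaceT.
Qed.

Lemma avg01_cst (a : R) : avg01 (fun=> a) = a.
Proof.
rewrite /avg01 Rintegral_cst //= lebesgue_measure_itv /= lte_fin ltr01.
by rewrite oppr0 adde0 mulr1.
Qed.

Lemma avg01B (phi psi : R -> R) : continuous phi -> continuous psi ->
  avg01 (fun t => phi t - psi t) = avg01 phi - avg01 psi.
Proof. by move=> /int01 cphi /int01 cpsi; exact: RintegralB. Qed.

Lemma avg01_sum (I : Type) (s : seq I) (phi : I -> R -> R) :
  (forall i, continuous (phi i)) ->
  avg01 (fun t => \sum_(i <- s) phi i t) = \sum_(i <- s) avg01 (phi i).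
Proof.
move=> cphi; elim: s => [|i s IH].
  by rewrite big_nil -[RHS]avg01_cst; congr avg01; apply/funext => t; rewrite big_nil.
rewrite big_cons -IH -RintegralD; [|exact: measurable_itv|exact: int01|].
  by congr avg01; apply/funext => t; rewrite big_cons.
by apply: int01; apply: continuous_big => [|j _]; [exact: add_continuous|exact: cphi].
Qed.

Lemma avg01Z (a : R) (phi : R -> R) : continuous phi -> avg01 (fun t => a * phi t) = a * avg01 phi.
Proof. by move=> /int01 cphi; exact: RintegralZl. Qed.

Lemma avg01_bound (phi : R -> R) (e : R) : continuous phi ->
  (forall t, 0 <= t <= 1 -> `|phi t| <= e) -> `|avg01 phi| <= e.
Proof.
move=> cphi H; apply: le_trans (le_normr_Rintegral _ (int01 cphi)) _ => //.
rewrite -[leRHS]avg01_cst; apply: le_Rintegral => //.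
  by apply: int01 => x; apply: continuous_comp; [exact: cphi|exact: norm_continuous].
by apply: int01; exact: cst_continuous.
Qed.

Lemma avg01_FTC (Phi phi : R -> R) : continuous phi ->
  (forall t, is_derive t (1 : R) Phi (phi t)) -> avg01 phi = Phi 1 - Phi 0.
Proof.
move=> cphi dPhi.
have cPhi t : {for t, continuous Phi}.
  by apply: differentiable_continuous; apply/derivable1_diffP; have [] := dPhi t.
rewrite /avg01 /Rintegral (@continuous_FTC2 R phi Phi 0 1) //=.
- exact: continuous_subspaceT.
- split; first by move=> t _; have [] := dPhi t.
    by apply: cvg_at_right_filter; exact: cPhi.
  by apply: cvg_at_left_filter; exact: cPhi.
- by move=> t _; rewrite derive1E; have [_ ->] := dPhi t.
Qed.

Variables (n : nat) (q : 'rV[R]_n).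
Implicit Types F G : 'rV[R]_n -> R.

Let ray_continuous (x : 'rV[R]_n) : continuous (fun t : R => q + t *: (x - q)).
Proof.
move=> t; apply: cvgD; first exact: cvg_cst.
by apply: cvgZr_tmp; exact: cvg_id.
Qed.

(** Compactness of the parameter interval makes continuity along the rays uniform in [t], as needed
    for limits under the integral. *)
Lemma ray_uniform G x (e : R) : continuous G -> 0 < e ->
  exists2 d : R, 0 < d & forall y, `|x - y| < d -> forall t, 0 <= t <= 1 ->
    `|G (q + t *: (y - q)) - G (q + t *: (x - q))| <= e.
Proof.
move=> cG e0.
have /compact_near_coveringP H := @segment_compact R 0 1.
have e20 : 0 < e / 2 by rewrite divr_gt0.
have := H _ (nbhs x) (fun y t => `|G (q + t *: (y - q)) - G (q + t *: (x - q))| < e) _.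
move=> Hn; have : \forall y \near x, `[0, 1] `<=`
    (fun t => `|G (q + t *: (y - q)) - G (q + t *: (x - q))| < e).
  apply: Hn => t _.
  have c1 : (fun ty : R * 'rV[R]_n => G (q + ty.1 *: (ty.2 - q))) @ (t, x) --> G (q + t *: (x - q)).
    have c0 : (fun ty : R * 'rV[R]_n => q + ty.1 *: (ty.2 - q)) @ (t, x) --> q + t *: (x - q).
      apply: cvgD; first exact: cvg_cst.
      apply: cvgZ; first exact: cvg_fst.
      by apply: cvgB; [exact: cvg_snd|exact: cvg_cst].
    exact: (cvg_comp _ _ c0 (cG _)).
  have c2 : (fun ty : R * 'rV[R]_n => G (q + ty.1 *: (x - q))) @ (t, x) --> G (q + t *: (x - q)).
    have c0 : (fun ty : R * 'rV[R]_n => q + ty.1 *: (x - q)) @ (t, x) --> q + t *: (x - q).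
      apply: cvgD; first exact: cvg_cst.
      by apply: cvgZr_tmp; exact: cvg_fst.
    exact: (cvg_comp _ _ c0 (cG _)).
  move/cvgrPdist_lt : c1 => /(_ _ e20) c1; move/cvgrPdist_lt : c2 => /(_ _ e20) c2.
  apply: filterS2 c1 c2 => -[u y] /= h1 h2.
  rewrite (splitr e) -(subrKA (G (q + t *: (x - q)))) (le_lt_trans (ler_normD _ _)) //.
  by rewrite ltrD // distrC.
move/nbhs_ballP => [d /= d0 Hd]; exists d => // y xy t t01; apply/ltW/Hd => //.
  by rewrite -ball_normE.
Qed.

(** The weight [t ^+ k] makes the family stable under differentiation in [x]: each partial
    derivative brings out one more factor [t]. *)
Definition ray_avg k F (x : 'rV[R]_n) : R := avg01 (fun t => t ^+ k * F (q + t *: (x - q))).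

Let ray_avg_cont (k : nat) F (x : 'rV[R]_n) : continuous F ->
  continuous (fun t : R => t ^+ k * F (q + t *: (x - q))).
Proof.
move=> cF t; apply: cvgM; first exact: exprn_continuous.
by apply: continuous_comp; [exact: ray_continuous|exact: cF].
Qed.

Lemma ray_avg_continuous k F : continuous F -> continuous (ray_avg k F).
Proof.
move=> cF x; apply/(@cvgrPdist_le _ _ _ (nbhs x)) => e e0.
have [d d0 Hd] := ray_uniform x cF e0.
apply/nbhs_ballP; exists d => //= y; rewrite -ball_normE /= => xy.
rewrite /ray_avg -avg01B; [|exact: ray_avg_cont..].
apply: avg01_bound.
  by move=> t; apply: cvgB; exact: ray_avg_cont.
move=> t t01; rewrite -mulrBr normrM distrC -[leRHS]mul1r.
case/andP: (t01) => t0 t1.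
by apply: ler_pM => //; [rewrite ger0_norm ?exprn_ile1 ?exprn_ge0|exact: Hd].
Qed.

Lemma is_derive_ray_avg k F x (i : 'I_n) : Ck_on 1 setT F ->
  is_derive x (delta_mx 0 i) (ray_avg k F) (ray_avg k.+1 ('D_(delta_mx 0 i) F) x).
Proof.
move=> [cF0 dF]; have cF : continuous F by move=> y; exact: cF0.
have [dFi [cG0 _]] := dF i; set G := 'D_(delta_mx 0 i) F.
have cG : continuous G by move=> y; exact: cG0.
have key : (fun h : R => h^-1 *: (ray_avg k F (h *: delta_mx 0 i + x) - ray_avg k F x))
    @ 0^' --> ray_avg k.+1 G x.
  apply/cvgrPdist_le => e e0.
  have [d d0 Hd] := ray_uniform x cG e0.
  near=> h; have h0 : h != 0 by near: h; exact: nbhs_dnbhs_neq.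
  have hd : `|h| < d by near: h; exact: dnbhs0_lt.
  set y := h *: delta_mx 0 i + x.
  have cD : continuous (fun t : R => t ^+ k * F (q + t *: (y - q)) - t ^+ k * F (q + t *: (x - q))).
    by move=> t; apply: cvgB; exact: ray_avg_cont.
  rewrite /ray_avg -avg01B; [|exact: ray_avg_cont..].
  rewrite -[h^-1 *: _](avg01Z _ cD) -avg01B; last 2 first.
  - exact: ray_avg_cont.
  - by move=> t; apply: cvgMl_tmp; exact: cD.
  apply: avg01_bound.
    by move=> t; apply: cvgB; [exact: ray_avg_cont|apply: cvgMl_tmp; exact: cD].
  move=> t t01; case/andP: (t01) => t0 t1.
  have [|c ch Ec] := @mvt_line R n F (q + t *: (x - q)) (delta_mx 0 i) (t * h).
    by move=> s _; exact: dFi.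
  have Ey : q + t *: (y - q) = q + t *: (x - q) + (t * h) *: delta_mx 0 i.
    by rewrite /y -scalerA -!addrA -scalerDr; congr (_ + _ *: _); rewrite addrC.
  rewrite Ey -mulrBr Ec mulrA.
  have [t00|tn0] := eqVneq t 0.
    rewrite t00 exprS !mul0r !mulr0 subr0 normr0; exact: ltW.
  (* The intermediate point has parameter [t] on the ray towards [c / t *: delta_mx 0 i + x], a
     point at distance at most |c| / t <= |h| from [x]; hence the separate case [t = 0] above. *)
  have -> : t ^+ k.+1 * G (q + t *: (x - q)) -
      h^-1 * t ^+ k * (G (q + t *: (x - q) + c *: delta_mx 0 i) * (t * h)) =
      t ^+ k.+1 * (G (q + t *: (x - q)) - G (q + t *: (c / t *: delta_mx 0 i + x - q))).
    rewrite -/G exprS.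
    have -> : q + t *: (c / t *: delta_mx 0 i + x - q) =
        q + t *: (x - q) + c *: delta_mx 0 i.
      rewrite -[_ + x - q]addrA scalerDr scalerA mulrCA divff // mulr1 -addrA.
      by rewrite [c *: _ + _]addrC.
    by field.
  rewrite normrM distrC -[leRHS]mul1r; apply: ler_pM => //.
    by rewrite ger0_norm ?exprn_ile1 ?exprn_ge0.
  apply: Hd => //; rewrite opprD addrCA subrr addr0 normrN normrZ.
  apply: le_lt_trans hd; rewrite normrM normfV.
  have tp : 0 < t by rewrite lt_neqAle eq_sym tn0.
  rewrite (gtr0_norm tp).
  have nd : `|delta_mx 0 i : 'rV[R]_n| <= 1.
    by apply: rV_norm_le => // j; rewrite mxE eqxx /=; case: eqP; rewrite ?normr1 ?normr0.
  apply: (@le_trans _ _ (`|c| / t)); first by apply: ler_piMr => //; rewrite divr_ge0.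
  by rewrite ler_pdivrMr // mulrC (le_trans ch) // normrM gtr0_norm.
by apply: DeriveDef; [apply/cvg_ex; eexists; exact: key|exact/cvg_lim].
Unshelve. all: by end_near. Qed.

Lemma Ck_on_ray_avg j k F : Ck_on k setT F -> Ck_on k setT (ray_avg j F).
Proof.
elim: k j F => [|k IH] j F CF.
  by split=> // x _; apply: ray_avg_continuous => y; exact: CF.1.
have C1 : Ck_on 1 setT F by exact: Ck_on_le CF.
split; first by move=> x _; apply: ray_avg_continuous => y; exact: CF.1.
move=> i; split; first by move=> x _; have [] := is_derive_ray_avg j x i C1.
apply: (eq_Ck_on openT) (IH j.+1 _ (CF.2 i).2) => x _.
by have [_ ->] := is_derive_ray_avg j x i C1.
Qed.

(** The coefficients are averages of the partial derivatives over the segment from [q]. This is what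
    forces an abstract derivation at [q] to act through first partial derivatives. *)
Lemma hadamard F : smooth_on setT F ->
  exists H : 'I_n -> 'rV[R]_n -> R, [/\ forall i, smooth_on setT (H i),
    forall i, H i q = 'D_(delta_mx 0 i) F q &
    forall x, F x = F q + \sum_(i < n) (x 0 i - q 0 i) * H i x].
Proof.
move=> sF; exists (fun i => ray_avg 0 ('D_(delta_mx 0 i) F)); split.
- by move=> i k; apply: Ck_on_ray_avg; exact: ((sF k.+1).2 i).2.
- move=> i; rewrite /ray_avg -[RHS]avg01_cst; congr avg01; apply/funext => t.
  by rewrite subrr scaler0 addr0 expr0 mul1r.
move=> x.
have cD i : continuous ('D_(delta_mx 0 i) F) by move=> y; exact: ((sF 1%N).2 i).2.1.
pose phi (t : R) := \sum_(i < n) (x 0 i - q 0 i) * 'D_(delta_mx 0 i) F (q + t *: (x - q)).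
have cr i : continuous (fun t : R => 'D_(delta_mx 0 i) F (q + t *: (x - q))).
  move=> t; apply: (@continuous_comp _ _ _ (fun t : R => q + t *: (x - q))
    ('D_(delta_mx 0 i) F)); [exact: ray_continuous|exact: cD].
have cphi : continuous phi.
  apply: continuous_big => [|i _ t]; first exact: add_continuous.
  by apply: (@cvgMl_tmp R _ (nbhs t)); exact: cr.
have dphi t : is_derive t (1 : R) (fun t => F (q + t *: (x - q))) (phi t).
  have [df Df] := @C1_differentiable R n setT F (q + t *: (x - q)) openT I (sF 1%N).
  have [dl El] := is_derive_line (diff_derivable (v := x - q) df).
  apply: DeriveDef => //; rewrite El Df; apply: eq_bigr => i _.
  by rewrite !mxE.
have := avg01_FTC cphi dphi; rewrite scale1r scale0r addr0 (addrC q) subrK => E.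
apply/eqP; rewrite addrC -subr_eq -E; apply/eqP.
rewrite /phi avg01_sum.
  apply: eq_bigr => i _; rewrite avg01Z; last exact: cr.
  rewrite /ray_avg; congr (_ * _); congr avg01; apply/funext => t.
  by rewrite expr0 mul1r.
by move=> i t; apply: (@cvgMl_tmp R _ (nbhs t)); exact: cr.
Qed.

End Hadamard.

(** * Derivative tests at a maximum *)

Section MaximumTests.
Variables (R : realType) (n : nat).
Implicit Types (f : 'rV[R]_n -> R) (U : set 'rV[R]_n).

Lemma locally_cst_ball f x0 r : Ck_on 1 (ball x0 r) f ->
  (forall y i, ball x0 r y -> 'D_(delta_mx 0 i) f y = 0) ->
  forall y, ball x0 r y -> f y = f x0.
Proof.
move=> Cf df0 y By.
have ob : open (ball x0 r) by exact: ball_open.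
have inb (s : R) : `|s| <= `|1 : R| -> ball x0 r (x0 + s *: (y - x0)).
  rewrite normr1 => s1; move: By; rewrite -!ball_normE /=; apply: le_lt_trans.
  by rewrite opprD addNKr normrN normrZ distrC ler_piMl.
have D (s : R) (s1 : `|s| <= `|1 : R|) := C1_differentiable ob (inb s s1) Cf.
have [|c c1] := @mvt_line R n f x0 (y - x0) 1.
  by move=> s /D[df _]; exact: diff_derivable.
have [_ ->] := D c c1.
rewrite scale1r [x0 + _]addrC subrK => /eqP; rewrite subr_eq => /eqP ->.
rewrite big1 ?mul0r ?add0r // => i _.
by rewrite df0 ?mulr0 //; exact: inb.
Qed.

Lemma local_max_derivative U f x0 : open U -> U x0 -> Ck_on 1 U f ->
  (forall x, U x -> f x <= f x0) -> forall v, 'D_v f x0 = 0.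
Proof.
move=> oU Ux0 Cf fmax v.
pose h (t : R) := f (x0 + t *: v).
have cl : continuous (fun t : R => x0 + t *: v).
  move=> t; apply: cvgD; first exact: cvg_cst.
  by apply: cvgZr_tmp; exact: cvg_id.
have : \forall t \near (0 : R), U (x0 + t *: v).
  by apply: (cl 0); rewrite scale0r addr0; exact: open_nbhs_nbhs.
move/nbhs_ballP => [d /= d0 Hd].
have Ud (t : R) : t \in `]-d, d[ -> U (x0 + t *: v).
  by rewrite in_itv /= => td; apply: Hd; rewrite -ball_normE /= sub0r normrN ltr_norml.
have dh (t : R) : t \in `]-d, d[ -> is_derive t (1 : R) h ('D_v f (x0 + t *: v)).
  move=> /Ud Ut; apply: is_derive_line; apply: diff_derivable.
  by have [] := C1_differentiable oU Ut Cf.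
have I0 : (0 : R) \in `]-d, d[ by rewrite in_itv /= oppr_lt0 d0.
have := @derive1_at_max R h (-d) d 0 _ _ I0.
case; [by rewrite ltW // (lt_trans _ d0) // oppr_lt0|by move=> t /dh[]| |].
  by move=> t /Ud /fmax; rewrite /h scale0r addr0.
by move=> _; have [_ ->] := dh 0 I0; rewrite scale0r addr0.
Qed.

Lemma local_max_hessian U f x0 (a : 'rV[R]_n) : open U -> U x0 -> Ck_on 2 U f ->
  (forall x, U x -> f x <= f x0) ->
  \sum_(i < n) \sum_(j < n)
    a 0 i * a 0 j * 'D_(delta_mx 0 i) ('D_(delta_mx 0 j) f) x0 <= 0.
Proof.
move=> oU Ux0 Cf fmax; pose G y := \sum_(j < n) a 0 j * 'D_(delta_mx 0 j) f y.
have C1f : Ck_on 1 U f by exact: Ck_on_le Cf.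
have CG : Ck_on 1 U G.
  apply: Ck_on_sum => // j _; apply: (Ck_onM oU (Ck_on_cst oU 1 (a 0 j))).
  exact: (Cf.2 j).2.
have DG y : U y -> 'D_a f y = G y by move=> Uy; have [_ ->] := C1_differentiable oU Uy C1f.
have G0 : G x0 = 0 by rewrite -DG //; exact: (local_max_derivative oU Ux0 C1f fmax).
have -> : \sum_(i < n) \sum_(j < n)
    a 0 i * a 0 j * 'D_(delta_mx 0 i) ('D_(delta_mx 0 j) f) x0 = 'D_a G x0.
  have [_ ->] := C1_differentiable oU Ux0 CG; apply: eq_bigr => i _.
  have dj (j : 'I_n) : derivable (fun y => a 0 j * 'D_(delta_mx 0 j) f y) x0 (delta_mx 0 i).
    have := (Ck_onM oU (Ck_on_cst oU 1 (a 0 j)) (Cf.2 j).2).2 i.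
    by case=> H _; exact: H.
  have -> : G = \sum_(j < n) (fun y => a 0 j * 'D_(delta_mx 0 j) f y).
    by apply/funext => y; rewrite fct_sumE.
  rewrite derive_sum // mulr_sumr; apply: eq_bigr => j _.
  rewrite -mulrA; congr (_ * _).
  have := @deriveZ R _ _ ('D_(delta_mx 0 j) f) (a 0 j) x0 (delta_mx 0 i).
  by move=> -> //; exact: ((Cf.2 j).2.2 i).1.
(* If the second derivative along [a] were positive, the first one, [G], would vanish at [x0] and be
   positive shortly after, so [f] would increase along [a]. *)
rewrite leNgt; apply/negP => c0; set c := 'D_a G x0 in c0.
pose h (t : R) := f (x0 + t *: a).
have cl : continuous (fun t : R => x0 + t *: a).
  move=> t; apply: cvgD; first exact: cvg_cst.
  by apply: cvgZr_tmp; exact: cvg_id.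
have nU : \forall t \near (0 : R), U (x0 + t *: a).
  by apply: (cl 0); rewrite scale0r addr0; exact: open_nbhs_nbhs.
have nG : \forall t \near (0 : R)^', 0 < t^-1 * G (x0 + t *: a).
  have [dG _] := C1_differentiable oU Ux0 CG.
  have : (fun t : R => t^-1 *: (G (t *: a + x0) - G x0)) @ 0^' --> c.
    exact: (diff_derivable (v := a) dG).
  move/cvgrPdist_lt => /(_ _ c0); apply: filterS => t.
  rewrite G0 subr0 [t *: a + _]addrC ltr_norml => /andP[_].
  by rewrite ltrBlDr ltrDl.
have : \forall t \near (0 : R)^', U (x0 + t *: a) /\ 0 < t^-1 * G (x0 + t *: a).
  by apply: filterS2 nG (nbhs_dnbhs nU) => t.
move=> [d /= d0 Hd].
have Ud (t : R) : 0 <= t < d -> U (x0 + t *: a).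
  move=> /andP[]; rewrite le_eqVlt => /predU1P[<- _|t0 td].
    by rewrite scale0r addr0.
  by apply: (Hd t _ _).1; rewrite /= ?sub0r ?normrN ?gtr0_norm ?gt_eqF.
have Gd (t : R) : 0 < t < d -> 0 < G (x0 + t *: a).
  move=> /andP[t0 td].
  have := (Hd t _ _).2; rewrite /= sub0r normrN gtr0_norm // gt_eqF // => /(_ td isT).
  by rewrite pmulr_rgt0 // invr_gt0.
have d20 : 0 < d / 2 by rewrite divr_gt0.
have d2d : d / 2 < d by rewrite ltr_pdivrMr // mulr_natr mulr2n ltrDl.
have dh (t : R) : 0 <= t < d -> is_derive t (1 : R) h (G (x0 + t *: a)).
  move=> /Ud Ut; rewrite -DG //; apply: is_derive_line; apply: diff_derivable.
  by have [] := C1_differentiable oU Ut C1f.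
have dh1 (t : R) : t \in `]0, d / 2[ -> is_derive t (1 : R) h (G (x0 + t *: a)).
  by rewrite in_itv /= => /andP[t0 t1]; apply: dh; rewrite ltW //= (lt_trans t1).
have ch : {within `[0, d / 2], continuous h}.
  apply: derivable_within_continuous => t; rewrite in_itv /= => /andP[t0 t1].
  by have [] // := dh t; rewrite t0 (le_lt_trans t1).
have [s] := MVT d20 dh1 ch; rewrite in_itv /= => /andP[s0 s1] E.
have : 0 < h (d / 2) - h 0.
  by rewrite E mulr_gt0 ?subr_gt0 // Gd // s0 (lt_trans s1).
rewrite subr_gt0 ltNge /h scale0r addr0 fmax //.
by apply: Ud; rewrite ltW.
Qed.

End MaximumTests.

(** * Charts, tangent vectors and local frames *)

Section RowVectors.
Variables (R : realType) (n : nat).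

Lemma rV_closed_ball_compact (x0 : 'rV[R]_n) (r : R) : compact [set x | `|x - x0| <= r].
Proof.
apply: bounded_closed_compact.
  exists (r + `|x0|); split; first exact: num_real.
  move=> b rb x /= xr; apply: le_trans (ltW rb).
  by rewrite -[x](subrK x0) (le_trans (ler_normD _ _)) // lerD2r.
have cn : continuous (fun x : 'rV[R]_n => `|x - x0|).
  move=> x; apply: (@cvg_norm _ _ _ (nbhs x)).
  by apply: cvgB; [exact: cvg_id|exact: cvg_cst].
exact: (closed_comp (fun x _ => cn x) (@closed_le R r)).
Qed.

Lemma smooth_on_supported (x0 : 'rV[R]_n) (r : R) (U : set 'rV[R]_n)
    (chi k : 'rV[R]_n -> R) :
  open U -> [set x | `|x - x0| <= r] `<=` U -> smooth_on setT chi ->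
  (forall x, chi x != 0 -> `|x - x0| <= r) -> smooth_on U k ->
  smooth_on setT (fun x => chi x * k x).
Proof.
move=> oU CU schi chi0 sk j; apply: Ck_on_local => x _.
have [Ux|nUx] := pselect (U x).
  exists U; split=> //; apply: Ck_onM => //.
  exact: Ck_on_sub (schi j).
exists (~` [set x | `|x - x0| <= r]); split.
- by apply: closed_openC; apply: compact_closed; [exact: norm_hausdorff|exact: rV_closed_ball_compact].
- by move=> /CU.
have oC : open (~` [set x | `|x - x0| <= r]).
  by apply: closed_openC; apply: compact_closed; [exact: norm_hausdorff|exact: rV_closed_ball_compact].
apply: (eq_Ck_on oC) (Ck_on_cst oC j 0) => z /= nz.
by have [->|/chi0//] := eqVneq (chi z) 0; rewrite mul0r.
Qed.

End RowVectors.

Section Charts.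
Variables (R : realType) (n : nat) (M : smoothManifold R n).
Implicit Types (c d : chart R n M) (p q : M).

Definition chart_img c := chart_map c @` chart_dom c.

Lemma chart_imgP c p : chart_dom c p -> chart_img c (chart_map c p).
Proof. by exists p. Qed.

Lemma chart_invP c x : chart_img c x ->
  chart_dom c (chart_inv c x) /\ chart_map c (chart_inv c x) = x.
Proof. by move=> [q dq <-]; rewrite chart_mapK. Qed.

Lemma open_chart_img_sub c (O : set M) : open O ->
  open (chart_map c @` (chart_dom c `&` O)).
Proof.
move=> oO; rewrite openE => _ [q [dq Oq] <-].
have ci := chart_inv_continuous (chart_imgP dq).
have n1 : nbhs (chart_map c q) (chart_img c).
  by apply: open_nbhs_nbhs; split; [exact: chart_img_open|exact: chart_imgP].
have n2 : nbhs (chart_map c q) (chart_inv c @^-1` O).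
  by apply: ci; rewrite chart_mapK //; exact: open_nbhs_nbhs.
apply: filterS2 n1 n2 => y /chart_invP[dy Ey] Oy.
by exists (chart_inv c y).
Qed.

Lemma smooth_continuous (f : M -> R) : smooth f -> continuous f.
Proof.
move=> sf p; have [c ac dp] := atlas_cover p.
have nd : nbhs p (chart_dom c) by apply: open_nbhs_nbhs; split => //; exact: chart_dom_open.
have cf : (fun q => f (chart_inv c (chart_map c q))) @ p --> f (chart_inv c (chart_map c p)).
  apply: (@continuous_comp _ _ _ (chart_map c) (f \o chart_inv c)).
    exact: chart_map_continuous.
  exact: (sf c ac 0%N).1 (chart_imgP dp).
rewrite chart_mapK // in cf; apply: cvg_trans cf; apply: near_eq_cvg.
by apply: filterS nd => q dq; rewrite chart_mapK.
Qed.

(* [k] read in the chart [c], cut off by [chi] and extended by zero *)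
Definition chart_cut c (chi k : 'rV[R]_n -> R) (q : M) : R :=
  if `[< chart_dom c q >] then chi (chart_map c q) * k (chart_map c q) else 0.

Lemma chart_cutE c chi k q : chart_dom c q ->
  chart_cut c chi k q = chi (chart_map c q) * k (chart_map c q).
Proof. by move=> dq; rewrite /chart_cut asboolT. Qed.

Lemma chart_cut_inv c chi k x : chart_img c x ->
  chart_cut c chi k (chart_inv c x) = chi x * k x.
Proof. by move=> /chart_invP[dx Ex]; rewrite chart_cutE // Ex. Qed.

Lemma smooth_chart_cut c x0 r chi k : atlas c ->
  [set x | `|x - x0| <= r] `<=` chart_img c -> smooth_on setT chi ->
  (forall x, chi x != 0 -> `|x - x0| <= r) -> smooth_on (chart_img c) k ->
  smooth (chart_cut c chi k).
Proof.
move=> ac CU schi chi0 sk d ad j.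
have sT := smooth_on_supported (@chart_img_open _ _ _ c) CU schi chi0 sk.
(* [K] is compact, hence closed because [M] is Hausdorff; this makes the extension by zero smooth at
   boundary points of the chart domain too. *)
pose K := chart_inv c @` [set x | `|x - x0| <= r].
have cK : closed K.
  apply: compact_closed; first exact: manifold_hausdorff.
  apply: continuous_compact; last exact: rV_closed_ball_compact.
  apply: continuous_in_subspaceT => x /set_mem/CU.
  exact: chart_inv_continuous.
apply: Ck_on_local => _ [q dq <-].
have [cq|ncq] := pselect (chart_dom c q).
  have oV := open_chart_img_sub (c := d) (chart_dom_open c).
  exists (chart_map d @` (chart_dom d `&` chart_dom c)); split => //; first by exists q.
  have CT : Ck_on j (chart_map d @` (chart_dom d `&` chart_dom c))
      (fun y => (fun x => chi x * k x) (chart_map c (chart_inv d y))).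
    apply: (@Ck_on_comp R n n (chart_map d @` (chart_dom d `&` chart_dom c)) setT
      (fun y => chart_map c (chart_inv d y)) oV openT (fun _ _ => I) j _ (sT j)).
    by move=> i; exact: atlas_compatible.
  by apply: (eq_Ck_on oV) CT => _ [q' [dq' cq'] <-] /=; rewrite chart_cutE chart_mapK.
exists (chart_map d @` (chart_dom d `&` ~` K)); split.
- by apply: open_chart_img_sub; exact: closed_openC.
- by exists q => //; split=> // -[x /CU/chart_invP[dx _] E]; apply: ncq; rewrite -E.
have oV := open_chart_img_sub (c := d) (closed_openC cK).
apply: (eq_Ck_on oV) (Ck_on_cst oV j 0) => _ [q' [dq' nK] <-] /=.
rewrite chart_mapK // /chart_cut; case: asboolP => // cq'.
have [->|/chi0 H] := eqVneq (chi (chart_map c q')) 0; first by rewrite mul0r.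
by exfalso; apply: nK; exists (chart_map c q') => //; rewrite chart_mapK.
Qed.

Lemma chart_bump c p : atlas c -> chart_dom c p ->
  exists chi : 'rV[R]_n -> R, exists r : R,
    [/\ 0 < r, [set x | `|x - chart_map c p| <= r] `<=` chart_img c, smooth_on setT chi,
        0 < chi (chart_map c p) & forall x, chi x != 0 -> `|x - chart_map c p| <= r].
Proof.
move=> ac dp; have : nbhs (chart_map c p) (chart_img c).
  by apply: open_nbhs_nbhs; split; [exact: chart_img_open|exact: chart_imgP].
move/nbhs_ballP => [r /= r0 Hr].
have r20 : 0 < r / 2 by rewrite divr_gt0.
have [chi [schi chi_gt0 supp]] := bump_exists (chart_map c p) r20.
exists chi, (r / 2); split=> // x /= xr; apply: Hr; rewrite -ball_normE /= distrC.
by apply: le_lt_trans xr _; rewrite ltr_pdivrMr // mulr_natr mulr2n ltrDl.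
Qed.

End Charts.

Section Tangents.
Variables (R : realType) (n : nat) (M : smoothManifold R n) (p : M).
Implicit Types (v : tangent p) (f g : smoothFun M).

Lemma tangentD v f g : v (f + g) = v f + v g.
Proof. by rewrite -[f]scale1r (tangentP v).1 mul1r scale1r. Qed.

Lemma tangent0 v : v 0 = 0.
Proof. by apply: (addrI (v 0)); rewrite -tangentD !addr0. Qed.

Lemma tangentZ v (a : R) f : v (a *: f) = a * v f.
Proof. by rewrite -[a *: f]addr0 (tangentP v).1 tangent0 addr0. Qed.

Lemma tangentM v f g : v (f * g) = v f * g p + f p * v g.
Proof. exact: (tangentP v).2. Qed.

Lemma tangentN v f : v (- f) = - v f.
Proof. by rewrite -scaleN1r tangentZ mulN1r. Qed.

Lemma tangentB v f g : v (f - g) = v f - v g.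
Proof. by rewrite tangentD tangentN. Qed.

Lemma tangent_sum v (I : Type) (s : seq I) (F : I -> smoothFun M) :
  v (\sum_(i <- s) F i) = \sum_(i <- s) v (F i).
Proof.
elim: s => [|i s IH]; first by rewrite !big_nil tangent0.
by rewrite !big_cons tangentD IH.
Qed.

Definition scst (a : R) : smoothFun M := mkSmooth (smooth_cst (M := M) a).

Lemma tangent_cst v a : v (scst a) = 0.
Proof.
have E1 : scst 1 * scst 1 = scst 1 by apply/val_inj/funext => q /=; exact: mulr1.
have v1 : v (scst 1) = 0.
  have : v (scst 1 * scst 1) = v (scst 1) * 1 + 1 * v (scst 1) by exact: tangentM.
  by rewrite E1 mulr1 mul1r => /eqP; rewrite -subr_eq subrr eq_sym => /eqP.
have -> : scst a = a *: scst 1 by apply/val_inj/funext => q /=; rewrite -[LHS]mulr1.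
by rewrite tangentZ v1 mulr0.
Qed.

Lemma smooth_sumE (I : Type) (s : seq I) (F : I -> smoothFun M) q :
  (\sum_(i <- s) F i) q = \sum_(i <- s) F i q.
Proof. by elim: s => [|i s IH]; rewrite ?big_nil // !big_cons -IH. Qed.

Lemma tangent_eqP v (w : tangent p) : (forall f, v f = w f) -> v = w.
Proof. by move=> H; apply/val_inj/funext. Qed.

Lemma tangent_addE v (w : tangent p) f : (v + w) f = v f + w f. Proof. by []. Qed.
Lemma tangent_oppE v f : (- v) f = - v f. Proof. by []. Qed.
Lemma tangent_scaleE a v f : (a *: v) f = a * v f. Proof. by []. Qed.
Lemma tangent_zeroE f : (0 : tangent p) f = 0. Proof. by []. Qed.

Lemma tangent_sumE (I : Type) (s : seq I) (F : I -> tangent p) f :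
  (\sum_(i <- s) F i) f = \sum_(i <- s) F i f.
Proof. by elim: s => [|i s IH]; rewrite ?big_nil // !big_cons -IH. Qed.

End Tangents.

Lemma smooth_eqP (R : realType) n (M : smoothManifold R n) (f g : smoothFun M) :
  (forall q, f q = g q) -> f = g.
Proof. by move=> H; apply/val_inj/funext. Qed.

Lemma vfield_eqP (R : realType) n (M : smoothManifold R n) (X Y : vfield M) :
  (forall p, X p = Y p) -> X = Y.
Proof.
case: X Y => [X sX] [Y sY] /= H; have XY : X = Y by apply/functional_extensionality_dep.
by rewrite XY in sX *; congr Vfield; exact: Prop_irrelevance.
Qed.

(** * Cut-off coordinate frames *)

Section Frames.
Variables (R : realType) (n : nat) (M : smoothManifold R n).

(** By the quotient rule this is chi^2 d(y_j / chi). For y_j = chi x_j it is chi^2 dx_j, written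
    with global functions only; against the fields chi d/dx_i it produces the factors chi^3
    below. *)
Definition coframe (chi : smoothFun M) (y : 'I_n -> smoothFun M) (q : M)
    (v : tangent q) (j : 'I_n) : R :=
  chi q * v (y j) - y j q * v chi.

(* [fchi] cuts off a chart around [p], [fy i] is the cut-off [i]-th coordinate and
   [fE i] the cut-off [i]-th coordinate field; none of the identities needs the
   cut-off to be constant near [p]. *)
Record local_frame (p : M) := LocalFrame {
  fchi : smoothFun M;
  fy : 'I_n -> smoothFun M;
  fE : 'I_n -> vfield M;
  fchi_gt0 : 0 < fchi p;
  fy_eq0 : forall i, fy i p = 0;
  frame_expand : forall q (v : tangent q),
    fchi q ^+ 3 *: v = \sum_(i < n) coframe fchi fy v i *: fE i q;
  frame_dual : forall q i j, coframe fchi fy (fE i q) j = fchi q ^+ 3 * (i == j)%:R;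
  frame_compact : exists C : set M, [/\ compact C, nbhs p C & forall q, C q -> 0 < fchi q];
  frame_max : forall f : smoothFun M, (forall q, f q <= f p) ->
    (forall i, fE i p f = 0) /\
    (forall a : 'rV[R]_n,
       \sum_(i < n) \sum_(j < n) a 0 i * a 0 j * fE i p (vder (fE j) f) <= 0);
  frame_cst : forall f : smoothFun M, (forall q i, fE i q f = 0) ->
    \forall q \near p, f q = f p }.

Section FrameConstruction.
Variables (p : M) (c : chart R n M) (chi : 'rV[R]_n -> R) (r : R).
Let x0 := chart_map c p.
Hypotheses (ac : atlas c) (dp : chart_dom c p) (r0 : 0 < r).
Hypotheses (CU : [set x | `|x - x0| <= r] `<=` chart_img c) (schi : smooth_on setT chi).
Hypotheses (chi_x0 : 0 < chi x0) (supp : forall x, chi x != 0 -> `|x - x0| <= r).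

Let oU : open (chart_img c). Proof. exact: chart_img_open. Qed.
Let cut_smooth k : smooth_on (chart_img c) k -> smooth (chart_cut c chi k).
Proof. exact: smooth_chart_cut ac CU schi supp. Qed.

Let chi_smooth : smooth (chart_cut c chi (fun=> 1)).
Proof. by apply: cut_smooth => k; exact: Ck_on_cst. Qed.

Let y_smooth i : smooth (chart_cut c chi (fun x => x 0 i - x0 0 i)).
Proof.
apply: cut_smooth => k.
exact: (Ck_onD oU (Ck_on_coord oU k i) (Ck_on_cst oU k (- x0 0 i))).
Qed.

Let chiM := mkSmooth chi_smooth.
Let yM i := mkSmooth (y_smooth i).

Let loc (f : smoothFun M) : smooth_on (chart_img c) (f \o chart_inv c).
Proof. exact: smoothFunP. Qed.

Let der i (f : M -> R) (x : 'rV[R]_n) := 'D_(delta_mx 0 i) (f \o chart_inv c) x.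

Let derivable_loc i (f : smoothFun M) x : chart_img c x ->
  derivable (f \o chart_inv c) x (delta_mx 0 i).
Proof. by move=> cx; exact: ((loc f 1%N).2 i).1. Qed.

Arguments derivable_loc i f {x} _.

Let E_derivation i q : derivation_at q (fun f => chart_cut c chi (der i f) q).
Proof.
split=> [a f g|f g]; rewrite /chart_cut; case: asboolP => [dq|_].
- have -> : der i (a *: f + g) (chart_map c q) =
      'D_(delta_mx 0 i) (a *: (f \o chart_inv c) + (g \o chart_inv c)) (chart_map c q).
    by [].
  have df := derivable_loc i f (chart_imgP dq).
  have dg := derivable_loc i g (chart_imgP dq).
  rewrite (deriveD (derivableZ (k := a) df) dg) (deriveZ a df).
  by rewrite [a *: _]/(a * _) mulrDr mulrCA.
- by rewrite mulr0 addr0.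
- have -> : der i (f * g) (chart_map c q) =
      'D_(delta_mx 0 i) ((f \o chart_inv c) * (g \o chart_inv c)) (chart_map c q).
    by [].
  have df := derivable_loc i f (chart_imgP dq).
  have dg := derivable_loc i g (chart_imgP dq).
  rewrite (deriveM df dg) /= chart_mapK //; set x1 := chart_map c q.
  transitivity (chi x1 * (f q * der i g x1 + g q * der i f x1)); first by [].
  by ring.
- by rewrite mul0r mulr0 addr0.
Qed.

Let E_smooth i : smooth_field (fun q => mkTangent (E_derivation i q)).
Proof. by move=> f; apply: cut_smooth => k; exact: ((loc f k.+1).2 i).2. Qed.

Let E i := Vfield (E_smooth i).

Let E_E i q f : E i q f = chart_cut c chi (der i f) q. Proof. by []. Qed.

Let chiME q : chart_dom c q -> chiM q = chi (chart_map c q).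
Proof. by move=> dq; rewrite /chiM /= chart_cutE // mulr1. Qed.

Let yME i q : chart_dom c q -> yM i q = chi (chart_map c q) * (chart_map c q 0 i - x0 0 i).
Proof. by move=> dq; rewrite /yM /= chart_cutE. Qed.

Let chi_f_smooth (f : smoothFun M) : smooth_on setT (fun x => chi x * f (chart_inv c x)).
Proof. exact: (smooth_on_supported oU CU schi supp (loc f)). Qed.

Let derchi i x : derivable chi x (delta_mx 0 i).
Proof. by have [_ /(_ i)[H _]] := schi 1%N; exact: H. Qed.

Let der_chi_f i (f : smoothFun M) x : chart_img c x ->
  'D_(delta_mx 0 i) (fun x => chi x * f (chart_inv c x)) x =
  'D_(delta_mx 0 i) chi x * f (chart_inv c x) + chi x * der i f x.
Proof.
move=> cx; rewrite (deriveM (f := chi) (g := f \o chart_inv c)) //; last exact: derivable_loc.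
by rewrite addrC [_ *: _]mulrC.
Qed.

(* Hadamard's lemma applied to [chi * f] at [q] *)
Let expand_aux q (v : tangent q) (f : smoothFun M) : chart_dom c q ->
  chi (chart_map c q) ^+ 2 * (v chiM * f q + chi (chart_map c q) * v f) =
  \sum_(i < n) coframe chiM yM v i *
    ('D_(delta_mx 0 i) chi (chart_map c q) * f q + chi (chart_map c q) * der i f (chart_map c q)).
Proof.
move=> dq; set x1 := chart_map c q.
have [H [sH Hq HE]] := hadamard x1 (chi_f_smooth f).
have sHc i : smooth_on (chart_img c) (H i) by move=> k; apply: Ck_on_sub (sH i k).
pose h i := mkSmooth (cut_smooth (sHc i)).
pose a := chi x1 * f q.
(* [u i] is chi times the difference of x_i and its value at [q]. One factor chi makes this
   difference a global function, another one does so for [H i], so that [v] can be applied to the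
   identity [key]. *)
pose u i := yM i + (x0 0 i - x1 0 i) *: chiM.
have key : chiM * chiM * (chiM * f - scst M a) = \sum_(i < n) u i * h i.
  apply: smooth_eqP => z; rewrite smooth_sumE.
  rewrite (_ : (chiM * chiM * (chiM * f - scst M a)) z = chiM z * chiM z * (chiM z * f z - a)) //.
  have uh i : (u i * h i) z = (yM i z + (x0 0 i - x1 0 i) * chiM z) * h i z by [].
  under eq_bigr do rewrite uh.
  have [dz|ndz] := pselect (chart_dom c z).
    rewrite chiME //; have := HE (chart_map c z); rewrite chart_mapK // chart_mapK //.
    rewrite -/a => ->; rewrite [a + _]addrC addrK mulr_sumr.
    by apply: eq_bigr => i _; rewrite yME // /h /= chart_cutE //; ring.
  have chi0 : chiM z = 0 by rewrite /chiM /= /chart_cut asboolF.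
  rewrite chi0 !mul0r big1 // => i _.
  by rewrite [h i z](_ : _ = 0) ?mulr0 // /h /= /chart_cut asboolF.
have /(congr1 v) := key.
rewrite tangent_sum !tangentM tangentB tangentM tangent_cst.
rewrite (_ : (chiM * f - scst M a) q = 0); last first.
  by rewrite (_ : (chiM * f - scst M a) q = chiM q * f q - a) // chiME // subrr.
rewrite (_ : (chiM * chiM) q = chi x1 * chi x1); last by rewrite -chiME.
rewrite chiME // => key'.
transitivity (chi x1 * chi x1 * (v chiM * f q + chi x1 * v f)); first by ring.
move: key'; rewrite mulr0 add0r subr0 => ->.
apply: eq_bigr => i _; rewrite tangentM.
rewrite (_ : u i q = 0); last first.
  rewrite (_ : u i q = yM i q + (x0 0 i - x1 0 i) * chiM q) //.
  by rewrite yME // chiME //; ring.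
rewrite mul0r addr0 tangentD tangentZ [h i q](_ : _ = chi x1 * H i x1); last first.
  by rewrite /h /= chart_cutE.
rewrite Hq der_chi_f ?chart_mapK //; last exact: chart_imgP.
by rewrite /coframe yME // chiME // -/x1; ring.
Qed.

Arguments expand_aux {q} v f _.

Let expand q (v : tangent q) : chiM q ^+ 3 *: v = \sum_(i < n) coframe chiM yM v i *: E i q.
Proof.
apply: tangent_eqP => f; rewrite tangent_sumE tangent_scaleE.
under eq_bigr do rewrite tangent_scaleE E_E.
have [dq|ndq] := pselect (chart_dom c q); last first.
  have c0 : chiM q = 0 by rewrite /chiM /= /chart_cut asboolF.
  rewrite c0 expr0n mul0r big1 // => i _.
  by rewrite /chart_cut asboolF // mulr0.
(* The instance of the constant function 1 computes [v chiM]; subtracting [f q] times it removes all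
   derivatives of chi. *)
have e1 := expand_aux v f dq; have e2 := expand_aux v (scst M 1) dq.
rewrite tangent_cst mulr0 addr0 in e2.
have d1 i : der i (scst M 1) (chart_map c q) = 0.
  by rewrite /der (_ : _ \o _ = cst 1) // derive_cst.
have one : scst M 1 q = 1 by [].
rewrite one mulr1 in e2.
have e3 : \sum_(i < n) coframe chiM yM v i * 'D_(delta_mx 0 i) chi (chart_map c q) =
    chi (chart_map c q) ^+ 2 * v chiM.
  by rewrite e2; apply: eq_bigr => i _; rewrite d1 mulr0 addr0 mulr1.
under eq_bigr do rewrite chart_cutE //.
rewrite chiME //; set X := chi _ in e1 e2 e3 *.
have : X ^+ 2 * (v chiM * f q + X * v f) = X ^+ 2 * v chiM * f q +
  \sum_(i < n) coframe chiM yM v i * (X * der i f (chart_map c q)).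
  rewrite e1 -e3 mulr_suml -big_split; apply: eq_bigr => i _ /=; ring.
by move=> e4; apply: (addrI (X ^+ 2 * v chiM * f q)); rewrite -e4; ring.
Qed.

Let dual q i j : coframe chiM yM (E i q) j = chiM q ^+ 3 * (i == j)%:R.
Proof.
have [dq|ndq] := pselect (chart_dom c q); last first.
  have c0 : chiM q = 0 by rewrite /chiM /= /chart_cut asboolF.
  by rewrite /coframe c0 !E_E /chart_cut asboolF // expr0n !mul0r mulr0 subr0.
rewrite /coframe !E_E !chart_cutE // yME // chiME //.
set x1 := chart_map c q; have cx1 : chart_img c x1 by exact: chart_imgP.
have nU : nbhs x1 (chart_img c) by exact: open_nbhs_nbhs.
have -> : der i (yM j) x1 =
    'D_(delta_mx 0 i) chi x1 * (x1 0 j - x0 0 j) + chi x1 * (i == j)%:R.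
  rewrite /der (near_eq_derive (g := fun x => chi x * (x 0 j - x0 0 j))); last first.
    by apply: filterS nU => x cx /=; rewrite chart_cut_inv.
  have dy : is_derive x1 (delta_mx 0 i : 'rV[R]_n) (fun x => x 0 j - x0 0 j : R) (i == j)%:R.
    have [d1 e1] := is_derive_coord x1 (delta_mx 0 i) j.
    have dc : derivable (cst (x0 0 j) : 'rV[R]_n -> R) x1 (delta_mx 0 i) by exact: derivable_cst.
    apply: DeriveDef; first exact: (derivableB d1 dc).
    by have := deriveB d1 dc; rewrite derive_cst e1 subr0 mxE eqxx /= eq_sym => <-.
  have [d2 e2] := dy.
  rewrite (deriveM (f := chi) (g := fun x => x 0 j - x0 0 j)) // e2.
  by rewrite addrC [_ *: _]mulrC.
have -> : der i chiM x1 = 'D_(delta_mx 0 i) chi x1.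
  rewrite /der (near_eq_derive (g := chi)) //.
  by apply: filterS nU => x cx /=; rewrite chart_cut_inv // mulr1.
ring.
Qed.

Let compact_nbhd : exists C : set M, [/\ compact C, nbhs p C & forall q, C q -> 0 < chiM q].
Proof.
have cx0 : chart_img c x0 by exact: chart_imgP.
have n1 : nbhs x0 (chart_img c) by exact: open_nbhs_nbhs.
have n2 : \forall x \near x0, 0 < chi x.
  have c0 : {for x0, continuous chi} by exact: (schi 0%N).1.
  by apply: (c0 [set t | 0 < t]); exact: lt_nbhsr.
have /nbhs_ballP[d /= d0 Hd] : nbhs x0 (chart_img c `&` [set x | 0 < chi x]) by exact: filterI.
have d20 : 0 < d / 2 by rewrite divr_gt0.
have sub x : `|x - x0| <= d / 2 -> chart_img c x /\ 0 < chi x.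
  move=> xd; apply: Hd; rewrite -ball_normE /= distrC.
  by apply: le_lt_trans xd _; rewrite ltr_pdivrMr // mulr_natr mulr2n ltrDl.
exists (chart_inv c @` [set x | `|x - x0| <= d / 2]); split.
- apply: continuous_compact; last exact: rV_closed_ball_compact.
  apply: continuous_in_subspaceT => x /set_mem/sub[cx _].
  exact: chart_inv_continuous.
- have nd : nbhs p (chart_dom c) by apply: open_nbhs_nbhs; split => //; exact: chart_dom_open.
  have nb : nbhs p (chart_map c @^-1` ball x0 (d / 2)).
    by apply: (chart_map_continuous dp); exact: nbhsx_ballx.
  apply: filterS2 nd nb => q dq /= bq; exists (chart_map c q); last by rewrite chart_mapK.
  by rewrite /= distrC ltW //; move: bq; rewrite -ball_normE.
by move=> _ [x /sub[/chart_invP[dx Ex] x_gt0] <-]; rewrite chart_cutE // Ex mulr1.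
Qed.

Let frame_maxP (f : smoothFun M) : (forall q, f q <= f p) ->
  (forall i, E i p f = 0) /\
  (forall a : 'rV[R]_n,
     \sum_(i < n) \sum_(j < n) a 0 i * a 0 j * E i p (vder (E j) f) <= 0).
Proof.
move=> fmax; have cx0 : chart_img c x0 by exact: chart_imgP.
have nU : nbhs x0 (chart_img c) by exact: open_nbhs_nbhs.
have lmax x : chart_img c x -> (f \o chart_inv c) x <= (f \o chart_inv c) x0.
  by move=> _ /=; rewrite /x0 chart_mapK.
have d0 i : der i f x0 = 0 by exact: (local_max_derivative oU cx0 (loc f 1%N) lmax).
split=> [i|a]; first by rewrite E_E chart_cutE // -/x0 d0 mulr0.
have H := local_max_hessian a oU cx0 (loc f 2%N) lmax.
have -> : \sum_(i < n) \sum_(j < n) a 0 i * a 0 j * E i p (vder (E j) f) =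
  chi x0 ^+ 2 * \sum_(i < n) \sum_(j < n) a 0 i * a 0 j *
     'D_(delta_mx 0 i) ('D_(delta_mx 0 j) (f \o chart_inv c)) x0.
  rewrite mulr_sumr; apply: eq_bigr => i _; rewrite mulr_sumr; apply: eq_bigr => j _.
  rewrite E_E chart_cutE // -/x0.
  (* The term with a derivative of chi carries a first derivative of [f], which is zero at the
     maximum. *)
  have -> : der i (vder (E j) f) x0 =
      chi x0 * 'D_(delta_mx 0 i) ('D_(delta_mx 0 j) (f \o chart_inv c)) x0.
    rewrite /der (near_eq_derive (g := fun x => chi x * der j f x)); last first.
      by apply: filterS nU => x cx /=; rewrite chart_cut_inv.
    have d2 : derivable (der j f) x0 (delta_mx 0 i).
      by have := ((loc f 2%N).2 j).2.2 i; case=> H' _; exact: H'.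
    by rewrite (deriveM (f := chi) (g := der j f)) // d0 scale0r addr0.
  by rewrite expr2; ring.
by rewrite mulr_ge0_le0 // sqr_ge0.
Qed.

Let frame_cstP (f : smoothFun M) : (forall q i, E i q f = 0) ->
  \forall q \near p, f q = f p.
Proof.
move=> f0; have [C [cC nC Cchi]] := compact_nbhd.
have cx0 : chart_img c x0 by exact: chart_imgP.
have n1 : nbhs x0 (chart_img c) by exact: open_nbhs_nbhs.
have n2 : \forall x \near x0, 0 < chi x.
  have c0 : {for x0, continuous chi} by exact: (schi 0%N).1.
  by apply: (c0 [set t | 0 < t]); exact: lt_nbhsr.
have /nbhs_ballP[d /= d0 Hd] : nbhs x0 (chart_img c `&` [set x | 0 < chi x]) by exact: filterI.
have bc : Ck_on 1 (ball x0 d) (f \o chart_inv c).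
  by apply: Ck_on_sub (loc f 1%N) => x /Hd[].
have der0 x i : ball x0 d x -> 'D_(delta_mx 0 i) (f \o chart_inv c) x = 0.
  move=> /Hd[cx chi0]; have := f0 (chart_inv c x) i.
  rewrite E_E chart_cut_inv // => /eqP; rewrite mulf_eq0 gt_eqF //= => /eqP.
  by [].
have nd : nbhs p (chart_dom c) by apply: open_nbhs_nbhs; split => //; exact: chart_dom_open.
have nb : nbhs p (chart_map c @^-1` ball x0 d).
  by apply: (chart_map_continuous dp); exact: nbhsx_ballx.
apply: filterS2 nd nb => q dq /= bq.
by have := locally_cst_ball bc der0 bq; rewrite /= /x0 !chart_mapK.
Qed.

Lemma local_frame_of_chart : local_frame p.
Proof.
apply: (@LocalFrame p chiM yM E) => //.
- by rewrite chiME.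
- by move=> i; rewrite yME // subrr mulr0.
Qed.

End FrameConstruction.

Lemma local_frame_exists p : exists F : local_frame p, True.
Proof.
have [c ac dp] := atlas_cover p.
have [chi [r [r0 CU schi chi0 supp]]] := chart_bump ac dp.
by exists (local_frame_of_chart ac dp CU schi chi0 supp).
Qed.

Definition frame p : local_frame p := projT1 (cid (local_frame_exists p)).

End Frames.

(** * Tensoriality, the maximum principle and smoothness of quotients *)

Section Fields.
Variables (R : realType) (n : nat) (M : smoothManifold R n).
Implicit Types (X Y Z : vfield M) (p q : M).

Lemma vzero_smooth : smooth_field (fun p : M => 0 : tangent p).
Proof. by move=> f; exact: smooth_cst. Qed.

Definition vzero : vfield M := Vfield vzero_smooth.

Lemma vsumE (I : Type) (s : seq I) (F : I -> vfield M) p :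
  (\big[@vadd R n M/vzero]_(i <- s) F i) p = \sum_(i <- s) F i p.
Proof. by elim: s => [|i s IH]; rewrite ?big_nil // !big_cons -IH. Qed.

Definition vcoord p (v : tangent p) (i : 'I_n) : R :=
  coframe (fchi (frame p)) (fy (frame p)) v i / fchi (frame p) p ^+ 3.

Lemma vcoordE p (v : tangent p) : v = \sum_(i < n) vcoord v i *: fE (frame p) i p.
Proof.
have c0 : fchi (frame p) p ^+ 3 != 0 by rewrite expf_neq0 // gt_eqF // fchi_gt0.
apply: (scalerI c0); rewrite frame_expand scaler_sumr; apply: eq_bigr => i _.
by rewrite scalerA /vcoord mulrC divfK.
Qed.

Definition vext p (v : tangent p) : vfield M :=
  \big[@vadd R n M/vzero]_(i < n) vscale (scst M (vcoord v i)) (fE (frame p) i).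

Lemma vextE p (v : tangent p) : vext v p = v.
Proof. by rewrite vsumE [RHS]vcoordE. Qed.

Section Tensorial.
Variables (V : lmodType R) (p : M) (T : vfield M -> V).
Hypothesis Tadd : forall X Y, T (vadd X Y) = T X + T Y.
Hypothesis Tscale : forall f X, T (vscale f X) = f p *: T X.

Lemma tensorial0 : T vzero = 0.
Proof.
apply: (addrI (T vzero)); rewrite -Tadd addr0; congr T.
by apply: vfield_eqP => q /=; rewrite addr0.
Qed.

Lemma tensorial_sum (I : Type) (s : seq I) (F : I -> vfield M) :
  T (\big[@vadd R n M/vzero]_(i <- s) F i) = \sum_(i <- s) T (F i).
Proof.
by elim: s => [|i s IH]; rewrite ?big_nil ?tensorial0 // !big_cons Tadd IH.
Qed.

(** For Z = X - Y, the field chi^3 Z is globally a combination of the frame fields whose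
    coefficients [theta i] vanish at [p], so chi(p)^3 T Z = 0. *)
Lemma tensorial X Y : X p = Y p -> T X = T Y.
Proof.
move=> XY; pose Z := vadd X (vscale (scst M (-1)) Y).
have Zp : Z p = 0 by rewrite /= XY scaleN1r subrr.
suff TZ : T Z = 0.
  by move: TZ; rewrite Tadd Tscale /= scaleN1r => /eqP; rewrite subr_eq0 => /eqP.
pose F := frame p; pose theta i := fchi F * vder Z (fy F i) - fy F i * vder Z (fchi F).
have c0 : fchi F p ^+ 3 != 0 by rewrite expf_neq0 // gt_eqF // fchi_gt0.
have E : vscale (fchi F * fchi F * fchi F) Z =
    \big[@vadd R n M/vzero]_(i < n) vscale (theta i) (fE F i).
  apply: vfield_eqP => q; rewrite vsumE.
  transitivity (fchi F q ^+ 3 *: Z q); first by rewrite !exprS expr0 mulr1 mulrA.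
  by rewrite frame_expand.
move/(congr1 T) : E; rewrite Tscale tensorial_sum big1 => [E|i _].
  apply: (scalerI c0); rewrite scaler0 -[RHS]E; congr (_ *: _).
  by rewrite !exprS expr0 mulr1 mulrA.
rewrite Tscale (_ : theta i p = 0) ?scale0r //.
rewrite (_ : theta i p = fchi F p * Z p (fy F i) - fy F i p * Z p (fchi F)) //.
by rewrite Zp !tangent_zeroE !mulr0 subr0.
Qed.

End Tensorial.

(** At a critical point the map X -> V (X f) is tensorial, because a derivative of a coefficient
    comes multiplied by X f. So the inner [V] can be replaced by a combination of frame fields with
    constant coefficients, to which the Hessian test of the frame applies. *)
Lemma max_principle (f : smoothFun M) p (V : vfield M) : (forall q, f q <= f p) ->
  V p f = 0 /\ V p (vder V f) <= 0.
Proof.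
move=> fmax; have [dE hE] := frame_max (frame p) fmax.
have df (v : tangent p) : v f = 0.
  by rewrite (vcoordE v) tangent_sumE big1 // => i _; rewrite tangent_scaleE dE mulr0.
split; first exact: df.
pose T X : R^o := V p (vder X f).
have Tadd X Y : T (vadd X Y) = T X + T Y by rewrite /T -tangentD; congr (V p _); exact: smooth_eqP.
have Tscale h X : T (vscale h X) = h p *: T X.
  rewrite /T (_ : vder _ f = h * vder X f); last exact: smooth_eqP.
  rewrite tangentM [X in _ * X + _](_ : _ = X p f) // df mulr0 add0r.
  by [].
have -> : V p (vder V f) = T (vext (V p)) by apply: (tensorial Tadd Tscale); rewrite vextE.
rewrite /vext (tensorial_sum Tadd).
pose a : 'rV[R]_n := \row_i vcoord (V p) i.
have := hE a; congr (_ <= 0); rewrite exchange_big; apply: eq_bigr => j _.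
rewrite Tscale /T {2}(vcoordE (V p)) tangent_sumE scaler_sumr; apply: eq_bigr => i _.
by rewrite tangent_scaleE !mxE [_ *: _]mulrA [X in X * _]mulrC.
Qed.

Lemma constant_of_derivative0 (f : smoothFun M) : connected [set: M] ->
  (forall q (v : tangent q), v f = 0) -> forall p q, f p = f q.
Proof.
move=> cM f0 p q; have fc := smooth_continuous (smoothFunP f).
have H : [set q | f q = f p] = [set: M].
  apply: cM; first by exists p.
  - exists [set q | f q = f p]; last by rewrite setTI.
    rewrite openE => r /= rp.
    have := @frame_cst _ _ _ r (frame r) f (fun q i => f0 q _).
    by apply: filterS => z; rewrite rp.
  - exists [set q | f q = f p]; last by rewrite setTI.
    exact: (closed_comp (fun x _ => fc x) (@closed_eq R (f p))).
by have : [set q | f q = f p] q by rewrite H.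
Qed.

(** Meant for functions defined by a choice at each point: near [p] they are quotients of smooth
    functions. The relation holds on all of [M], but [h] may vanish away from [p]. *)
Lemma smooth_div (phi : M -> R) :
  (forall p, exists h k : smoothFun M, h p != 0 /\ forall q, h q * phi q = k q) ->
  smooth phi.
Proof.
move=> H c ac j; apply: Ck_on_local => x cx.
have [h [k [hp hk]]] := H (chart_inv c x).
have ch : {for x, continuous (h \o chart_inv c)}.
  exact: (smoothFunP h ac 0%N).1 x cx.
pose U := chart_img c `&` [set y | h (chart_inv c y) != 0].
have oU : open U.
  have oN : open [set t : R | t != 0].
    rewrite (_ : [set t | t != 0] = ~` [set t | t = 0]).
      exact/closed_openC/closed_eq.
    by apply/seteqP; split=> t /= /eqP.
  rewrite openE => y [cy hy].
  have n1 : nbhs y (chart_img c) by apply: open_nbhs_nbhs; split => //; exact: chart_img_open.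
  have hc : {for y, continuous (h \o chart_inv c)} by exact: (smoothFunP h ac 0%N).1 y cy.
  have n2 : nbhs y ((h \o chart_inv c) @^-1` [set t | t != 0]).
    by apply: hc; exact: open_nbhs_nbhs.
  exact: filterI n1 n2.
have sub : U `<=` chart_img c by move=> y [].
exists U; split=> //.
have Ch : Ck_on j U (h \o chart_inv c) := Ck_on_sub sub (smoothFunP h ac j).
have Ckk : Ck_on j U (k \o chart_inv c) := Ck_on_sub sub (smoothFunP k ac j).
apply: (eq_Ck_on oU) (Ck_onM oU Ckk (Ck_onV oU _ Ch)) => [y [cy hy]|y [cy hy]] //=.
by rewrite -hk mulrC mulKf.
Qed.

Lemma smooth_sum (I : Type) (s : seq I) (F : I -> M -> R) :
  (forall i, smooth (F i)) -> smooth (fun q => \sum_(i <- s) F i q).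
Proof.
move=> sF; elim: s => [|i s IH].
  by have := smooth_cst (M := M) 0; congr smooth; apply/funext => q; rewrite big_nil.
by have := smoothD (sF i) IH; congr smooth; apply/funext => q; rewrite big_cons.
Qed.

Lemma smooth_prod (I : Type) (s : seq I) (F : I -> M -> R) :
  (forall i, smooth (F i)) -> smooth (fun q => \prod_(i <- s) F i q).
Proof.
move=> sF; elim: s => [|i s IH].
  by have := smooth_cst (M := M) 1; congr smooth; apply/funext => q; rewrite big_nil.
by have := smoothM (sF i) IH; congr smooth; apply/funext => q; rewrite big_cons.
Qed.

Lemma smooth_det m (G : M -> 'M[R]_m) : (forall i j, smooth (fun q => G q i j)) ->
  smooth (fun q => \det (G q)).
Proof.
move=> sG; rewrite /determinant; apply: smooth_sum => s.
apply: smoothM; first exact: smooth_cst.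
exact: smooth_prod.
Qed.

Lemma smooth_adj m (G : M -> 'M[R]_m) i j : (forall i j, smooth (fun q => G q i j)) ->
  smooth (fun q => \adj (G q) i j).
Proof.
move=> sG.
have : smooth (fun q => (-1) ^+ (j + i) * \det (row' j (col' i (G q)))).
  apply: smoothM; first exact: smooth_cst.
  apply: smooth_det => k l.
  by have := sG (lift j k) (lift i l); congr smooth; apply/funext => q; rewrite !mxE.
by congr smooth; apply/funext => q; rewrite !mxE.
Qed.

End Fields.

(** * Metrics and extremal tangent vectors *)

Section TensorBasics.
Variables (R : realType) (n : nat) (M : smoothManifold R n) (t : tensor2 M).
Variable p : M.
Implicit Types u v w : tangent p.

Lemma tensor2Dl u v w : t p (u + v) w = t p u w + t p v w.
Proof. by rewrite -[u]scale1r tensor2_linearl mul1r scale1r. Qed.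

Lemma tensor2Dr u v w : t p u (v + w) = t p u v + t p u w.
Proof. by rewrite -[v]scale1r tensor2_linearr mul1r scale1r. Qed.

Lemma tensor20l w : t p 0 w = 0.
Proof. by apply: (addrI (t p 0 w)); rewrite -tensor2Dl !addr0. Qed.

Lemma tensor20r w : t p w 0 = 0.
Proof. by apply: (addrI (t p w 0)); rewrite -tensor2Dr !addr0. Qed.

Lemma tensor2Zl a u w : t p (a *: u) w = a * t p u w.
Proof. by rewrite -[a *: u]addr0 tensor2_linearl tensor20l addr0. Qed.

Lemma tensor2Zr a u w : t p u (a *: w) = a * t p u w.
Proof. by rewrite -[a *: w]addr0 tensor2_linearr tensor20r addr0. Qed.

Lemma tensor2Nl u w : t p (- u) w = - t p u w.
Proof. by rewrite -scaleN1r tensor2Zl mulN1r. Qed.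

Lemma tensor2Nr u w : t p u (- w) = - t p u w.
Proof. by rewrite -scaleN1r tensor2Zr mulN1r. Qed.

Lemma tensor2_suml (I : Type) (s : seq I) (F : I -> tangent p) w :
  t p (\sum_(i <- s) F i) w = \sum_(i <- s) t p (F i) w.
Proof. by elim: s => [|i s IH]; rewrite ?big_nil ?tensor20l // !big_cons tensor2Dl IH. Qed.

Lemma tensor2_sumr (I : Type) (s : seq I) (F : I -> tangent p) w :
  t p w (\sum_(i <- s) F i) = \sum_(i <- s) t p w (F i).
Proof. by elim: s => [|i s IH]; rewrite ?big_nil ?tensor20r // !big_cons tensor2Dr IH. Qed.

End TensorBasics.

Section Metric.
Variables (R : realType) (n : nat) (M : smoothManifold R n) (g : metric M).

Lemma metric_ge0 p (u : tangent p) : 0 <= g p u u.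
Proof.
have [->|/metric_pos/ltW//] := eqVneq u 0.
by rewrite tensor20l.
Qed.

Lemma metric_eq0 p (u : tangent p) : g p u u = 0 -> u = 0.
Proof.
by have [//|u0] := eqVneq u 0; move=> E; have := metric_pos g u0; rewrite E ltxx.
Qed.

Lemma metric_inj p (u v : tangent p) : (forall w, g p u w = g p v w) -> u = v.
Proof.
move=> H; apply/eqP; rewrite -subr_eq0; apply/eqP/metric_eq0.
by rewrite tensor2Dl tensor2Nl H subrr.
Qed.

Lemma frame_span (p q : M) (v : tangent q) : fchi (frame p) q != 0 ->
  v = \sum_(i < n) (coframe (fchi (frame p)) (fy (frame p)) v i / fchi (frame p) q ^+ 3)
         *: fE (frame p) i q.
Proof.
move=> c0; apply: (scalerI (expf_neq0 3 c0)).
rewrite frame_expand scaler_sumr; apply: eq_bigr => i _.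
by rewrite scalerA mulrC divfK // expf_neq0.
Qed.

Definition fcomb (p : M) (a : 'rV[R]_n) (q : M) : tangent q :=
  \sum_(i < n) a 0 i *: fE (frame p) i q.

Lemma coframe_sum chi y q (a : 'I_n -> R) (F : 'I_n -> tangent q) (j : 'I_n) :
  coframe chi y (\sum_(i < n) a i *: F i : tangent (M := M) q) j =
  \sum_(i < n) a i * coframe chi y (F i) j.
Proof.
rewrite /coframe !tangent_sumE !mulr_sumr -sumrB; apply: eq_bigr => i _.
by rewrite !tangent_scaleE; ring.
Qed.

Lemma fcomb_eq0 (p : M) a q : fchi (frame p) q != 0 -> fcomb p a q = 0 -> a = 0.
Proof.
move=> c0 a0; apply/rowP => j; rewrite mxE.
have : coframe (fchi (frame p)) (fy (frame p)) (fcomb p a q) j = fchi (frame p) q ^+ 3 * a 0 j.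
  rewrite coframe_sum (bigD1 j) //= frame_dual eqxx mulr1 mulrC big1 ?addr0 // => i ij.
  by rewrite frame_dual (negbTE ij) !mulr0.
rewrite a0 /coframe !tangent_zeroE !mulr0 subr0 => /esym/eqP.
by rewrite mulf_eq0 expf_eq0 (negbTE c0) andbF /= => /eqP.
Qed.

(** One non-zero vector forces [n] to be positive, and then the frame fields centred at [q] are
    non-zero at [q]. *)
Lemma nonzero_tangent (p : M) (u : tangent p) : u != 0 ->
  forall q : M, exists v : tangent q, v != 0.
Proof.
move=> u0 q; have [i _|no_i] := pickP (fun _ : 'I_n => true); last first.
  by case/eqP: u0; rewrite (vcoordE u) big1 // => i; have := no_i i.
exists (fcomb q (delta_mx 0 i) q); apply/eqP => /fcomb_eq0 H.
have /H/rowP/(_ i) : fchi (frame q) q != 0 by rewrite gt_eqF // fchi_gt0.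
by rewrite !mxE !eqxx => /eqP; rewrite oner_eq0.
Qed.

Lemma gram_unit (p q : M) : fchi (frame p) q != 0 ->
  \det (\matrix_(i < n, j < n) g q (fE (frame p) i q) (fE (frame p) j q)) != 0.
Proof.
move=> c0; apply/det0P => -[a /negP a0 aG]; apply/a0/eqP; apply: (fcomb_eq0 c0).
apply: metric_eq0; rewrite {2}/fcomb tensor2_sumr big1 // => j _.
rewrite tensor2Zr /fcomb tensor2_suml.
have /rowP/(_ j) := aG; rewrite !mxE => E.
rewrite (_ : \sum_(i < n) _ = 0) ?mulr0 // -[RHS]E; apply: eq_bigr => i _.
by rewrite tensor2Zl !mxE.
Qed.

Lemma riesz (omega : tensor2 M) p (u : tangent p) :
  exists w : tangent p, forall v, g p w v = omega p u v.
Proof.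
have c0 : fchi (frame p) p != 0 by rewrite gt_eqF // fchi_gt0.
have G0 := gram_unit c0; set G := \matrix_(i, j) _ in G0.
have uG : G \in unitmx by rewrite unitmxE unitfE.
pose b : 'rV[R]_n := \row_j omega p u (fE (frame p) j p).
pose c := b *m invmx G; exists (fcomb p c p) => v.
rewrite (frame_span v c0) !tensor2_sumr; apply: eq_bigr => j _.
rewrite !tensor2Zr; congr (_ * _).
have /rowP/(_ j) : c *m G = b by rewrite /c mulmxKV.
rewrite !mxE => <-; rewrite /fcomb tensor2_suml; apply: eq_bigr => i _.
by rewrite tensor2Zl !mxE.
Qed.

(** [A] is chosen pointwise by [riesz]; its smoothness comes from Cramer's rule for the Gram matrix
    of a frame. *)
Lemma endo_of_form (omega : tensor2 M) :
  exists A : endo M, forall p (u v : tangent p), g p (A p u) v = omega p u v.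
Proof.
have [A AE] : exists A : forall p : M, tangent p -> tangent p,
    forall p u v, g p (A p u) v = omega p u v.
  exists (fun p u => projT1 (cid (riesz omega u))) => p u v.
  exact: (projT2 (cid (riesz omega u)) v).
have A_linear p a (u v : tangent p) : A p (a *: u + v) = a *: A p u + A p v.
  apply: metric_inj => w; by rewrite AE !tensor2_linearl !AE.
have A_smooth (X : vfield M) : smooth_field (fun p => A p (X p)).
  move=> f; apply: smooth_div => p.
  pose E := fE (frame p); pose chi := fchi (frame p).
  pose G (q : M) := \matrix_(i < n, j < n) g q (E i q) (E j q).
  have sG i j : smooth (fun q => G q i j).
    have := tensor2_smooth g (E i) (E j); congr smooth.
    by apply/funext => q; rewrite mxE.
  (* The determinant clears the denominator of Cramer's rule. The frame spans only where chi is
     non-zero; the factor chi^3 makes the identity trivial elsewhere. *)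
  pose h := chi * chi * chi * mkSmooth (smooth_det sG).
  pose k : smoothFun M := chi * chi * chi * \sum_(i < n) \sum_(j < n)
    tensor2_fun omega X (E i) * mkSmooth (smooth_adj i j sG) * vder (E j) f.
  have c0 : chi p != 0 by rewrite gt_eqF // fchi_gt0.
  have hE q : h q = chi q * chi q * chi q * \det (G q) by [].
  have kE q : k q = chi q * chi q * chi q * \sum_(i < n) \sum_(j < n)
    omega q (X q) (E i q) * \adj (G q) i j * E j q f.
    rewrite (_ : k q = chi q * chi q * chi q * (\sum_(i < n) \sum_(j < n)
       tensor2_fun omega X (E i) * mkSmooth (smooth_adj i j sG) * vder (E j) f) q) //.
    by rewrite smooth_sumE; congr (_ * _); apply: eq_bigr => i _; rewrite smooth_sumE.
  exists h, k; split=> [|q].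
    by rewrite hE !mulf_neq0 //; exact: gram_unit.
  rewrite hE kE; have [->|cq0] := eqVneq (chi q) 0; first by rewrite !mul0r.
  rewrite -mulrA; congr (_ * _).
  pose cc i := coframe chi (fy (frame p)) (A q (X q)) i / chi q ^+ 3.
  have span : A q (X q) = \sum_(i < n) cc i *: E i q := frame_span (A q (X q)) cq0.
  pose c : 'rV[R]_n := \row_i cc i.
  have bE i : omega q (X q) (E i q) = (c *m G q) 0 i.
    rewrite -AE span tensor2_suml mxE; apply: eq_bigr => j _.
    by rewrite tensor2Zl !mxE.
  have EA j : \sum_(i < n) omega q (X q) (E i q) * \adj (G q) i j = \det (G q) * cc j.
    have /rowP/(_ j) : c *m G q *m \adj (G q) = \det (G q) *: c.
      by rewrite -mulmxA mul_mx_adj mul_mx_scalar.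
    by rewrite mxE => H; rewrite !mxE in H; rewrite -H; apply: eq_bigr => i _; rewrite bE.
  rewrite span tangent_sumE mulr_sumr exchange_big; apply: eq_bigr => j _ /=.
  by rewrite -mulr_suml EA mulrA.
by exists (Endo A_linear A_smooth).
Qed.

(** * Maxima of biquadratic functions over pairs of tangent vectors *)

Variable Q : forall p : M, tangent p -> tangent p -> tangent p -> tangent p -> R.
Hypothesis Q1 : forall p a (u v x y z : tangent p),
  Q (a *: u + v) x y z = a * Q u x y z + Q v x y z.
Hypothesis Q2 : forall p a (u v x y z : tangent p),
  Q x (a *: u + v) y z = a * Q x u y z + Q x v y z.
Hypothesis Q3 : forall p a (u v x y z : tangent p),
  Q x y (a *: u + v) z = a * Q x y u z + Q x y v z.
Hypothesis Q4 : forall p a (u v x y z : tangent p),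
  Q x y z (a *: u + v) = a * Q x y z u + Q x y z v.
Hypothesis Qc : forall X Y Z W : vfield M,
  continuous (fun p => Q (X p) (Y p) (Z p) (W p)).

Let linear0 (p : M) (L : tangent p -> R) (Ll : forall a u v, L (a *: u + v) = a * L u + L v) :
  L 0 = 0.
Proof. by apply: (addrI (L 0)); have := Ll 1 0 0; rewrite scale1r mul1r !addr0. Qed.

Let linear_sum (p : M) (L : tangent p -> R) (Ll : forall a u v, L (a *: u + v) = a * L u + L v)
    (a : 'rV[R]_n) (F : 'I_n -> tangent p) :
  L (\sum_(i < n) a 0 i *: F i) = \sum_(i < n) a 0 i * L (F i).
Proof.
elim: (index_enum _) => [|i s IH]; first by rewrite !big_nil (linear0 Ll).
by rewrite !big_cons Ll IH.
Qed.

Let linearZ0 (p : M) (L : tangent p -> R) (Ll : forall a u v, L (a *: u + v) = a * L u + L v) a u :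
  L (a *: u) = a * L u.
Proof. by have := Ll a u 0; rewrite (linear0 Ll) !addr0. Qed.

Let QZ (p : M) a b (x y : tangent p) :
  Q (a *: x) (a *: x) (b *: y) (b *: y) = a ^+ 2 * b ^+ 2 * Q x x y y.
Proof.
rewrite (linearZ0 (fun a u v => Q1 a u v _ _ _)) (linearZ0 (fun a u v => Q2 a u v _ _ _)).
rewrite (linearZ0 (fun a u v => Q3 a u v _ _ _)) (linearZ0 (fun a u v => Q4 a u v _ _ _)).
by ring.
Qed.

Let quad (p : M) (a b : 'rV[R]_n) q :
  Q (fcomb p a q) (fcomb p a q) (fcomb p b q) (fcomb p b q) =
  \sum_(i < n) \sum_(j < n) \sum_(k < n) \sum_(l < n) a 0 i * a 0 j * b 0 k * b 0 l *
    Q (fE (frame p) i q) (fE (frame p) j q) (fE (frame p) k q) (fE (frame p) l q).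
Proof.
rewrite {1}/fcomb (linear_sum (fun a u v => Q1 a u v _ _ _)); apply: eq_bigr => i _.
rewrite {1}/fcomb (linear_sum (fun a u v => Q2 a u v _ _ _)) mulr_sumr; apply: eq_bigr => j _.
rewrite {1}/fcomb (linear_sum (fun a u v => Q3 a u v _ _ _)) !mulr_sumr; apply: eq_bigr => k _.
rewrite {1}/fcomb (linear_sum (fun a u v => Q4 a u v _ _ _)) !mulr_sumr; apply: eq_bigr => l _.
by rewrite !mulrA.
Qed.

Let gquad (p : M) (a : 'rV[R]_n) q : g q (fcomb p a q) (fcomb p a q) =
  \sum_(i < n) \sum_(j < n) a 0 i * a 0 j * g q (fE (frame p) i q) (fE (frame p) j q).
Proof.
rewrite {1}/fcomb tensor2_suml; apply: eq_bigr => i _.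
rewrite tensor2Zl tensor2_sumr mulr_sumr; apply: eq_bigr => j _.
by rewrite tensor2Zr mulrA.
Qed.

Let dominates (p : M) (u v : tangent p) (A : set M) := forall q (x y : tangent q), A q ->
  Q x x y y <= Q u u v v * (g q x x * g q y y).

(** The pair [u], [v] may sit over a point outside [A]. The property therefore passes to subsets,
    and also to unions of two sets by comparing the two values. *)
Let has_max (A : set M) := exists p (u v : tangent p),
  [/\ g p u u = 1, g p v v = 1 & dominates u v A].

Let normalize (p : M) (u : tangent p) : u != 0 -> exists2 s : R, 0 < s & g p (s *: u) (s *: u) = 1.
Proof.
move=> u0; have gu := metric_pos g u0.
exists (Num.sqrt (g p u u))^-1; first by rewrite invr_gt0 sqrtr_gt0.
rewrite tensor2Zl tensor2Zr mulrA -invfM -expr2 sqr_sqrtr ?mulVf ?gt_eqF //.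
exact: ltW.
Qed.

Let cproj1 i (z : M * ('rV[R]_n * 'rV[R]_n)) :
  {for z, continuous (fun z : M * ('rV[R]_n * 'rV[R]_n) => z.2.1 0 i)}.
Proof.
have c1 : (fun z : M * ('rV[R]_n * 'rV[R]_n) => z.2.1) @ z --> z.2.1.
  by apply: (cvg_comp _ _ cvg_snd); exact: cvg_fst.
exact: (cvg_comp _ _ c1 (@coord_continuous R 1 n 0 i _)).
Qed.

Let cproj2 i (z : M * ('rV[R]_n * 'rV[R]_n)) :
  {for z, continuous (fun z : M * ('rV[R]_n * 'rV[R]_n) => z.2.2 0 i)}.
Proof.
have c1 : (fun z : M * ('rV[R]_n * 'rV[R]_n) => z.2.2) @ z --> z.2.2.
  by apply: (cvg_comp _ _ cvg_snd); exact: cvg_snd.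
exact: (cvg_comp _ _ c1 (@coord_continuous R 1 n 0 i _)).
Qed.

Let cmul (f h : M * ('rV[R]_n * 'rV[R]_n) -> R) z :
  {for z, continuous f} -> {for z, continuous h} -> {for z, continuous (fun z => f z * h z)}.
Proof. exact: continuousM. Qed.

Let cbase (f : M -> R) (z : M * ('rV[R]_n * 'rV[R]_n)) : continuous f ->
  {for z, continuous (fun z : M * ('rV[R]_n * 'rV[R]_n) => f z.1)}.
Proof. by move=> cf; apply: (cvg_comp _ _ cvg_fst); exact: cf. Qed.

(** Over [C] every non-zero vector is a multiple of a frame combination with coefficients in the
    unit sphere [S] of row vectors, and dividing by both squared lengths makes the value invariant
    under scaling. So the maximum is one over the compact product of [C] with two copies of [S]. *)
Let local_max (p : M) (u0 : tangent p) : u0 != 0 ->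
  exists C : set M, nbhs p C /\ has_max C.
Proof.
move=> u00; have [C [cC nC Cchi]] := frame_compact (frame p).
exists C; split=> //.
pose S := [set a : 'rV[R]_n | `|a| = 1].
have cS : compact S.
  apply: bounded_closed_compact.
    exists 1; split; first exact: num_real.
    by move=> b b1 a /= ->; exact: ltW.
  have cn : continuous (fun a : 'rV[R]_n => `|a|).
    by move=> a; apply: (@cvg_norm _ _ _ (nbhs a)); exact: cvg_id.
  exact: (closed_comp (fun a _ => cn a) (@closed_eq R 1)).
pose K := C `*` (S `*` S).
have cK : compact K by apply: compact_setX => //; exact: compact_setX.
have toS q (x : tangent q) : C q -> x != 0 -> exists2 s : R, s != 0 &
    exists2 a, S a & x = s *: fcomb p a q.
  move=> Cq x0; have cq : fchi (frame p) q != 0 by rewrite gt_eqF // Cchi.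
  pose cc i := coframe (fchi (frame p)) (fy (frame p)) x i / fchi (frame p) q ^+ 3.
  have xE : x = \sum_(i < n) cc i *: fE (frame p) i q := frame_span x cq.
  pose a : 'rV[R]_n := \row_i cc i.
  have xa : x = fcomb p a q by rewrite {1}xE; apply: eq_bigr => i _; rewrite mxE.
  have a0 : a != 0.
    apply: contraNneq x0 => a0; rewrite xa a0 /fcomb big1 // => i _.
    by rewrite mxE scale0r.
  have na0 : `|a| != 0 by rewrite normr_eq0.
  exists `|a| => //; exists (`|a|^-1 *: a).
    by rewrite /S /= normrZ normfV normr_id mulVf.
  rewrite {1}xa /fcomb scaler_sumr; apply: eq_bigr => i _.
  by rewrite [in RHS]mxE scalerA mulrA divff // mul1r.
pose N (z : M * ('rV[R]_n * 'rV[R]_n)) := Q (fcomb p z.2.1 z.1) (fcomb p z.2.1 z.1)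
    (fcomb p z.2.2 z.1) (fcomb p z.2.2 z.1).
pose G1 (z : M * ('rV[R]_n * 'rV[R]_n)) := g z.1 (fcomb p z.2.1 z.1) (fcomb p z.2.1 z.1).
pose G2 (z : M * ('rV[R]_n * 'rV[R]_n)) := g z.1 (fcomb p z.2.2 z.1) (fcomb p z.2.2 z.1).
have cN : continuous N.
  have -> : N = (fun z => \sum_(i < n) \sum_(j < n) \sum_(k < n) \sum_(l < n)
      z.2.1 0 i * z.2.1 0 j * z.2.2 0 k * z.2.2 0 l *
      Q (fE (frame p) i z.1) (fE (frame p) j z.1) (fE (frame p) k z.1) (fE (frame p) l z.1)).
    by apply/funext => z; rewrite /N quad.
  apply: continuous_big => [|i _]; first exact: add_continuous.
  apply: continuous_big => [|j _]; first exact: add_continuous.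
  apply: continuous_big => [|k _]; first exact: add_continuous.
  apply: continuous_big => [|l _]; first exact: add_continuous.
  move=> z; apply: (cmul (f := fun z => z.2.1 0 i * z.2.1 0 j * z.2.2 0 k * z.2.2 0 l)); last first.
    apply: (@cbase (fun q => Q (fE (frame p) i q) (fE (frame p) j q)
      (fE (frame p) k q) (fE (frame p) l q))).
    exact: (@Qc (fE (frame p) i) (fE (frame p) j) (fE (frame p) k)).
  do 2 (apply: cmul; last exact: cproj2).
  by apply: cmul; exact: cproj1.
have cg i j : continuous (fun q => g q (fE (frame p) i q) (fE (frame p) j q)).
  exact: smooth_continuous (tensor2_smooth g (fE (frame p) i) (fE (frame p) j)).
have cG1 : continuous G1.
  have -> : G1 = (fun z => \sum_(i < n) \sum_(j < n)
      z.2.1 0 i * z.2.1 0 j * g z.1 (fE (frame p) i z.1) (fE (frame p) j z.1)).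
    by apply/funext => z; rewrite /G1 gquad.
  apply: continuous_big => [|i _]; first exact: add_continuous.
  apply: continuous_big => [|j _]; first exact: add_continuous.
  move=> z; apply: (cmul (f := fun z => z.2.1 0 i * z.2.1 0 j)); last first.
    by apply: (@cbase (fun q => g q (fE (frame p) i q) (fE (frame p) j q))); exact: cg.
  by apply: cmul; exact: cproj1.
have cG2 : continuous G2.
  have -> : G2 = (fun z => \sum_(i < n) \sum_(j < n)
      z.2.2 0 i * z.2.2 0 j * g z.1 (fE (frame p) i z.1) (fE (frame p) j z.1)).
    by apply/funext => z; rewrite /G2 gquad.
  apply: continuous_big => [|i _]; first exact: add_continuous.
  apply: continuous_big => [|j _]; first exact: add_continuous.
  move=> z; apply: (cmul (f := fun z => z.2.2 0 i * z.2.2 0 j)); last first.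
    by apply: (@cbase (fun q => g q (fE (frame p) i q) (fE (frame p) j q))); exact: cg.
  by apply: cmul; exact: cproj2.
have comb_neq0 q a : C q -> S a -> fcomb p a q != 0.
  move=> Cq Sa; have cq : fchi (frame p) q != 0 by rewrite gt_eqF // Cchi.
  apply/negP => /eqP/(fcomb_eq0 cq) a0; move: Sa; rewrite /S /= a0 normr0 => /esym/eqP.
  by rewrite oner_eq0.
have Gpos z : K z -> 0 < G1 z /\ 0 < G2 z.
  move=> [Cz [S1 S2]]; split; apply: metric_pos; exact: comb_neq0.
have K0 : K !=set0.
  have Cp : C p by exact: nbhs_singleton.
  by have [_ _ [a Sa _]] := toS p u0 Cp u00; exists (p, (a, a)).
have cK' : {within K, continuous (fun z => N z / (G1 z * G2 z))}.
  apply: continuous_in_subspaceT => z /set_mem/Gpos[g1 g2].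
  apply: continuousM; first exact: cN.
  apply: continuousV; first by rewrite mulf_neq0 ?gt_eqF.
  by apply: continuousM; [exact: cG1|exact: cG2].
have [[q [a b]] /set_mem Kz zmax] := compact_EVT_max K0 cK cK'.
have [Cq [/= Sa Sb]] := Kz.
have [s1 s10 e1] := normalize (comb_neq0 _ _ Cq Sa).
have [s2 s20 e2] := normalize (comb_neq0 _ _ Cq Sb).
exists q, (s1 *: fcomb p a q), (s2 *: fcomb p b q); split=> // q' x y Cq'.
have [->|x0] := eqVneq x 0.
  by rewrite tensor20l mul0r mulr0 (linear0 (fun a u v => Q1 a u v _ _ _)).
have [->|y0] := eqVneq y 0.
  by rewrite tensor20l !mulr0 (linear0 (fun a u v => Q3 a u v _ _ _)).
have [t1 t10 [a' Sa' ->]] := toS q' x Cq' x0.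
have [t2 t20 [b' Sb' ->]] := toS q' y Cq' y0.
have K' : K (q', (a', b')) by [].
have := zmax (q', (a', b')) (mem_set K').
have [/= g1 g2] := Gpos _ K'; have [/= g3 g4] := Gpos _ Kz.
rewrite ler_pdivrMr ?mulr_gt0 // => H.
rewrite !QZ !(tensor2Zl, tensor2Zr).
move: e1 e2; rewrite !(tensor2Zl, tensor2Zr) -/(G1 (q, (a, b))) -/(G2 (q, (a, b))).
rewrite -/(G1 (q', (a', b'))) -/(G2 (q', (a', b'))) -/(N (q, (a, b))) -/(N (q', (a', b'))).
move=> e1 e2.
have -> : s1 ^+ 2 * s2 ^+ 2 * N (q, (a, b)) = N (q, (a, b)) / (G1 (q, (a, b)) * G2 (q, (a, b))).
  have E1 : s1 ^+ 2 = (G1 (q, (a, b)))^-1.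
    by apply: (mulIf (lt0r_neq0 g3)); rewrite mulVf ?gt_eqF // -[RHS]e1; ring.
  have E2 : s2 ^+ 2 = (G2 (q, (a, b)))^-1.
    by apply: (mulIf (lt0r_neq0 g4)); rewrite mulVf ?gt_eqF // -[RHS]e2; ring.
  by rewrite E1 E2 invfM mulrC.
set m := _ / _ in H *.
have -> : m * (t1 * (t1 * G1 (q', (a', b'))) * (t2 * (t2 * G2 (q', (a', b'))))) =
   t1 ^+ 2 * t2 ^+ 2 * (m * (G1 (q', (a', b')) * G2 (q', (a', b')))) by ring.
by rewrite ler_wpM2l // mulr_ge0 // sqr_ge0.
Qed.

(* The sets on whose complement the maximum is attained form a filter, which would
   have a cluster point if it were proper. *)
Lemma biquadratic_max : compact [set: M] -> (exists (p : M) (u : tangent p), u != 0) ->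
  exists (p : M) (u v : tangent p), [/\ g p u u = 1, g p v v = 1 &
    forall q (x y : tangent q), Q x x y y <= Q u u v v * (g q x x * g q y y)].
Proof.
move=> cM [p0 [w w0]].
have [s _ gs] := normalize w0.
have H0 : has_max set0 by exists p0, (s *: w), (s *: w); split.
have HS A B : A `<=` B -> has_max B -> has_max A.
  move=> AB [p [u [v [e1 e2 D]]]]; exists p, u, v; split=> // q x y /AB; exact: D.
have HU A B : has_max A -> has_max B -> has_max (A `|` B).
  move=> [p [u [v [e1 e2 D]]]] [p' [u' [v' [e1' e2' D']]]].
  have gg q (x y : tangent q) : 0 <= g q x x * g q y y by rewrite mulr_ge0 ?metric_ge0.
  have [le|/ltW le] := leP (Q u u v v) (Q u' u' v' v').
    exists p', u', v'; split=> // q x y [/(D q x y)|/D'//].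
    by move/le_trans; apply; rewrite ler_wpM2r.
  exists p, u, v; split=> // q x y [/D//|/(D' q x y)].
  by move/le_trans; apply; rewrite ler_wpM2r.
suff [p [u [v [e1 e2 D]]]] : has_max setT by exists p, u, v; split=> // q x y; exact: D.
apply: contrapT => nH.
pose F := [set A : set M | has_max (~` A)].
have FF : ProperFilter F.
  split; first by rewrite /F /= setC0.
  split; first by rewrite /F /= setCT.
  - by move=> A B FA FB; rewrite /F /= setCI; exact: HU.
  - by move=> A B AB; apply: HS; exact: subsetC.
have [p [_ clp]] := cM F FF filterT.
have [u u0] := nonzero_tangent w0 p.
have [C [nC mC]] := local_max u0.
have FC : F (~` C) by rewrite /F /= setCK.
by have [q []] := clp _ _ FC nC.
Qed.

End Metric.

(** * Connections and curvature *)

Section NablaAlgebra.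
Variables (R : realType) (n : nat) (M : smoothManifold R n) (D : connection M).
Implicit Types (X Y Z W : vfield M) (p : M).

Definition vneg X : vfield M := vscale (scst M (-1)) X.

Lemma vnegE X p : vneg X p = - X p.
Proof. by rewrite /= scaleN1r. Qed.

Lemma vaddE X Y p : vadd X Y p = X p + Y p. Proof. by []. Qed.

Lemma vscaleE f X p : vscale f X p = f p *: X p. Proof. by []. Qed.

Lemma nabla_addl X Y Z : D (vadd X Y) Z = vadd (D X Z) (D Y Z).
Proof.
rewrite (_ : vadd X Y = vadd (vscale (scst M 1) X) Y); last first.
  by apply: vfield_eqP => p /=; rewrite scale1r.
by rewrite nabla_linearl; apply: vfield_eqP => p /=; rewrite scale1r.
Qed.

Lemma nabla_vzero Z : D (vzero M) Z = vzero M.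
Proof.
have E : vadd (vzero M) (vzero M) = vzero M by apply: vfield_eqP => p /=; rewrite addr0.
apply: vfield_eqP => p /=; apply: (addrI (D (vzero M) Z p)).
by rewrite -vaddE -nabla_addl E addr0.
Qed.

Lemma nabla_scalel f X Z : D (vscale f X) Z = vscale f (D X Z).
Proof.
have := nabla_linearl D f X (vzero M) Z.
rewrite nabla_vzero (_ : vadd (vscale f X) (vzero M) = vscale f X); last first.
  by apply: vfield_eqP => p /=; rewrite addr0.
by move=> ->; apply: vfield_eqP => p /=; rewrite addr0.
Qed.

Lemma nabla_negl X Z : D (vneg X) Z = vneg (D X Z).
Proof. exact: nabla_scalel. Qed.

Lemma nabla_cst X a Z p : D X (vscale (scst M a) Z) p = a *: D X Z p.
Proof. by rewrite nabla_leibniz [LHS]/= tangent_cst scale0r add0r. Qed.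

Lemma nabla_negr X Z : D X (vneg Z) = vneg (D X Z).
Proof. by apply: vfield_eqP => p; rewrite nabla_cst. Qed.

Lemma nabla_tensorial X X' Z p : X p = X' p -> D X Z p = D X' Z p.
Proof.
move=> XX'; apply: (@tensorial _ _ _ _ p (fun X => D X Z p) _ _ X X' XX') => [X1 Y|f X1].
  by rewrite nabla_addl.
by rewrite nabla_scalel.
Qed.

Lemma nabla_sumr (I : Type) (s : seq I) (F : I -> vfield M) X p :
  D X (\big[@vadd R n M/vzero M]_(i <- s) F i) p = \sum_(i <- s) D X (F i) p.
Proof.
elim: s => [|i s IH]; last by rewrite !big_cons nabla_addr -IH.
rewrite !big_nil; have E : vadd (vzero M) (vzero M) = vzero M.
  by apply: vfield_eqP => q /=; rewrite addr0.
apply: (addrI (D X (vzero M) p)).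
by rewrite -vaddE -nabla_addr E addr0.
Qed.

(* Geodesic-type extension: subtract from a constant-coefficient extension of [u] a
   combination of frame fields whose coefficients vanish at [p]. *)
Lemma normal_extension p (u : tangent p) :
  exists U : vfield M, U p = u /\ forall X, D X U p = 0.
Proof.
pose F := frame p; pose chi := fchi F p.
have chi0 : chi != 0 by rewrite gt_eqF // fchi_gt0.
pose U0 := vext u; pose Gam i j := vcoord (D (fE F i) U0 p) j.
pose xi j : smoothFun M := \sum_(i < n) (Gam i j / chi ^+ 2) *: fy F i.
have xi0 j : xi j p = 0.
  rewrite /xi smooth_sumE big1 // => i _.
  rewrite [LHS](_ : _ = Gam i j / chi ^+ 2 * fy F i p) //.
  by rewrite fy_eq0 mulr0.
have Xxi X j : X p (xi j) = \sum_(i < n) Gam i j * vcoord (X p) i.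
  rewrite /xi tangent_sum; apply: eq_bigr => i _; rewrite tangentZ -mulrA; congr (_ * _).
  by rewrite /vcoord /coframe fy_eq0 mul0r subr0 -/F -/chi; field.
exists (vadd U0 (\big[@vadd R n M/vzero M]_(j < n) vscale (- xi j) (fE F j))); split.
  rewrite vaddE vextE vsumE big1 ?addr0 // => j _.
  by rewrite vscaleE (_ : (- xi j) p = - xi j p) // xi0 oppr0 scale0r.
move=> X; rewrite nabla_addr vaddE (nabla_sumr _ (fun j => vscale (- xi j) (fE F j))).
have -> : D X U0 p = \sum_(i < n) vcoord (X p) i *: D (fE F i) U0 p.
  rewrite (nabla_tensorial (X' := vext (X p))) ?vextE //.
  rewrite (tensorial_sum (T := fun X => D X U0 p)) => [|Y Z]; last by rewrite nabla_addl.
  by apply: eq_bigr => i _; rewrite nabla_scalel.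
have -> : \sum_(j < n) D X (vscale (- xi j) (fE F j)) p =
    - \sum_(j < n) \sum_(i < n) (Gam i j * vcoord (X p) i) *: fE F j p.
  rewrite -sumrN; apply: eq_bigr => j _; rewrite nabla_leibniz vaddE !vscaleE.
  rewrite (_ : (- xi j) p = - xi j p) // xi0 oppr0 scale0r addr0.
  rewrite [vder _ _ p](_ : _ = X p (- xi j)) // tangentN Xxi scaleNr; congr (- _).
  by rewrite scaler_suml.
apply/eqP; rewrite subr_eq0 exchange_big; apply/eqP; apply: eq_bigr => i _ /=.
rewrite {1}(vcoordE (D (fE F i) U0 p)) scaler_sumr; apply: eq_bigr => j _.
by rewrite scalerA mulrC.
Qed.

Definition normal_ext p (u : tangent p) : vfield M := projT1 (cid (normal_extension u)).

Lemma normal_extE p (u : tangent p) : normal_ext u p = u.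
Proof. exact: (projT2 (cid (normal_extension u))).1. Qed.

Lemma nabla_normal_ext p (u : tangent p) X : D X (normal_ext u) p = 0.
Proof. exact: (projT2 (cid (normal_extension u))).2. Qed.

Lemma endo_add (A : endo M) X Y : endo_app A (vadd X Y) = vadd (endo_app A X) (endo_app A Y).
Proof.
apply: vfield_eqP => p /=; rewrite -[X p]scale1r endo_linear.
by rewrite !scale1r.
Qed.

Lemma endo0 (A : endo M) p : A p 0 = 0.
Proof.
have := endo_linear A 1 (0 : tangent p) 0; rewrite scale1r addr0 scale1r => E.
by apply: (addrI (A p 0)); rewrite addr0 -E.
Qed.

Lemma endoZ (A : endo M) p a (u : tangent p) : A p (a *: u) = a *: A p u.
Proof. by rewrite -[a *: u]addr0 endo_linear endo0 addr0. Qed.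

Lemma endoN (A : endo M) p (u : tangent p) : A p (- u) = - A p u.
Proof. by rewrite -scaleN1r endoZ scaleN1r. Qed.

Lemma endoD (A : endo M) p (u v : tangent p) : A p (u + v) = A p u + A p v.
Proof. by rewrite -[u]scale1r endo_linear !scale1r. Qed.

Lemma endo_scale (A : endo M) f X : endo_app A (vscale f X) = vscale f (endo_app A X).
Proof. by apply: vfield_eqP => p /=; rewrite endoZ. Qed.

Lemma endo_neg (A : endo M) X : endo_app A (vneg X) = vneg (endo_app A X).
Proof. exact: endo_scale. Qed.

Lemma endo_appE (A : endo M) X p : endo_app A X p = A p (X p). Proof. by []. Qed.

End NablaAlgebra.

Section LeviCivita.
Variables (R : realType) (n : nat) (M : smoothManifold R n) (g : metric M) (D : connection M).
Hypothesis D_LC : levi_civita g D.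
Implicit Types (X Y Z W : vfield M) (p : M).

Lemma bracketE X Y : bracket X Y = vadd (D X Y) (vneg (D Y X)).
Proof.
apply: vfield_eqP => p; rewrite vaddE vnegE.
by have [tf _] := D_LC; rewrite tf.
Qed.

Lemma metric_derive X Y Z p :
  X p (tensor2_fun g Y Z) = g p (D X Y p) (Z p) + g p (Y p) (D X Z p).
Proof.
have [_ /(_ X Y Z p)] := D_LC; rewrite /nabla_tensor2 => /eqP.
by rewrite -addrA -opprD subr_eq0 => /eqP.
Qed.

(** The bracket is written as D_X Y - D_Y X from the start: torsion-freeness is then built in, and
    the commutation formulas below become formal consequences of additivity. *)
Definition curv X Y Z : vfield M :=
  vadd (vadd (D X (D Y Z)) (vneg (D Y (D X Z))))
       (vneg (vadd (D (D X Y) Z) (vneg (D (D Y X) Z)))).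

Lemma curvatureE X Y Z p : curvature D X Y Z p = curv X Y Z p.
Proof.
rewrite /curvature bracketE nabla_addl nabla_negl /curv !vaddE !vnegE !vaddE !vnegE.
by [].
Qed.

Definition R4 p X Y Z W : R := g p (curv X Y Z p) (W p).

Definition vlin := (@vaddE R n M, @vnegE R n M, @tensor2Dl R n M, @tensor2Dr R n M,
  @tensor2Nl R n M, @tensor2Nr R n M).

Lemma gsym p (u v : tangent p) : g p u v = g p v u.
Proof. exact: Defs.metric_sym. Qed.

Lemma R4_skew12 p X Y Z W : R4 p X Y Z W = - R4 p Y X Z W.
Proof. by rewrite /R4 /curv !vlin; ring. Qed.

Lemma curv_flat X Y (f : smoothFun M) p :
  X p (vder Y f) - Y p (vder X f) - (D X Y p) f + (D Y X p) f = 0.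
Proof.
have /(congr1 (fun V : vfield M => V p f)) := bracketE X Y.
rewrite vaddE vnegE tangent_addE tangent_oppE => E.
have : bracket X Y p f = X p (vder Y f) - Y p (vder X f) by [].
by rewrite E => <-; ring.
Qed.

Lemma vder_metric X Y Z :
  vder X (tensor2_fun g Y Z) = tensor2_fun g (D X Y) Z + tensor2_fun g Y (D X Z).
Proof. by apply: smooth_eqP => q; exact: metric_derive. Qed.

(** On the function g(Z, W), second derivatives commute up to the bracket term; metric compatibility
    turns this commutator into R(X, Y, Z, W) + R(X, Y, W, Z). *)
Lemma R4_skew34 p X Y Z W : R4 p X Y Z W = - R4 p X Y W Z.
Proof.
have := curv_flat X Y (tensor2_fun g Z W) p.
rewrite !vder_metric !tangentD !metric_derive.
rewrite /R4 (gsym (curv X Y W p)) /curv !vlin => E.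
by rewrite -[RHS]addr0 -E; ring.
Qed.

Lemma jacobi X Y Z p : bracket X (bracket Y Z) p + bracket Y (bracket Z X) p +
  bracket Z (bracket X Y) p = 0.
Proof.
apply: tangent_eqP => f; rewrite !tangent_addE.
have E U V W : bracket U (bracket V W) p f =
    U p (vder V (vder W f)) - U p (vder W (vder V f)) -
    (V p (vder W (vder U f)) - W p (vder V (vder U f))).
  have -> : bracket U (bracket V W) p f =
      U p (vder (bracket V W) f) - bracket V W p (vder U f) by [].
  rewrite (_ : vder (bracket V W) f = vder V (vder W f) - vder W (vder V f)).
    by rewrite tangentB.
  exact: smooth_eqP.
by rewrite !E tangent_zeroE; ring.
Qed.

Lemma R4_bianchi p X Y Z W : R4 p X Y Z W + R4 p Y Z X W + R4 p Z X Y W = 0.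
Proof.
have /(congr1 (fun v => g p v (W p))) := jacobi X Y Z p.
rewrite tensor20l !bracketE !(nabla_addl, nabla_addr, nabla_negl, nabla_negr) !vlin => E.
by rewrite -[RHS]E /R4 /curv !vlin; ring.
Qed.

(** There is one Bianchi identity for each choice of the last argument; after cancellation by the
    two skew-symmetries the four together leave only this. *)
Lemma R4_pair p X Y Z W : R4 p X Y Z W = R4 p Z W X Y.
Proof.
have b1 := R4_bianchi p X Y Z W; have b2 := R4_bianchi p Y Z W X.
have b3 := R4_bianchi p Z W X Y; have b4 := R4_bianchi p W X Y Z.
have := (R4_skew34 p Y Z X W, R4_skew34 p X Y Z W, R4_skew34 p W X Y Z,
  R4_skew34 p Z W X Y, R4_skew12 p W Y Z X, R4_skew34 p Y W Z X, R4_skew12 p X Z W Y,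
  R4_skew34 p Z X W Y).
move=> [[[[[[[s1 s2] s3] s4] s5] s6] s7] s8]; lra.
Qed.

End LeviCivita.

(** * Covariant derivatives of a field of endomorphisms *)

Section EndoDerivative.
Variables (R : realType) (n : nat) (M : smoothManifold R n) (D : connection M) (A : endo M).
Implicit Types (X Y Z W V : vfield M) (p : M).

(* [nabA X Y] is (nabla_X A) Y and [nab2A W X Y] is (nabla_W (nabla A))(X, Y). *)
Definition nabA X Y : vfield M :=
  vadd (D X (endo_app A Y)) (vneg (endo_app A (D X Y))).

Definition nab2A W X Y : vfield M :=
  vadd (D W (nabA X Y)) (vneg (vadd (nabA (D W X) Y) (nabA X (D W Y)))).

Lemma nabA_addl X X' Y : nabA (vadd X X') Y = vadd (nabA X Y) (nabA X' Y).
Proof.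
apply: vfield_eqP => p; rewrite /nabA !nabla_addl endo_add !(vaddE, vnegE).
by rewrite opprD addrACA.
Qed.

Lemma nabA_addr X Y Y' : nabA X (vadd Y Y') = vadd (nabA X Y) (nabA X Y').
Proof.
apply: vfield_eqP => p; rewrite /nabA endo_add !nabla_addr endo_add !(vaddE, vnegE).
by rewrite opprD addrACA.
Qed.

Lemma nabA_scalel f X Y : nabA (vscale f X) Y = vscale f (nabA X Y).
Proof.
apply: vfield_eqP => p; rewrite /nabA !nabla_scalel endo_scale !(vaddE, vnegE, vscaleE).
by rewrite -scalerBr.
Qed.

Lemma nabA_scaler f X Y : nabA X (vscale f Y) = vscale f (nabA X Y).
Proof.
apply: vfield_eqP => p; rewrite /nabA endo_scale !nabla_leibniz endo_add !endo_scale.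
rewrite !(vaddE, vnegE, vscaleE) opprD addrACA subrr add0r.
by rewrite -scalerBr.
Qed.

Lemma nabA_negl X Y : nabA (vneg X) Y = vneg (nabA X Y).
Proof. exact: nabA_scalel. Qed.

Lemma nabA_negr X Y : nabA X (vneg Y) = vneg (nabA X Y).
Proof. exact: nabA_scaler. Qed.

Lemma nabA_tensorial X X' Y Y' p : X p = X' p -> Y p = Y' p -> nabA X Y p = nabA X' Y' p.
Proof.
move=> XX YY; transitivity (nabA X' Y p).
  apply: (@tensorial _ _ _ _ p (fun X => nabA X Y p) _ _ X X' XX) => [X1 X2|f X1].
    by rewrite nabA_addl.
  by rewrite nabA_scalel.
apply: (@tensorial _ _ _ _ p (fun Y => nabA X' Y p) _ _ Y Y' YY) => [X1 X2|f X1].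
  by rewrite nabA_addr.
by rewrite nabA_scaler.
Qed.

(* locked: otherwise rewriting with the linearity rules sees through to [vadd] *)
Definition nabAp p (u v : tangent p) : tangent p := locked (nabA (vext u) (vext v) p).

Lemma nabApE X Y p : nabA X Y p = nabAp (X p) (Y p).
Proof. by rewrite /nabAp -lock; apply: nabA_tensorial; rewrite vextE. Qed.

Lemma nabAp_linearl p a (u v w : tangent p) :
  nabAp (a *: u + v) w = a *: nabAp u w + nabAp v w.
Proof.
rewrite -[in RHS](vextE u) -[in RHS](vextE v) -[in RHS](vextE w) -!nabApE.
rewrite -(vscaleE (scst M a)) -nabA_scalel -vaddE -nabA_addl.
by rewrite nabApE !(vaddE, vscaleE) !vextE.
Qed.

Lemma nabAp_linearr p a (u v w : tangent p) :
  nabAp w (a *: u + v) = a *: nabAp w u + nabAp w v.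
Proof.
rewrite -[in RHS](vextE u) -[in RHS](vextE v) -[in RHS](vextE w) -!nabApE.
rewrite -(vscaleE (scst M a)) -nabA_scaler -vaddE -nabA_addr.
by rewrite nabApE !(vaddE, vscaleE) !vextE.
Qed.

Lemma nabAp0l p (w : tangent p) : nabAp 0 w = 0.
Proof.
have := nabAp_linearl 1 0 0 w; rewrite scale1r addr0 scale1r => E.
by apply: (addrI (nabAp 0 w)); rewrite addr0 -E.
Qed.

Lemma nabAp0r p (w : tangent p) : nabAp w 0 = 0.
Proof.
have := nabAp_linearr 1 0 0 w; rewrite scale1r addr0 scale1r => E.
by apply: (addrI (nabAp w 0)); rewrite addr0 -E.
Qed.

Lemma nabApZl p a (u w : tangent p) : nabAp (a *: u) w = a *: nabAp u w.
Proof. by rewrite -[a *: u]addr0 nabAp_linearl nabAp0l addr0. Qed.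

Lemma nabApZr p a (u w : tangent p) : nabAp w (a *: u) = a *: nabAp w u.
Proof. by rewrite -[a *: u]addr0 nabAp_linearr nabAp0r addr0. Qed.

Lemma nabApNl p (u w : tangent p) : nabAp (- u) w = - nabAp u w.
Proof. by rewrite -scaleN1r nabApZl scaleN1r. Qed.

Lemma nabApNr p (u w : tangent p) : nabAp w (- u) = - nabAp w u.
Proof. by rewrite -scaleN1r nabApZr scaleN1r. Qed.

Lemma nabApDl p (u v w : tangent p) : nabAp (u + v) w = nabAp u w + nabAp v w.
Proof. by rewrite -[u]scale1r nabAp_linearl !scale1r. Qed.

Lemma nabApDr p (u v w : tangent p) : nabAp w (u + v) = nabAp w u + nabAp w v.
Proof. by rewrite -[u]scale1r nabAp_linearr !scale1r. Qed.

Lemma nabAE X Y p : nabA X Y p = D X (endo_app A Y) p - A p (D X Y p).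
Proof. by rewrite [LHS]vaddE; congr (_ + _); exact: vnegE. Qed.

Lemma nab2AE W X Y p :
  nab2A W X Y p = D W (nabA X Y) p - (nabA (D W X) Y p + nabA X (D W Y) p).
Proof. by rewrite [LHS]vaddE; congr (_ + _); exact: vnegE. Qed.

Lemma nab2A_neg3 W X Y : nab2A W X (vneg Y) = vneg (nab2A W X Y).
Proof.
apply: vfield_eqP => p; rewrite /nab2A nabla_negr !nabA_negr nabla_negr.
by rewrite !(vaddE, vnegE) opprD !opprK opprD opprK.
Qed.

End EndoDerivative.

Section KillingEndo.
Variables (R : realType) (n : nat) (M : smoothManifold R n) (g : metric M) (D : connection M).
Hypothesis D_LC : levi_civita g D.
Variable A : endo M.
Implicit Types (X Y Z W V : vfield M) (p : M).
Local Notation B := (nabA D A).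
Local Notation C := (nab2A D A).
Local Notation cv := (curv D).

Hypothesis A_skew : forall p (u v : tangent p), g p (A p u) v = - g p u (A p v).
Hypothesis K1 : forall X Y Z p, g p (B X Y p) (Z p) = - g p (B Y X p) (Z p).
Hypothesis K2 : forall X Y Z p, g p (B X Y p) (Z p) = - g p (B X Z p) (Y p).

Lemma nabA_anti X Y : B X Y = vneg (B Y X).
Proof.
apply: vfield_eqP => p; apply: (metric_inj (g := g)) => w.
by rewrite -(vextE w) K1 vnegE tensor2Nl.
Qed.

Lemma nabA_self X p : B X X p = 0.
Proof.
apply: (metric_inj (g := g)) => w; rewrite tensor20l -(vextE w).
by have := K1 X X (vext w) p; lra.
Qed.

Lemma nabAp_anti p (u v : tangent p) : nabAp D A u v = - nabAp D A v u.
Proof. by rewrite -[in LHS](vextE u) -[in LHS](vextE v) -nabApE nabA_anti vnegE nabApE !vextE. Qed.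

Lemma nabAp_skew p (u v w : tangent p) : g p (nabAp D A u v) w = - g p v (nabAp D A u w).
Proof.
have := K2 (vext u) (vext v) (vext w) p; rewrite !nabApE !vextE => ->.
by rewrite Defs.metric_sym.
Qed.

Lemma nab2A_anti W X Y p : C W X Y p = - C W Y X p.
Proof.
rewrite /nab2A (nabA_anti X Y) nabla_negr (nabA_anti (D W X)) (nabA_anti X).
by rewrite !(vaddE, vnegE) !opprD !opprK; congr (_ + _); rewrite addrC.
Qed.

Lemma nab2A_skew W X Y Z p : g p (C W X Y p) (Z p) = - g p (C W X Z p) (Y p).
Proof.
have E : tensor2_fun g (B X Y) Z = - tensor2_fun g (B X Z) Y.
  by apply: smooth_eqP => q; exact: K2.
have /(congr1 (W p)) := E; rewrite tangentN !(metric_derive D_LC).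
have := (K2 (D W X) Y Z p, K2 X (D W Y) Z p, K2 X (D W Z) Y p).
rewrite /nab2A !vlin => -[[e1 e2] e3] e4.
by rewrite e1 e2 e3; lra.
Qed.

Lemma nab2A_ricci W X Y p :
  C W X Y p - C X W Y p = cv W X (endo_app A Y) p - A p (cv W X Y p).
Proof.
apply: (metric_inj (g := g)) => w.
rewrite -endo_appE /curv !(endo_add, endo_neg) /nab2A /nabA.
rewrite !(nabla_addl, nabla_addr, nabla_negl, nabla_negr, endo_add, endo_neg) !vlin.
ring.
Qed.

End KillingEndo.

(** * The square of a Killing endomorphism *)

(** The first-order condition at an extremal vector: [t] is the size of a perturbation and [b] its
    linear effect. *)
Lemma linear_coef_eq0 (R : realFieldType) (b c : R) :
  (forall t : R, 0 <= t * b + t ^+ 2 * c) -> b = 0.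
Proof.
move=> H; have c0 : 0 <= c by have := H 1; have := H (-1); rewrite sqrrN expr1n; lra.
have c1 : 0 < c + 1 by lra.
(* The denominator [c + 1] is positive even for [c = 0], and the value at this point is -(b / (c +
   1))^2. *)
have := H (- b / (c + 1)).
have -> : - b / (c + 1) * b + (- b / (c + 1)) ^+ 2 * c = - (b / (c + 1)) ^+ 2.
  by field; rewrite gt_eqF.
rewrite oppr_ge0 => h; have /eqP : (b / (c + 1)) ^+ 2 = 0.
  by apply/le_anti/andP; split=> //; exact: sqr_ge0.
rewrite sqrf_eq0 mulf_eq0 invr_eq0 (gt_eqF c1) orbF => /eqP //.
Qed.

Section KillingSquare.
Variables (R : realType) (n : nat) (M : smoothManifold R n) (g : metric M) (D : connection M).
Hypothesis D_LC : levi_civita g D.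
Variable A : endo M.
Implicit Types (X Y Z W V U E : vfield M) (p : M).
Local Notation B := (nabA D A).
Local Notation C := (nab2A D A).
Local Notation cv := (curv D).
Local Notation gs := (Defs.metric_sym g).

Hypothesis K1 : forall X Y Z p, g p (B X Y p) (Z p) = - g p (B Y X p) (Z p).
Hypothesis M_compact : compact [set: M].
Hypothesis g_negative : negative_sectional_curvature g D.

Lemma metric_derive2 X V p :
  X p (vder X (tensor2_fun g V V)) =
  2 * (g p (D X (D X V) p) (V p) + g p (D X V p) (D X V p)).
Proof.
rewrite (vder_metric D_LC) tangentD !(metric_derive D_LC).
by rewrite (gs (V p)); ring.
Qed.

Lemma sectional_neg U V p : U p != 0 -> V p != 0 ->
  g p (U p) (V p) = 0 -> R4 g D p U V V U < 0.
Proof.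
move=> /(metric_pos g) uu /(metric_pos g) vv uv; have ind : lin_indep2 (U p) (V p).
  move=> a b ab; have := congr1 (fun w => g p w (U p)) ab.
  have := congr1 (fun w => g p w (V p)) ab.
  rewrite !(tensor20l, tensor2Dl, tensor2Zl) uv (gs (V p)) uv !mulr0 addr0 add0r.
  move=> /eqP; rewrite mulf_eq0 (gt_eqF vv) orbF => /eqP b0.
  by move=> /eqP; rewrite mulf_eq0 (gt_eqF uu) orbF => /eqP a0.
have := g_negative ind; rewrite /sectional_curvature uv expr0n /= subr0 (curvatureE D_LC).
by rewrite pmulr_llt0 // invr_gt0 mulr_gt0.
Qed.

Let Q p (x x' y y' : tangent p) : R :=
  g p (A p x) (A p x') * g p y y' - g p (A p y) (A p y') * g p x x'.

Lemma killing_square_proportional : (exists (p : M) (u : tangent p), u != 0) ->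
  forall p (x y : tangent p), g p (A p x) (A p x) * g p y y = g p (A p y) (A p y) * g p x x.
Proof.
move=> ne.
have Q1 p a (u v x y z : tangent p) : Q (a *: u + v) x y z = a * Q u x y z + Q v x y z.
  by rewrite /Q endo_linear !tensor2_linearl; ring.
have Q2 p a (u v x y z : tangent p) : Q x (a *: u + v) y z = a * Q x u y z + Q x v y z.
  by rewrite /Q endo_linear !tensor2_linearr; ring.
have Q3 p a (u v x y z : tangent p) : Q x y (a *: u + v) z = a * Q x y u z + Q x y v z.
  by rewrite /Q endo_linear !tensor2_linearl; ring.
have Q4 p a (u v x y z : tangent p) : Q x y z (a *: u + v) = a * Q x y z u + Q x y z v.
  by rewrite /Q endo_linear !tensor2_linearr; ring.
have Qc X Y Z W : continuous (fun p => Q (X p) (Y p) (Z p) (W p)).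
  have := smooth_continuous (smoothFunP (tensor2_fun g (endo_app A X) (endo_app A Y) *
    tensor2_fun g Z W - tensor2_fun g (endo_app A Z) (endo_app A W) * tensor2_fun g X Y)).
  by [].
have [p [u [e [uu ee umax]]]] := biquadratic_max g Q1 Q2 Q3 Q4 Qc M_compact ne.
set lam := g p (A p u) (A p u); set mu := g p (A p e) (A p e).
have Que : Q u u e e = lam - mu by rewrite /Q uu ee !mulr1.
rewrite Que in umax.
(* If the maximum is at most 0, one inequality holds for all pairs; exchanging [x] and [y] gives the
   other. *)
suff le : lam <= mu.
  have H q (x y : tangent q) :
      g q (A q x) (A q x) * g q y y <= g q (A q y) (A q y) * g q x x.
    rewrite -subr_le0; apply: le_trans (umax q x y) _.
    by rewrite mulr_le0_ge0 ?subr_le0 // mulr_ge0 // metric_ge0.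
  by move=> q x y; apply/le_anti; rewrite !H.
rewrite leNgt; apply/negP => lt.
(* First variation at [u] of |Ax|^2 <= lam |x|^2, which is maximality with [e] fixed as second
   vector; [eigE] is obtained in the same way with [u] fixed. *)
have eigU w : g p (A p u) (A p w) = lam * g p u w.
  have H x : g p (A p x) (A p x) <= lam * g p x x.
    have := umax p x e; rewrite /Q ee -/mu !mulr1; lra.
  have : forall t, 0 <= t * (2 * (lam * g p u w - g p (A p u) (A p w))) +
      t ^+ 2 * (lam * g p w w - g p (A p w) (A p w)).
    move=> t; have := H (u + t *: w).
    rewrite endoD endoZ !(tensor2Dl, tensor2Dr, tensor2Zl, tensor2Zr) uu -/lam.
    rewrite (gs (A p w) (A p u)) (gs w u); lra.
  by move=> /linear_coef_eq0; lra.
have eigE w : g p (A p e) (A p w) = mu * g p e w.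
  have H x : mu * g p x x <= g p (A p x) (A p x).
    have := umax p u x; rewrite /Q uu -/lam !mulr1 !mul1r; lra.
  have : forall t, 0 <= t * (2 * (g p (A p e) (A p w) - mu * g p e w)) +
      t ^+ 2 * (g p (A p w) (A p w) - mu * g p w w).
    move=> t; have := H (e + t *: w).
    rewrite endoD endoZ !(tensor2Dl, tensor2Dr, tensor2Zl, tensor2Zr) ee -/mu.
    rewrite (gs (A p w) (A p e)) (gs w e); lra.
  by move=> /linear_coef_eq0; lra.
have ue : g p u e = 0.
  have := eigU e; have := eigE u; rewrite (gs (A p e)) (gs e) => -> E.
  have : (lam - mu) * g p u e = 0 by lra.
  by move=> /eqP; rewrite mulf_eq0 subr_eq0 gt_eqF //= => /eqP.
pose U := normal_ext D u; pose E := normal_ext D e.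
have Up : U p = u by exact: normal_extE.
have Ep : E p = e by exact: normal_extE.
have DU X : D X U p = 0 by exact: nabla_normal_ext.
have DE X : D X E p = 0 by exact: nabla_normal_ext.
pose AU := endo_app A U; pose AE := endo_app A E.
pose fa := tensor2_fun g AU AU; pose fb := tensor2_fun g AE AE.
pose gU := tensor2_fun g U U; pose gE := tensor2_fun g E E.
(* Maximality over all pairs at all points says that [f] is nowhere positive, and it vanishes at
   [p]. The lengths are kept in the formula, so [U] and [E] need not be of unit length away from
   [p]. *)
pose f := fa * gE - fb * gU - (lam - mu) *: (gU * gE).
have fE q : f q = Q (U q) (U q) (E q) (E q) - (lam - mu) * (g q (U q) (U q) * g q (E q) (E q)).
  by [].
have fmax q : f q <= f p.
  have -> : f p = 0 by rewrite fE Up Ep Que uu ee !mulr1 subrr.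
  by rewrite fE subr_le0.
have DV X V : (forall Y, D Y V p = 0) ->
    X p (tensor2_fun g V V) = 0 /\
    X p (vder X (tensor2_fun g V V)) = 2 * g p (D X (D X V) p) (V p).
  move=> DV; rewrite (metric_derive D_LC) metric_derive2 DV !tensor20l tensor20r.
  by rewrite !addr0.
have DAV X V lm : D X X p = 0 -> (forall Y, D Y V p = 0) ->
    (forall w, g p (A p (V p)) (A p w) = lm * g p (V p) w) ->
    X p (vder X (tensor2_fun g (endo_app A V) (endo_app A V))) =
    2 * (g p (C X X V p) (A p (V p)) + g p (B X V p) (B X V p) +
         lm * g p (D X (D X V) p) (V p)).
  move=> DX0 DV0 eig.
  have E1 : D X (endo_app A V) = vadd (B X V) (endo_app A (D X V)).
    by apply: vfield_eqP => q; rewrite [RHS]vaddE nabAE subrK.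
  have E2 : D X (endo_app A (D X V)) p = B X (D X V) p + A p (D X (D X V) p).
    by rewrite nabAE subrK.
  have B0 : B X (D X V) p = 0 by rewrite nabApE DV0 nabAp0r.
  have B0' : B (D X X) V p = 0 by rewrite nabApE DX0 nabAp0l.
  have E3 : D X (endo_app A V) p = B X V p.
    by rewrite E1 (vaddE (B X V)) endo_appE DV0 endo0 addr0.
  have E4 : D X (D X (endo_app A V)) p = C X X V p + A p (D X (D X V) p).
    rewrite E1 nabla_addr (vaddE (D X (B X V))) E2 B0 add0r; congr (_ + _).
    by rewrite nab2AE B0 B0' addr0 subr0.
  rewrite metric_derive2 E3 E4 tensor2Dl (gs (A p (D X (D X V) p))) eig (gs (V p)).
  by ring.
(* Because [u] and [e] are eigenvectors, the second derivatives of the fields enter only through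
   g(D_X D_X U, u) and g(D_X D_X E, e), each with coefficient 2 (lam - mu) - 2 (lam - mu) = 0. *)
have mp X : (forall Y, D Y X p = 0) ->
   X p (vder X f) = 2 * (g p (C X X U p) (A p u) + g p (B X U p) (B X U p)) -
                    2 * (g p (C X X E p) (A p e) + g p (B X E p) (B X E p)).
  move=> DX; have [gU0 gU2] := DV X U DU; have [gE0 gE2] := DV X E DE.
  have fa2 := DAV X U lam (DX X) DU; rewrite Up in fa2.
  have fb2 := DAV X E mu (DX X) DE; rewrite Ep in fb2.
  have -> : vder X f = vder X fa * gE + fa * vder X gE - (vder X fb * gU + fb * vder X gU)
      - (lam - mu) *: (vder X gU * gE + gU * vder X gE).
    apply: smooth_eqP => q.
    have -> : vder X f q = X q f by [].
    rewrite /f tangentB tangentB !tangentM tangentZ tangentM.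
    by [].
  rewrite !(tangentB, tangentD, tangentZ, tangentM).
  have vE h : vder X h p = X p h by [].
  rewrite !vE gU0 gE0 gU2 gE2 fa2 // fb2 //.
  have -> : gU p = 1 by rewrite /gU /= Up.
  have -> : gE p = 1 by rewrite /gE /= Ep.
  have -> : fa p = lam by rewrite /fa /= Up.
  have -> : fb p = mu by rewrite /fb /= Ep.
  by rewrite Up Ep; ring.
have [_ hU] := max_principle U fmax; have [_ hE] := max_principle E fmax.
rewrite (mp _ DU) in hU; rewrite (mp _ DE) in hE.
have C0 X Y : C X Y Y p = 0.
  apply: (metric_inj (g := g)) => w; rewrite tensor20l.
  have := congr1 (fun v => g p v w) (nab2A_anti K1 X Y Y p).
  by rewrite tensor2Nl; lra.
(* Since C(Y, X, X) = 0 by skewness, the Ricci identity expresses C(X, X, Y) by curvature alone. *)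
have CR X Y : C X X Y p = - (cv X Y (endo_app A X) p - A p (cv X Y X p)).
  by rewrite (nab2A_anti K1) -(nab2A_ricci g D A X Y X p) C0 subr0.
have BB X : B X X p = 0 by exact: nabA_self.
have gN (a b w : tangent p) : g p (- (a - b)) w = g p b w - g p a w.
  by rewrite tensor2Nl tensor2Dl tensor2Nl; ring.
have gNN (a : tangent p) : g p (- a) (- a) = g p a a by rewrite tensor2Nl tensor2Nr opprK.
rewrite BB !C0 !tensor20l !addr0 CR gN in hU.
rewrite BB !C0 !tensor20l !addr0 CR gN (nabA_anti K1 E U) vnegE gNN in hE.
have Asym X Y w Z : g p (A p (cv X Y Z p)) (A p w) = g p (A p w) (A p (cv X Y Z p)) by exact: gs.
rewrite Asym eigE in hU; rewrite Asym eigU in hE.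
have e1 : g p (cv E U (endo_app A E) p) (A p u) = R4 g D p E U AE AU.
  by rewrite /R4 endo_appE Up.
have e2 : g p (cv U E (endo_app A U) p) (A p e) = R4 g D p U E AU AE.
  by rewrite /R4 endo_appE Ep.
rewrite e1 in hE; rewrite e2 in hU.
have e3 : g p u (cv E U E p) = R4 g D p E U E U by rewrite /R4 Up gs.
have e4 : g p e (cv U E U p) = R4 g D p U E U E by rewrite /R4 Ep gs.
rewrite e3 in hE; rewrite e4 in hU.
(* The two tests add up to (lam - mu) R(u, e, u, e) <= 0, where R(u, e, u, e) is minus the numerator
   of the sectional curvature. *)
have s1 := R4_skew12 g D p U E AU AE; have s2 := R4_skew34 D_LC p E U AU AE.
have s3 := R4_skew12 g D p U E U E; have s4 := R4_skew34 D_LC p E U U E.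
have nz (x : tangent p) : g p x x = 1 -> x != 0.
  by move=> xx; apply: contra_eqN xx => /eqP ->; rewrite tensor20l eq_sym oner_eq0.
have sec := @sectional_neg U E p; rewrite Up Ep in sec.
have := sec (nz _ uu) (nz _ ee) ue; have s5 := R4_skew34 D_LC p U E E U; rewrite s5 => sec0.
have l0 : 0 < lam - mu by lra.
have : 0 < (lam - mu) * R4 g D p U E U E by rewrite mulr_gt0 //; lra.
have e5 : R4 g D p E U E U = R4 g D p U E U E by lra.
by rewrite e5 in hE; rewrite mulrBl; lra.
Qed.

End KillingSquare.

(** * Nearly Kähler structures *)

(* [P] is the second covariant derivative of [J], [F] its expected value and [S] the
   curvature tensor. The pair symmetry of [S] and the Ricci identity make [T := P - F]
   symmetric in its first two arguments; it is skew in its last three, so it vanishes. *)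
Section NearlyKahlerAlgebra.
Variables (R : realFieldType) (V : Type) (J : V -> V) (P F S : V -> V -> V -> V -> R).

Hypothesis P23 : forall w x y z, P w x y z = - P w y x z.
Hypothesis P34 : forall w x y z, P w x y z = - P w x z y.
Hypothesis F23 : forall w x y z, F w x y z = - F w y x z.
Hypothesis F34 : forall w x y z, F w x y z = - F w x z y.
Hypothesis PJ3 : forall w x y z, P w x (J (J y)) z = - P w x y z.
Hypothesis FJ3 : forall w x y z, F w x (J (J y)) z = - F w x y z.
Hypothesis PF : forall w x y z,
  P w x (J y) z - P w x y (J z) = F w x (J y) z - F w x y (J z).
Hypothesis F_pair : forall w x y z,
  F w x y z - F x w y z + F y z w x - F z y w x = 0.
Hypothesis F_J : forall w x y z,
  F (J w) x y z - F x (J w) y z = - (F w x (J y) z - F x w (J y) z).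
Hypothesis S12 : forall w x y z, S w x y z = - S x w y z.
Hypothesis S34 : forall w x y z, S w x y z = - S w x z y.
Hypothesis S_pair : forall w x y z, S w x y z = S y z w x.
Hypothesis S_bianchi : forall w x y z, S w x y z + S x y w z + S y w x z = 0.
Hypothesis SJ1 : forall w x y z, S (J (J w)) x y z = - S w x y z.
Hypothesis ricci : forall w x y z,
  P w x y z - P x w y z = S w x (J y) z + S w x y (J z).

Let SJ3 w x y z : S w x (J (J y)) z = - S w x y z.
Proof. by rewrite S_pair SJ1 -S_pair. Qed.

Let SJ2 w x y z : S w (J (J x)) y z = - S w x y z.
Proof. by rewrite S12 SJ1 -S12. Qed.

Let SJ4 w x y z : S w x y (J (J z)) = - S w x y z.
Proof. by rewrite S34 SJ3 -S34. Qed.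

Let P_cyc w x y z : P w x y z = P w y z x.
Proof. by rewrite P23 P34 opprK. Qed.

(** By skewness of [P] the left-hand side is invariant under cyclic permutations of [x], [y], [z].
    Expressed by the Ricci identity, the sum of its three versions vanishes by the Bianchi
    identity. *)
Let P_pair w x y z : P w x y z - P x w y z + P y z w x - P z y w x = 0.
Proof.
have sw a b c d : P a b c d = - P a d c b.
  by have := (P23 a b c d, P34 a c b d, P23 a c d b); case=> [[-> ->] ->]; rewrite !opprK.
have e1 : P w x y z - P x w y z + P y z w x - P z y w x =
          P w y z x - P y w z x + P z x w y - P x z w y.
  have := (P_cyc w x y z, P23 y w z x, sw z x w y, P_cyc x z w y).
  by case=> [[[-> ->] ->] ->]; ring.
have e2 : P w x y z - P x w y z + P y z w x - P z y w x =
          P w z x y - P z w x y + P x y w z - P y x w z.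
  have := (P_cyc w z x y, P23 z w x y, sw x y w z, P_cyc y x w z, P_cyc z y w x, P_cyc z w x y).
  have := (P_cyc z x w y, P23 z x y w, P_cyc x w y z, P_cyc x y z w, P23 x y w z, P34 x y w z).
  have := (P_cyc y z w x, P_cyc y w x z, P23 y w x z).
  move=> [[a1 a2] a3] [[[[[a4 a5] a6] a7] a8] a9] [[[[[b1 b2] b3] b4] b5] b6].
  have := (sw z y w x, sw z w x y, P34 x w y z, sw x w y z); case=> [[[c1 c2] c3] c4].
  lra.
have r1 := (ricci w x y z, ricci y z w x); have r2 := (ricci w y z x, ricci z x w y).
have r3 := (ricci w z x y, ricci x y w z).
case: r1 => [r1 r1']; case: r2 => [r2 r2']; case: r3 => [r3 r3'].
have := (S34 w x (J y) z, S34 w y (J z) x, S34 w z (J x) y).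
have := (S34 y z (J w) x, S34 z x (J w) y, S34 x y (J w) z).
have := (S_bianchi w x y (J z), S_bianchi w y z (J x), S_bianchi w z x (J y), S_bianchi x y z (J w)).
have := (S12 y w x (J z), S12 z w y (J x), S12 x w z (J y)).
move=> [[a1 a2] a3] [[[b1 b2] b3] b4] [[c1 c2] c3] [[d1 d2] d3].
lra.
Qed.

(** By the Ricci identity and pair symmetry, [P_pair] says exactly that [J], acting as a derivation,
    annihilates the curvature tensor. *)
Let S_inv w x y z : S (J w) x y z + S w (J x) y z + S w x (J y) z + S w x y (J z) = 0.
Proof.
have := (P_pair w x y z, ricci w x y z, ricci y z w x, S_pair (J w) x y z, S_pair w (J x) y z).
by move=> [[[[a1 a2] a3] a4] a5]; lra.
Qed.

Let S_J2 w x y z : S (J w) (J x) y z = S w x (J y) (J z).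
Proof.
have := (S_inv (J w) x y z, S_inv w (J x) y z, S_inv w x (J y) z, S_inv w x y (J z)).
have := (SJ1 w x y z, SJ2 w x y z, SJ3 w x y z, SJ4 w x y z).
by move=> [[[a1 a2] a3] a4] [[[b1 b2] b3] b4]; lra.
Qed.

Let P_J w x y z : P (J w) x y z - P x (J w) y z = - (P w x (J y) z - P x w (J y) z).
Proof.
have := (ricci (J w) x y z, ricci w x (J y) z, S_inv (J w) x y z, S_J2 w x y z).
have := (SJ1 w x y z, SJ3 w x y z).
by move=> [a1 a2] [[[b1 b2] b3] b4]; lra.
Qed.

Let T w x y z := P w x y z - F w x y z.

Let T23 w x y z : T w x y z = - T w y x z.
Proof. by rewrite /T P23 F23; ring. Qed.

Let T34 w x y z : T w x y z = - T w x z y.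
Proof. by rewrite /T P34 F34; ring. Qed.

Let T_cyc w x y z : T w x y z = T w y z x.
Proof. by rewrite T23 T34 opprK. Qed.

Let TJ34 w x y z : T w x (J y) z = T w x y (J z).
Proof. by have := PF w x y z; rewrite /T; lra. Qed.

Let TJ23 w x y z : T w (J x) y z = T w x (J y) z.
Proof.
rewrite (T_cyc w (J x)) (T_cyc w y) (T_cyc w x) (T_cyc w (J y)).
by rewrite -TJ34.
Qed.

Let TJJ34 w x y z : T w x (J y) (J z) = - T w x y z.
Proof. by rewrite -TJ34 /T PJ3 FJ3; ring. Qed.

Let TJJ23 w x y z : T w (J x) (J y) z = - T w x y z.
Proof. by rewrite TJ23 /T PJ3 FJ3; ring. Qed.

Let TJJ24 w x y z : T w (J x) y (J z) = - T w x y z.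
Proof. by rewrite -TJ34 TJJ23. Qed.

Let T_pair w x y z : T w x y z - T x w y z + T y z w x - T z y w x = 0.
Proof. by have := (P_pair w x y z, F_pair w x y z); rewrite /T => -[a b]; lra. Qed.

Let T_J w x y z : T (J w) x y z - T x (J w) y z = - (T w x (J y) z - T x w (J y) z).
Proof. by have := (P_J w x y z, F_J w x y z); rewrite /T => -[a b]; lra. Qed.

(** [T_pair] is evaluated with two factors [J] inserted at various places. Two factors among the
    last three arguments only change the sign, and the other terms can be eliminated. *)
Let T_JJ w x y z : T (J w) (J x) y z = - T w x y z.
Proof.
have l1 := T_pair w x y z.
have l2 := T_pair w (J x) (J y) z; have l3 := T_pair w (J x) y (J z).
have l4 := T_pair w x (J y) (J z); have l5 := T_pair (J w) (J x) y z.
have := (TJJ23 w x y z, TJJ24 z y w x, TJJ24 w x y z, TJJ24 y z w x, TJJ34 w x y z).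
have := (TJJ34 x w y z, TJJ34 y z w x, TJJ34 z y w x).
have := (TJ34 (J x) w y z, TJ23 (J x) w y z, TJ23 (J y) z w x, TJ34 (J y) z w x).
have := (TJ23 (J z) y w x, TJ34 (J z) y w x).
move=> [a1 a2] [[[b1 b2] b3] b4] [[c1 c2] c3] [[[[d1 d2] d3] d4] d5].
lra.
Qed.

Let T_J1 w x y z : T (J w) x y z = T w (J x) y z.
Proof.
have := T_JJ w (J x) y z; rewrite /T; have := (PJ3 (J w) y x z, FJ3 (J w) y x z).
have := (P23 (J w) (J (J x)) y z, F23 (J w) (J (J x)) y z, P23 (J w) x y z, F23 (J w) x y z).
by move=> [[[a1 a2] a3] a4] [b1 b2]; lra.
Qed.

(** In [T_J] every [J] can be moved to the third argument; the two sides then become opposite to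
    each other, so both vanish. Taking [J y] for [y] removes the remaining [J]. *)
Let T_swap w x y z : T w x y z = T x w y z.
Proof.
have H u v a b : T u v (J a) b = T v u (J a) b.
  have := (T_J u v a b, T_J1 u v a b, TJ23 v u a b, TJ23 u v a b).
  by move=> [[[a1 a2] a3] a4]; lra.
have := H w x (J y) z; rewrite /T !PJ3 !FJ3; lra.
Qed.

Lemma nearly_kahler_algebra w x y z : P w x y z = F w x y z.
Proof.
have : T w x y z = 0.
  have := (T_swap w x y z, T23 x w y z, T_swap x y w z, T23 y x w z, T_swap y w x z, T23 w y x z).
  by move=> [[[[[a1 a2] a3] a4] a5] a6]; lra.
by move=> /eqP; rewrite subr_eq0 => /eqP.
Qed.

End NearlyKahlerAlgebra.

(** * Higher derivatives of a nearly Kähler structure and their vanishing *)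

Section NearlyKahler.
Variables (R : realType) (n : nat) (M : smoothManifold R n) (g : metric M) (D : connection M).
Hypothesis D_LC : levi_civita g D.
Variable J : endo M.
Implicit Types (X Y Z W V U : vfield M) (p : M).
Local Notation B := (nabA D J).
Local Notation C := (nab2A D J).
Local Notation cv := (curv D).
Local Notation gs := (Defs.metric_sym g).
Local Notation b := (nabAp D J).
Local Notation JF := (endo_app J).

Hypothesis J_skew : forall p (u v : tangent p), g p (J p u) v = - g p u (J p v).
Hypothesis K1 : forall X Y Z p, g p (B X Y p) (Z p) = - g p (B Y X p) (Z p).
Hypothesis K2 : forall X Y Z p, g p (B X Y p) (Z p) = - g p (B X Z p) (Y p).
Hypothesis J_sq : forall p (u : tangent p), J p (J p u) = - u.

Let JF_sq X : JF (JF X) = vneg X.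
Proof. by apply: vfield_eqP => p; rewrite !endo_appE J_sq vnegE. Qed.

Lemma J_isom p (u v : tangent p) : g p (J p u) (J p v) = g p u v.
Proof. by rewrite J_skew J_sq tensor2Nr opprK. Qed.

Let nabJr X Y p : B X (JF Y) p = - J p (B X Y p).
Proof.
rewrite !nabAE JF_sq nabla_negr vnegE endoD endoN J_sq opprK opprD.
by rewrite addrC.
Qed.

Let bJr p (u v : tangent p) : b u (J p v) = - J p (b u v).
Proof. by have := nabJr (vext u) (vext v) p; rewrite !nabApE endo_appE !vextE. Qed.

Let banti p (u v : tangent p) : b u v = - b v u.
Proof. exact: (nabAp_anti K1). Qed.

Let bJl p (u v : tangent p) : b (J p u) v = - J p (b u v).
Proof. by rewrite banti bJr opprK (banti u v) endoN opprK. Qed.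

Let gD p (u v w : tangent p) : g p (u - v) w = g p u w - g p v w.
Proof. by rewrite tensor2Dl tensor2Nl. Qed.

Let bskew p (u v w : tangent p) : g p (b u v) w = - g p v (b u w).
Proof. exact: (nabAp_skew K2). Qed.

Let Gp p (w x y : tangent p) : tangent p := b w (b x y) - b y (b w x) + b x (b w y).

Let F p (w x y z : tangent p) : R := 2^-1 * g p (J p (Gp w x y)) z.

Let Jsw p (u v : tangent p) : g p u (J p v) = - g p v (J p u).
Proof. by rewrite gs J_skew. Qed.

(** In this form [F] is a cyclic sum over its last three arguments, which makes its skewness in them
    visible. *)
Let FE p (w x y z : tangent p) : F w x y z = - 2^-1 *
  (g p (b x y) (J p (b w z)) + g p (b y z) (J p (b w x)) + g p (b z x) (J p (b w y))).
Proof.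
have mv (a c d : tangent p) : g p (J p (b a c)) d = - g p c (J p (b a d)).
  by rewrite J_skew bskew bJr tensor2Nr !opprK.
rewrite /F /Gp !(endoD, endoN) !(tensor2Dl, tensor2Nl) !mv.
rewrite (Jsw (b w x)) (banti x z) endoN tensor2Nr (Jsw (b w y)); ring.
Qed.

Let F23 p (w x y z : tangent p) : F w x y z = - F w y x z.
Proof. by rewrite !FE (banti y x) (banti x z) (banti z y) !tensor2Nl; ring. Qed.

Let F34 p (w x y z : tangent p) : F w x y z = - F w x z y.
Proof. by rewrite !FE (banti y x) (banti x z) (banti z y) !tensor2Nl; ring. Qed.

(** In the difference of the two cyclic sums, the term with [b w x] doubles and the other two
    cancel. The result changes sign when the pairs (w, x) and (y, z) are exchanged, which gives the
    pair condition on [F]. *)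
Let rhoE p (w x y z : tangent p) : F w x y z - F x w y z = - g p (b y z) (J p (b w x)).
Proof.
rewrite !FE (banti x w) endoN tensor2Nr (Jsw (b w y) (b x z)) (banti x z).
by rewrite (banti z w) !tensor2Nl (Jsw (b w z) (b x y)); field.
Qed.

Let S p (W X Y Z : vfield M) : R := R4 g D p W X Y Z.
Let P p (W X Y Z : vfield M) : R := g p (C W X Y p) (Z p).
Let FF p (W X Y Z : vfield M) : R := F (W p) (X p) (Y p) (Z p).

(** The covariant derivative of the identity B_X (J Y) = - J (B_X Y). *)
Let nab2J W X Y p : C W X (JF Y) p =
  - J p (C W X Y p) - b (W p) (b (X p) (Y p)) - b (X p) (b (W p) (Y p)).
Proof.
have E : B X (JF Y) = vneg (JF (B X Y)).
  by apply: vfield_eqP => q; rewrite nabJr vnegE.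
have E1 : D W (JF (B X Y)) p = B W (B X Y) p + J p (D W (B X Y) p) by rewrite nabAE subrK.
have E2 : D W (JF Y) = vadd (B W Y) (JF (D W Y)).
  by apply: vfield_eqP => q; rewrite [RHS]vaddE nabAE subrK.
rewrite !nab2AE E nabla_negr vnegE E1 nabJr E2 nabA_addr (vaddE (B X (B W Y))) nabJr.
rewrite !(nabApE D J _ (B _ _)) !nabApE endoD endoN endoD.
apply: (metric_inj (g := g)) => z; rewrite !(tensor2Dl, tensor2Nl); ring.
Qed.

Lemma nearly_kahler_nab2 W X Y p : C W X Y p = 2^-1 *: J p (Gp (W p) (X p) (Y p)).
Proof.
apply: (metric_inj (g := g)) => z; rewrite tensor2Zl -(vextE z).
apply: (@nearly_kahler_algebra _ _ JF (P p) (FF p) (S p)) => {z} w x y z.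
- by rewrite /P (nab2A_anti K1) tensor2Nl.
- by rewrite /P (nab2A_skew D_LC K2).
- by rewrite /FF F23.
- by rewrite /FF F34.
- by rewrite /P JF_sq nab2A_neg3 vnegE tensor2Nl.
- by rewrite /FF !endo_appE J_sq !FE !(nabApNl, nabApNr, endoN, tensor2Nl, tensor2Nr); ring.
- rewrite /P nab2J !(tensor2Dl, tensor2Nl) endo_appE J_skew /FF /F !endo_appE J_isom /Gp.
  rewrite !(bJr, bJl, nabApNr, nabApNl, endoN, endoD, J_sq, opprK).
  rewrite !(tensor2Dl, tensor2Nl); by field.
- have := (rhoE (w p) (x p) (y p) (z p), rhoE (y p) (z p) (w p) (x p),
    Jsw (b (w p) (x p)) (b (y p) (z p))).
  by move=> [[e1 e2] e3]; rewrite /FF; lra.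
- by rewrite /FF !rhoE !endo_appE !bJl endoN J_sq opprK tensor2Nl J_isom; ring.
- exact: R4_skew12.
- exact: R4_skew34.
- exact: R4_pair.
- exact: R4_bianchi.
- rewrite /S JF_sq /R4 /curv !(nabla_negl, nabla_negr) !vlin; ring.
- have := congr1 (fun v => g p v (z p)) (nab2A_ricci g D J w x y p).
  by rewrite !gD J_skew opprK /P /S /R4 endo_appE.
Qed.

Lemma nearly_kahler_ricci W X Y Z p :
  R4 g D p W X (JF Y) Z + R4 g D p W X Y (JF Z) =
  - g p (b (Y p) (Z p)) (J p (b (W p) (X p))).
Proof.
have := congr1 (fun v => g p v (Z p)) (nab2A_ricci g D J W X Y p).
rewrite !gD J_skew opprK !nearly_kahler_nab2 !tensor2Zl.
by rewrite -/(F (W p) (X p) (Y p) (Z p)) -/(F (X p) (W p) (Y p) (Z p)) rhoE /R4 endo_appE.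
Qed.

(* (nabla_V (nabla (nabla J)))(W, X, Y) *)
Definition nab3 V W X Y p : tangent p :=
  D V (C W X Y) p - (C (D V W) X Y p + C W (D V X) Y p + C W X (D V Y) p).

Lemma nab3_ricci V W X Y p : nab3 V W X Y p - nab3 W V X Y p =
  cv V W (B X Y) p - B (cv V W X) Y p - B X (cv V W Y) p.
Proof.
apply: (metric_inj (g := g)) => w; rewrite /nab3 /nab2A /curv.
rewrite !(nabla_addr, nabla_negr, nabA_addl, nabA_addr, nabA_negl, nabA_negr) !vlin.
ring.
Qed.

Lemma nabla_nabA V X Y p :
  D V (B X Y) p = C V X Y p + b (D V X p) (Y p) + b (X p) (D V Y p).
Proof. by rewrite nab2AE !nabApE -addrA subrK. Qed.

Let Cp p (w x y : tangent p) : tangent p := 2^-1 *: J p (Gp w x y).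

Let CE W X Y p : C W X Y p = Cp (W p) (X p) (Y p).
Proof. exact: nearly_kahler_nab2. Qed.

Lemma nabla_endo V Z p : D V (JF Z) p = b (V p) (Z p) + J p (D V Z p).
Proof. by rewrite -nabApE nabAE subrK. Qed.

(** The pointwise formula, restated for fields so that it can be differentiated once more. *)
Let C_field W X Y : C W X Y = vscale (scst M 2^-1) (JF
  (vadd (vadd (B W (B X Y)) (vneg (B Y (B W X)))) (B X (B W Y)))).
Proof.
apply: vfield_eqP => p; rewrite CE vscaleE endo_appE; congr (_ *: J p _).
rewrite [RHS]vaddE [X in X + _]vaddE [X in _ + X + _]vnegE !(nabApE D J _ (B _ _)).
by rewrite !nabApE.
Qed.

(** The product rule yields derivatives of [b], which are again given by [Cp]; the terms with
    derivatives of the fields cancel, so the result is an algebraic expression at [p]. *)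
Lemma nab3E V W X Y p : let: (v, w, x, y) := (V p, W p, X p, Y p) in
  nab3 V W X Y p = 2^-1 *: (b v (Gp w x y) + J p
    (Cp v w (b x y) + b w (Cp v x y) - Cp v y (b w x) - b y (Cp v w x)
      + Cp v x (b w y) + b x (Cp v w y))).
Proof.
rewrite /nab3 !CE C_field nabla_cst.
have L (X1 X2 X3 : vfield M) : vadd (vadd X1 (vneg X2)) X3 p = X1 p - X2 p + X3 p.
  by rewrite [LHS]vaddE [X in X + _]vaddE [X in _ + X + _]vnegE.
have DN : forall X1 X2 X3 : vfield M,
    D V (vadd (vadd X1 (vneg X2)) X3) p = D V X1 p - D V X2 p + D V X3 p.
  by move=> X1 X2 X3; rewrite !nabla_addr nabla_negr L.
rewrite nabla_endo (DN (B W (B X Y))) (L (B W (B X Y))) !(nabApE D J _ (B _ _)).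
rewrite !nabla_nabA !CE !nabApE -/(Gp (W p) (X p) (Y p)) /Cp.
apply: (metric_inj (g := g)) => z; rewrite /Gp.
rewrite !(nabApDl, nabApDr, nabApNl, nabApNr, nabApZl, nabApZr, 
  endoD, endoN, endoZ, tensor2Dl, tensor2Nl, tensor2Zl).
by field.
Qed.

Hypothesis M_compact : compact [set: M].
Hypothesis g_negative : negative_sectional_curvature g D.

(** The Bianchi identity splits the left-hand side into two mixed curvatures, and
    [nearly_kahler_ricci] moves [J] across each of them at the cost of one term |B_X Y|^2. *)
Lemma bisectional X Y p : R4 g D p X (JF X) Y (JF Y) =
  2 * g p (b (X p) (Y p)) (b (X p) (Y p)) - R4 g D p X Y Y X - R4 g D p (JF X) Y Y (JF X).
Proof.
have e1 := R4_bianchi D_LC p X (JF X) Y (JF Y).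
have e2 := nearly_kahler_ricci Y X X (JF Y) p.
have e3 := nearly_kahler_ricci (JF X) Y X Y p.
have e4 := R4_skew12 g D p Y X X Y.
have e5 := R4_skew34 D_LC p X Y X Y.
have e6 := R4_skew34 D_LC p (JF X) Y (JF X) Y.
have e7 : R4 g D p Y X X (JF (JF Y)) = - R4 g D p Y X X Y.
  by rewrite JF_sq /R4 vnegE tensor2Nr.
move: e2 e3; rewrite !endo_appE !bJr !bJl (banti (Y p)) !(endoN, tensor2Nl, tensor2Nr) !J_sq.
rewrite !tensor2Nr !J_isom; lra.
Qed.

Lemma nab3_curvature p (x y : tangent p) (m : R) :
    b x (b x y) = - m *: y -> b y (b x y) = m *: x -> g p y y = 1 -> g p (b x y) (b x y) = m ->
  let X := vext x in let Y := vext y in let Z := B X Y in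
  m * (R4 g D p X (JF X) X (JF X) + R4 g D p X (JF X) Y (JF Y)) + R4 g D p X (JF X) Z (JF Z) =
    - m ^+ 2.
Proof.
move=> bxz byz yy zz X Y Z; set z := b x y in bxz byz zz *.
have Xp : X p = x by rewrite vextE.
have Yp : Y p = y by rewrite vextE.
have Zp : Z p = z by rewrite /Z nabApE Xp Yp.
have bxx : b x x = 0 by rewrite -Xp -nabApE (nabA_self K1).
have byy : b y y = 0 by rewrite -Yp -nabApE (nabA_self K1).
have bzz : b z z = 0 by rewrite -Zp -nabApE (nabA_self K1).
have byx : b y x = - z by rewrite banti.
have bzx : b z x = m *: y by rewrite banti bxz scaleNr opprK.
have bzy : b z y = - (m *: x) by rewrite banti byz.
have bxz' : b x z = - (m *: y) by rewrite bxz scaleNr.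
(* Up to [J], the span of [x], [y], [z] is closed under [b], so the products listed above evaluate
   the whole cubic expression. *)
have vw : nab3 X (JF X) X Y p - nab3 (JF X) X X Y p = - m *: J p z.
  rewrite !nab3E !endo_appE Xp Yp /Cp /Gp.
  apply: (metric_inj (g := g)) => w.
  do ! rewrite ?(bJl, bJr, J_sq, bxx, byy, bzz, byx, bzx, bzy, bxz', byz,
    endoN, endoD, endoZ, endo0, nabApNl, nabApNr, nabAp0l, nabAp0r, nabApDl, nabApDr, nabApZl, nabApZr,
    opprK, oppr0, addr0, add0r) -/z.
  by rewrite !(tensor2Dl, tensor2Nl, tensor2Zl, tensor20l); field.
have := congr1 (fun w => g p w (J p z)) (nab3_ricci X (JF X) X Y p).
rewrite vw !gD tensor2Zl J_isom zz !nabApE Xp Yp.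
rewrite banti tensor2Nl (bskew y) bJr byz endoZ.
rewrite (bskew x) bJr bxz' endoN endoZ !(tensor2Nr, tensor2Zr).
rewrite /R4 !endo_appE Xp Yp Zp -/Z; lra.
Qed.

Lemma nearly_kahler_parallel : (exists (p : M) (u : tangent p), u != 0) ->
  forall p (u v : tangent p), b u v = 0.
Proof.
move=> ne.
pose Q p (x x' y y' : tangent p) := g p (b x y) (b x' y').
have Q1 p a (u v x y z : tangent p) : Q p (a *: u + v) x y z = a * Q p u x y z + Q p v x y z.
  by rewrite /Q nabAp_linearl !tensor2_linearl; ring.
have Q2 p a (u v x y z : tangent p) : Q p x (a *: u + v) y z = a * Q p x u y z + Q p x v y z.
  by rewrite /Q nabAp_linearl !tensor2_linearr; ring.
have Q3 p a (u v x y z : tangent p) : Q p x y (a *: u + v) z = a * Q p x y u z + Q p x y v z.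
  by rewrite /Q nabAp_linearr !tensor2_linearl; ring.
have Q4 p a (u v x y z : tangent p) : Q p x y z (a *: u + v) = a * Q p x y z u + Q p x y z v.
  by rewrite /Q nabAp_linearr !tensor2_linearr; ring.
have Qc X Y Z W : continuous (fun p => Q p (X p) (Y p) (Z p) (W p)).
  suff -> : (fun p => Q p (X p) (Y p) (Z p) (W p)) = tensor2_fun g (B X Z) (B Y W) :> (M -> R).
    exact: smooth_continuous (smoothFunP _).
  by apply/funext => q; rewrite /Q -(nabApE D J X) -nabApE.
have [p [u [v [uu vv umax]]]] := biquadratic_max g Q1 Q2 Q3 Q4 Qc M_compact ne.
set z := b u v; set m := Q p u u v v in umax.
have zz : g p z z = m by [].
have [m0|m0] := leP m 0.
  move=> q x y; apply: (metric_eq0 (g := g)); apply/le_anti; rewrite metric_ge0 andbT.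
  by apply: le_trans (umax q x y) _; rewrite mulr_le0_ge0 // mulr_ge0 // metric_ge0.
exfalso.
(* First variation of |b u y|^2 <= m |y|^2 at y = v; [bvz] comes from varying the first vector
   instead. *)
have buz : b u z = - m *: v.
  apply: (metric_inj (g := g)) => w; rewrite bskew tensor2Zl mulNr; congr (- _).
  have H x : g p (b u x) (b u x) <= m * g p x x.
    by have := umax p u x; rewrite uu mul1r.
  have : forall t, 0 <= t * (2 * (m * g p v w - g p z (b u w))) +
      t ^+ 2 * (m * g p w w - g p (b u w) (b u w)).
    move=> t; have := H (v + t *: w).
    rewrite nabApDr nabApZr -/z !(tensor2Dl, tensor2Dr, tensor2Zl, tensor2Zr) vv zz.
    rewrite (gs (b u w) z) (gs w v); lra.
  by move=> /linear_coef_eq0; lra.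
have bvz : b v z = m *: u.
  apply: (metric_inj (g := g)) => w; rewrite bskew tensor2Zl (banti v w) tensor2Nr opprK.
  have H x : g p (b x v) (b x v) <= m * g p x x.
    by have := umax p x v; rewrite vv mulr1.
  have : forall t, 0 <= t * (2 * (m * g p u w - g p z (b w v))) +
      t ^+ 2 * (m * g p w w - g p (b w v) (b w v)).
    move=> t; have := H (u + t *: w).
    rewrite nabApDl nabApZl -/z !(tensor2Dl, tensor2Dr, tensor2Zl, tensor2Zr) uu zz.
    rewrite (gs (b w v) z) (gs w u); lra.
  by move=> /linear_coef_eq0; lra.
have E := nab3_curvature buz bvz vv zz; move: E => /=.
set X := vext u; set Y := vext v; set Z := B X Y.
have Xp : X p = u by rewrite vextE.
have Yp : Y p = v by rewrite vextE.
have Zp : Z p = z by rewrite /Z nabApE Xp Yp.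
have buu : b u u = 0 by rewrite -Xp -nabApE (nabA_self K1).
have ux t : g p u (b u t) = 0.
  by have := bskew u u t; rewrite buu tensor20l => /eqP; rewrite eq_sym oppr_eq0 => /eqP.
have Jux t : g p (J p u) (b u t) = 0.
  have := bskew u (J p u) t; rewrite bJr buu endo0 oppr0 tensor20l => /eqP.
  by rewrite eq_sym oppr_eq0 => /eqP.
(* [v] and [z] are both values of [b u], and these are orthogonal to [u] and to [J p u]: this is the
   orthogonality needed for four of the sectional curvatures. *)
have vE : v = b u (- m^-1 *: z).
  by rewrite nabApZr buz scalerA mulrNN mulVf ?scale1r // gt_eqF.
have nz (t : tangent p) : 0 < g p t t -> t != 0.
  by apply: contraTneq => ->; rewrite tensor20l ltxx.
have u0 : u != 0 by apply: nz; rewrite uu ltr01.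
have v0 : v != 0 by apply: nz; rewrite vv ltr01.
have z0 : z != 0 by apply: nz; rewrite zz.
have Ju0 : J p u != 0 by apply: nz; rewrite J_isom uu ltr01.
have s1 : R4 g D p X (JF X) (JF X) X < 0.
  apply: sectional_neg => //; rewrite ?endo_appE Xp //.
  by have := J_skew u u; rewrite (gs (J p u)); lra.
have s2 : R4 g D p X Y Y X < 0 by apply: sectional_neg => //; rewrite ?Xp ?Yp // vE ux.
have s3 : R4 g D p (JF X) Y Y (JF X) < 0.
  by apply: sectional_neg => //; rewrite ?endo_appE ?Xp ?Yp // vE Jux.
have s4 : R4 g D p X Z Z X < 0 by apply: sectional_neg => //; rewrite ?Xp ?Zp // ux.
have s5 : R4 g D p (JF X) Z Z (JF X) < 0.
  by apply: sectional_neg => //; rewrite ?endo_appE ?Xp ?Zp // Jux.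
rewrite (bisectional X Y) (bisectional X Z) (R4_skew34 D_LC p X (JF X) X (JF X)).
rewrite Xp Yp Zp -/z zz buz tensor2Zl tensor2Zr vv mulr1 mulrNN.
have key (a1 a2 a3 a4 a5 c : R) : 0 < c -> a1 < 0 -> a2 < 0 -> a3 < 0 -> a4 < 0 -> a5 < 0 ->
    c * (- a1 + (2 * c - a2 - a3)) + (2 * (c * c) - a4 - a5) <> - c ^+ 2.
  move=> c0 h1 h2 h3 h4 h5; have := mulr_gt0 c0 c0.
  have cneg (a : R) : a < 0 -> c * a < 0 by rewrite (pmulr_rlt0 _ c0).
  have := (cneg _ h1, cneg _ h2, cneg _ h3) => -[[? ?] ?]; lra.
exact: (key _ _ _ _ _ _ m0 s1 s2 s3 s4 s5).
Qed.

End NearlyKahler.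

(** * Killing forms in negative curvature *)

Section KillingSquareConstant.
Variables (R : realType) (n : nat) (M : smoothManifold R n) (g : metric M) (D : connection M).
Hypothesis D_LC : levi_civita g D.
Variable A : endo M.
Hypothesis K1 : forall (X Y Z : vfield M) p, g p (nabA D A X Y p) (Z p) = - g p (nabA D A Y X p) (Z p).
Hypotheses (M_compact : compact [set: M]) (M_connected : connected [set: M]).
Hypothesis g_negative : negative_sectional_curvature g D.
Hypothesis nonzero : exists (p : M) (u : tangent p), u != 0.
Local Notation gs := (Defs.metric_sym g).

Lemma killing_square_constant :
  exists lam : R, forall p (x y : tangent p), g p (A p x) (A p y) = lam * g p x y.
Proof.
have prop := killing_square_proportional D_LC K1 M_compact g_negative nonzero.
have [p0 [u0 u0n]] := nonzero.
(* The vectors [x q] are chosen without any continuity. As the ratio is the same for all non-zero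
   vectors at [q], a smooth field that is non-zero at [p] shows that [phi] is smooth near [p]. *)
pose x q := projT1 (cid (nonzero_tangent u0n q)).
have xn q : x q != 0 by rewrite /x; case: cid.
have xx q : g q (x q) (x q) != 0 by rewrite gt_eqF // metric_pos.
pose phi q := g q (A q (x q)) (A q (x q)) / g q (x q) (x q).
have phiE q (u : tangent q) : g q (A q u) (A q u) = phi q * g q u u.
  by rewrite /phi mulrAC -prop mulfK.
have sphi : smooth phi.
  apply: smooth_div => p; pose X := vext (x p).
  exists (tensor2_fun g X X), (tensor2_fun g (endo_app A X) (endo_app A X)); split.
    by rewrite /tensor2_fun /= vextE.
  by move=> q; rewrite mulrC -phiE.
have phi2 q (u v : tangent q) : g q (A q u) (A q v) = phi q * g q u v.
  have := phiE q (u + v); rewrite endoD !(tensor2Dl, tensor2Dr) !phiE.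
  by rewrite (gs v u) (gs (A q v)); lra.
pose lam := mkSmooth sphi.
have dlam q (v : tangent q) : v lam = 0.
  have [->//|v0] := eqVneq v 0.
  pose V := vext v; have Vq : V q = v by rewrite vextE.
  have E : tensor2_fun g (endo_app A V) (endo_app A V) = lam * tensor2_fun g V V.
    by apply: smooth_eqP => r; exact: phiE.
  have := congr1 (V q) E; rewrite tangentM !(metric_derive D_LC).
  have DA : D V (endo_app A V) q = A q (D V V q).
    have := nabA_self K1 V q.
    by rewrite nabAE => /eqP; rewrite subr_eq0 => /eqP.
  rewrite DA !endo_appE !phi2 -[lam q]/(phi q) -[tensor2_fun g V V q]/(g q (V q) (V q)) Vq.
  move=> E2; have /eqP : v lam * g q v v = 0 by lra.
  by rewrite mulf_eq0 => /orP[/eqP//|]; rewrite gt_eqF // metric_pos.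
exists (phi p0) => p y z; rewrite phi2; congr (_ * _).
exact: (constant_of_derivative0 (f := lam)).
Qed.

End KillingSquareConstant.

Section ScaledEndo.
Variables (R : realType) (n : nat) (M : smoothManifold R n) (c : R) (A : endo M).

Lemma endo_scaled_linear p a (u v : tangent p) :
  c *: A p (a *: u + v) = a *: (c *: A p u) + c *: A p v.
Proof. by rewrite endo_linear scalerDr !scalerA mulrC. Qed.

Lemma endo_scaled_smooth (X : vfield M) : smooth_field (fun p => c *: A p (X p)).
Proof. exact: (vfieldP (vscale (scst M c) (endo_app A X))). Qed.

Definition endo_scaled : endo M := Endo endo_scaled_linear endo_scaled_smooth.

Lemma endo_scaledE p (u : tangent p) : endo_scaled p u = c *: A p u.
Proof. by []. Qed.

Lemma nabA_scaled (D : connection M) X Y p :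
  nabA D endo_scaled X Y p = c *: nabA D A X Y p.
Proof.
rewrite !nabAE scalerBr endo_scaledE; congr (_ - _).
rewrite (_ : endo_app _ _ = vscale (scst M c) (endo_app A Y)) ?nabla_cst //.
exact: vfield_eqP.
Qed.

End ScaledEndo.

Theorem proposition4p2 (R : realType) (n : nat) (M : smoothManifold R n)
    (g : metric M) (D : connection M) (omega : form2 M)
    (M_compact : compact [set: M]) (M_connected : connected [set: M])
    (D_levi_civita : levi_civita g D)
    (g_negative : negative_sectional_curvature g D)
    (omega_Killing : Killing2 D omega)
    (omega_neq0 : exists (p : M) (u v : tangent p), omega p u v != 0) :
  parallel2 D omega /\
  exists c : R, c != 0 /\
    exists J : endo M, Kahler g D J /\
      forall (p : M) (u v : tangent p), c * omega p u v = g p (J p u) v.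
Proof.
have [A AE] := endo_of_form g omega.
have omegaN p (u v : tangent p) : omega p u v = - omega p v u.
  have := form2_alternating omega (u + v); rewrite !(tensor2Dl, tensor2Dr) !form2_alternating.
  lra.
have A_skew p (u v : tangent p) : g p (A p u) v = - g p u (A p v).
  by rewrite (Defs.metric_sym g u) !AE omegaN.
have nabE (X Y Z : vfield M) p : g p (nabA D A X Y p) (Z p) = nabla_tensor2 D omega X Y Z p.
  have E : tensor2_fun omega Y Z = tensor2_fun g (endo_app A Y) Z.
    by apply: smooth_eqP => q; rewrite -[LHS]AE.
  rewrite /nabla_tensor2 E (metric_derive D_levi_civita) nabAE tensor2Dl tensor2Nl.
  by rewrite endo_appE !AE; ring.
have K1 (X Y Z : vfield M) p : g p (nabA D A X Y p) (Z p) = - g p (nabA D A Y X p) (Z p).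
  by rewrite !nabE (omega_Killing X Y Z p).1.
have K2 (X Y Z : vfield M) p : g p (nabA D A X Y p) (Z p) = - g p (nabA D A X Z p) (Y p).
  by rewrite !nabE (omega_Killing X Y Z p).2.
have [p0 [u0 [v0 om0]]] := omega_neq0.
have Au0 : A p0 u0 != 0 by apply: contraNneq om0 => E; rewrite -AE E tensor20l.
have u0n : u0 != 0 by apply: contraNneq Au0 => ->; rewrite endo0.
have ne : exists (p : M) (u : tangent p), u != 0 by exists p0, u0.
have [lam lamE] := killing_square_constant D_levi_civita K1 M_compact M_connected g_negative ne.
(* [omega] is only known to be non-zero at [p0]; as [lam] is constant, that point decides its sign
   everywhere. *)
have lam0 : 0 < lam.
  have := metric_pos g Au0; rewrite lamE.
  by rewrite pmulr_lgt0 // metric_pos.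
pose c := (Num.sqrt lam)^-1.
have c0 : c != 0 by rewrite invr_eq0 gt_eqF // sqrtr_gt0.
have cc : c * c * lam = 1.
  by rewrite -invfM -expr2 sqr_sqrtr ?ltW // mulVf // gt_eqF.
have A_sq p (u : tangent p) : A p (A p u) = - (lam *: u).
  apply: (metric_inj (g := g)) => w.
  by rewrite A_skew lamE tensor2Nl tensor2Zl.
pose J := endo_scaled c A.
have J_skew p (u v : tangent p) : g p (J p u) v = - g p u (J p v).
  by rewrite !endo_scaledE tensor2Zl tensor2Zr A_skew mulrN.
have J_sq p (u : tangent p) : J p (J p u) = - u.
  by rewrite !endo_scaledE endoZ A_sq !scalerN !scalerA cc scale1r.
have JK1 (X Y Z : vfield M) p : g p (nabA D J X Y p) (Z p) = - g p (nabA D J Y X p) (Z p).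
  by rewrite !nabA_scaled !tensor2Zl K1 mulrN.
have JK2 (X Y Z : vfield M) p : g p (nabA D J X Y p) (Z p) = - g p (nabA D J X Z p) (Y p).
  by rewrite !nabA_scaled !tensor2Zl K2 mulrN.
have J0 (X Y : vfield M) p : nabA D J X Y p = 0.
  by rewrite nabApE (nearly_kahler_parallel D_levi_civita J_skew JK1 JK2 J_sq).
split.
  move=> X Y Z p; rewrite -nabE; have /eqP := J0 X Y p.
  by rewrite nabA_scaled scaler_eq0 (negbTE c0) => /eqP ->; rewrite tensor20l.
exists c; split=> //; exists J; split; last first.
  by move=> p u v; rewrite endo_scaledE tensor2Zl AE.
split=> [//|p u v|X Y p]; first exact: J_isom.
by rewrite -nabAE J0.
Qed.
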